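(* Let $(\mathbf{Y}_n,\mathbf{X}_n)\overset{d}{=}R_n\,\mathbf{S}_{q+p}$, $n\in\mathbb{N}$, be a sequence of $(q+p)$-dimensional $\ell_1$-norm symmetric random vectors and let $(\mathbf{Y},\mathbf{X})\overset{d}{=}R\,\mathbf{S}_{q+p}$ be $\ell_1$-norm symmetric, with $\mathbf{Y}_n=(Y_{1,n},\dots,Y_{q,n})$ and $\mathbf{Y}=(Y_1,\dots,Y_q)$. Assume that the distribution functions $F_{R_n}$ and $F_R$ are continuous with $F_{R_n}(0)=F_R(0)=0$ for all $n\in\mathbb{N}$. If $R_n\to R$ in distribution, then: (a) the Markov product of $(Y_{1,n},\mathbf{X}_n)$ converges weakly to the Markov product of $(Y_1,\mathbf{X})$, and, for all $i\in\{2,\dots,q\}$, the Markov product of $(Y_{i,n},(Y_{1,n},\dots,Y_{i-1,n},\mathbf{X}_n))$ converges weakly to the Markov product of $(Y_i,(Y_1,\dots,Y_{i-1},\mathbf{X}))$ and the Markov product of $(Y_{i,n},(Y_{1,n},\dots,Y_{i-1,n}))$ converges weakly to the Markov product of $(Y_i,(Y_1,\dots,Y_{i-1}))$; (b) $(F_{Y_{i,n}}\circ F_{Y_{i,n}}^{-1})(t)\to(F_{Y_i}\circ F_{Y_i}^{-1})(t)$ as $n\to\infty$ for Lebesgue-almost all $t\in(0,1)$ and all $i\in\{1,\dots,q\}$; and thus $T(\mathbf{Y}_n,\mathbf{X}_n)\to T(\mathbf{Y},\mathbf{X})$.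
   Context: $\mathbf{S}_d$ denotes a $d$-variate random vector uniformly distributed on the unit simplex $\{\mathbf{x}\in[0,\infty)^d:\|\mathbf{x}\|_1=1\}$. A $d$-variate random vector $\mathbf{W}$ follows an $\ell_1$-norm symmetric distribution if there exists a nonnegative random variable $R$ independent of $\mathbf{S}_d$ such that $\mathbf{W}\overset{d}{=}R\,\mathbf{S}_d$; in the representations above, $R_n$ and $R$ are such nonnegative random variables. The Markov product of a random vector $(Y,\mathbf{Z})$ ($Y$ real-valued) is the distribution of $(Y,Y')$, where the conditional distribution of $Y'$ given $\mathbf{Z}=\mathbf{z}$ equals that of $Y$ given $\mathbf{Z}=\mathbf{z}$ for $P^{\mathbf{Z}}$-almost all $\mathbf{z}$, and $Y$ and $Y'$ are conditionally independent given $\mathbf{Z}$. $F_Y$ is the distribution function of $Y$ and $F_Y^{-1}(t)=\inf\{y:F_Y(y)\ge t\}$ its generalized inverse. For a non-degenerate real random variable $Y$ and a random vector $\mathbf{X}$, $$\xi(Y,\mathbf{X}):=\frac{\int_{\mathbb{R}}\mathrm{Var}(P(Y\ge y\mid\mathbf{X}))\,\mathrm{d}P^Y(y)}{\int_{\mathbb{R}}\mathrm{Var}(\mathbf{1}_{\{Y\ge y\}})\,\mathrm{d}P^Y(y)},$$ and for $\mathbf{Y}=(Y_1,\dots,Y_q)$ with non-degenerate components, $$T(\mathbf{Y},\mathbf{X}):=1-\frac{q-\sum_{i=1}^q\xi(Y_i,(\mathbf{X},Y_{i-1},\dots,Y_1))}{q-\sum_{i=1}^q\xi(Y_i,(Y_{i-1},\dots,Y_1))},\qquad\xi(Y_1,\emptyset):=0.$$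 *)

(* Defs.v *)
From HB Require Import structures.
From mathcomp Require Import all_boot all_order all_algebra.
From mathcomp Require Import all_classical all_reals all_analysis.
From mathcomp Require Import measurable_realfun.

Set Implicit Arguments.
Unset Strict Implicit.
Unset Printing Implicit Defensive.

Import Order.TTheory GRing.Theory Num.Theory.
Import numFieldNormedType.Exports.

Local Open Scope classical_set_scope.
Local Open Scope ring_scope.

Section random_vectors.
Context {d : measure_display} {T : measurableType d} {R : realType}.

Definition component_fun n (V : T -> n.-tuple R) (i : 'I_n) : T -> R :=
  fun w => tnth (V w) i.

Definition subvector_fun n k (V : T -> n.-tuple R) (f : 'I_k -> 'I_n) :
  T -> k.-tuple R := fun w => [tuple tnth (V w) (f j) | j < k].

Definition join_vector_fun m n (U : T -> m.-tuple R) (V : T -> n.-tuple R) :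
  T -> (m + n).-tuple R := fun w => cat_tuple (U w) (V w).

Lemma measurable_component n (V : {mfun T >-> n.-tuple R}) i :
  measurable_fun [set: T] (component_fun V i).
Proof.
apply: (measurableT_comp (measurable_tnth i)); exact: measurable_funPT.
Qed.

HB.instance Definition _ n (V : {mfun T >-> n.-tuple R}) i :=
  isMeasurableFun.Build _ _ _ _ (component_fun V i) (measurable_component V i).

Lemma measurable_subvector n k (V : {mfun T >-> n.-tuple R})
    (f : 'I_k -> 'I_n) : measurable_fun [set: T] (subvector_fun V f).
Proof.
apply/measurable_fun_tnthP => j.
rewrite (_ : _ \o _ = component_fun V (f j)).
  exact: measurable_component.
by apply/funext => w /=; rewrite tnth_mktuple.
Qed.

HB.instance Definition _ n k (V : {mfun T >-> n.-tuple R}) (f : 'I_k -> 'I_n) :=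
  isMeasurableFun.Build _ _ _ _ (subvector_fun V f) (measurable_subvector V f).

Lemma measurable_join_vector m n (U : {mfun T >-> m.-tuple R})
    (V : {mfun T >-> n.-tuple R}) : measurable_fun [set: T] (join_vector_fun U V).
Proof.
apply/measurable_fun_tnthP => j; case: (split_ordP j) => k ->.
- rewrite (_ : _ \o _ = component_fun U k); first exact: measurable_component.
  by apply/funext => w /=; rewrite tnth_lshift.
- rewrite (_ : _ \o _ = component_fun V k); first exact: measurable_component.
  by apply/funext => w /=; rewrite tnth_rshift.
Qed.

HB.instance Definition _ m n (U : {mfun T >-> m.-tuple R})
    (V : {mfun T >-> n.-tuple R}) :=
  isMeasurableFun.Build _ _ _ _ (join_vector_fun U V)
    (measurable_join_vector U V).

Context {P : probability T R}.

Definition component n (V : {RV P >-> n.-tuple R}) (i : 'I_n) : {RV P >-> R} :=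
  component_fun V i.

Definition subvector n k (V : {RV P >-> n.-tuple R}) (f : 'I_k -> 'I_n) :
  {RV P >-> k.-tuple R} := subvector_fun V f.

Definition join_vector m n (U : {RV P >-> m.-tuple R})
    (V : {RV P >-> n.-tuple R}) : {RV P >-> (m + n).-tuple R} :=
  join_vector_fun U V.

(* Components are numbered from 0, so that [preceding V i] has length i. *)
Definition preceding n (V : {RV P >-> n.-tuple R}) (i : 'I_n) :
    {RV P >-> i.-tuple R} :=
  subvector V (widen_ord (ltnW (ltn_ord i))).

Definition preceding_rev n (V : {RV P >-> n.-tuple R}) (i : 'I_n) :
    {RV P >-> i.-tuple R} :=
  subvector V (widen_ord (ltnW (ltn_ord i)) \o @rev_ord i).

End random_vectors.

Section laws.
Context {R : realType}.

Definition eq_in_law d1 (T1 : measurableType d1) (P1 : probability T1 R)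
    d2 (T2 : measurableType d2) (P2 : probability T2 R)
    d' (T' : measurableType d') (f1 : T1 -> T') (f2 : T2 -> T') :=
  forall A, measurable A -> P1 (f1 @^-1` A) = P2 (f2 @^-1` A).

Definition independent_rv d (T : measurableType d) (P : probability T R)
    d1 (T1 : measurableType d1) d2 (T2 : measurableType d2)
    (X1 : {RV P >-> T1}) (X2 : {RV P >-> T2}) :=
  forall A B, measurable A -> measurable B ->
    P (X1 @^-1` A `&` X2 @^-1` B) = (P (X1 @^-1` A) * P (X2 @^-1` B))%E.

Definition cvg_in_distribution
    (dn : nat -> measure_display) (Tn : forall n, measurableType (dn n))
    (Pn : forall n, probability (Tn n) R) (Xn : forall n, {RV (Pn n) >-> R})
    d (T : measurableType d) (P : probability T R) (X : {RV P >-> R}) :=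
  forall x, {for x, continuous (cdf X)} ->
    cdf (Xn n) x @[n --> \oo] --> cdf X x.

Definition weak_cvg2 (mun : nat -> probability (R * R)%type R)
    (mu : probability (R * R)%type R) :=
  forall f : R * R -> R, continuous f -> (exists M, forall z, `|f z| <= M) ->
    (\int[mun n]_z (f z)%:E)%E @[n --> \oo] --> (\int[mu]_z (f z)%:E)%E.

Definition quantile d (T : measurableType d) (P : probability T R)
    (X : {RV P >-> R}) (t : R) : R :=
  inf [set y | (t%:E <= cdf X y)%E].

End laws.
Arguments independent_rv {R d T} P {d1 T1 d2 T2} X1 X2.
Arguments cvg_in_distribution {R dn Tn} Pn Xn {d T} P X.

Section l1_norm_symmetric.
Context {R : realType}.

(* n-dimensional Lebesgue measure on Borel sets, by slicing along the first
   coordinate as in [product_measure1]. *)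
Fixpoint lebesgue_tuple (n : nat) : set (n.-tuple R) -> \bar R :=
  if n is m.+1 then
    fun A => (\int[@lebesgue_measure R]_x
      lebesgue_tuple [set u : m.-tuple R | A (cons_tuple x u)])%E
  else fun A => \d_([tuple]) A.

Definition unit_simplex (k : nat) : set (k.-tuple R) :=
  [set x | (forall i, 0 <= tnth x i) /\ \sum_(i < k) `|tnth x i| = 1].

(* Affine parametrization of the hyperplane of vectors whose coordinates sum
   to 1 by all coordinates but the first one (for k > 0). *)
Definition simplex_chart (k : nat) (u : k.-1.-tuple R) : k.-tuple R :=
  [tuple nth 0 (1 - \sum_(x <- u) x :: u) i | i < k].

(* The chart is affine, hence it transports (k-1)-dimensional Lebesgue measure
   to a constant multiple of the surface measure of the hyperplane, and the
   constant disappears in the quotient. *)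
Definition uniform_on_simplex d (T : measurableType d) (P : probability T R)
    (k : nat) (S : {RV P >-> k.-tuple R}) :=
  forall A, measurable A ->
    P (S @^-1` A) =
    (fine (lebesgue_tuple (@simplex_chart k @^-1` (@unit_simplex k `&` A))) /
     fine (lebesgue_tuple (@simplex_chart k @^-1` (@unit_simplex k))))%:E.
Arguments uniform_on_simplex {d T} P {k} S.

(* W has the law of rad * S, with rad nonnegative and S uniform on the simplex
   and independent of rad. *)
Definition l1_symmetric_with d (T : measurableType d) (P : probability T R)
    (k : nat) (W : {RV P >-> k.-tuple R})
    d' (U : measurableType d') (Q : probability U R) (rad : {RV Q >-> R}) :=
  (forall u, 0 <= rad u) /\
  exists S : {RV Q >-> k.-tuple R},
    [/\ uniform_on_simplex Q S, independent_rv Q rad S &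
        eq_in_law P Q W (fun u => [tuple rad u * tnth (S u) i | i < k])].

End l1_norm_symmetric.
Arguments uniform_on_simplex {R d T} P {k} S.
Arguments l1_symmetric_with {R d T} P {k} W {d' U} Q rad.

Section conditioning.
Context {R : realType} {d : measure_display} {T : measurableType d}
  (P : probability T R) {d' : measure_display} {T' : measurableType d'}.

(* g is a version of z |-> P (E | Z = z). *)
Definition is_cond_prob (E : set T) (Z : {RV P >-> T'}) (g : T' -> R) :=
  (distribution P Z).-integrable [set: T'] (EFin \o g) /\
  forall B, measurable B ->
    (\int[distribution P Z]_(z in B) (g z)%:E)%E = P (E `&` Z @^-1` B).

(* A chosen version. Versions agree almost everywhere ([is_cond_prob_ae]), and
   the default value is never used for a measurable event ([cond_probP]). *)
Definition cond_prob (E : set T) (Z : {RV P >-> T'}) : T' -> R :=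
  xget (cst 0) [set g | is_cond_prob E Z g].

Lemma cond_probP (E : set T) (Z : {RV P >-> T'}) :
  measurable E -> is_cond_prob E Z (cond_prob E Z).
Proof.
move=> mE; apply: (@xgetPex _ (cst 0) [set g | is_cond_prob E Z g]).
have mZ : measurable_fun [set: T] Z by exact: measurable_funPT.
pose nu1 : {measure set T' -> \bar R} :=
  [the measure T' R of pushforward (mrestr P mE) Z].
pose nu0 := nu1 mZ.
have nuE B : nu0 B = P (E `&` Z @^-1` B).
  by rewrite /nu0 /nu1 /= /pushforward /mrestr setIC.
have fin_nu0 : fin_num_fun nu0.
  move=> B mB; rewrite nuE; apply: fin_num_measure.
  by apply: measurableI => //; exact: measurable_funPTI.
have sigma_finite_nu0 : sigma_finite [set: T'] nu0.
  by apply: fin_num_fun_sigma_finite => //; rewrite measure0.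
have sfinite_nu0 : sfinite_measure nu0.
  exact: sfinite_measure_sigma_finite.
pose H1 := isFinite.Build _ _ _ _ fin_nu0.
pose H2 := isSFinite.Build _ _ _ _ (sfinite_nu0).
pose H3 := isSigmaFinite.Build _ _ _ _ (sigma_finite_nu0).
pose nu := HB.pack_for (FiniteMeasure.type T' R) (Measure.sort nu0) H1 H2 H3.
have dom : nu `<< distribution P Z.
  apply/null_content_dominatesP => B mB PB0; apply/eqP.
  rewrite eq_le measure_ge0 andbT /= -[X in (_ <= X)%E]PB0.
  rewrite [leLHS]nuE; apply: le_measure => //; rewrite ?inE.
  - by apply: measurableI => //; exact: measurable_funPTI.
  - exact: measurable_funPTI.
have [f [f0 ffin fint fE]] := radon_nikodym_sigma_finite dom.
exists (fine \o f); split.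
  by apply: eq_integrable fint => // z _ /=; rewrite fineK.
move=> B mB; rewrite -nuE [RHS](fE _ mB).
by apply: eq_integral => z _ /=; rewrite fineK.
Qed.

Definition cond_distribution (Y : {RV P >-> R}) (Z : {RV P >-> T'})
    (kappa : R.-pker T' ~> R) :=
  forall A, measurable A ->
    {ae distribution P Z,
      forall z, kappa z A = (cond_prob (Y @^-1` A) Z z)%:E}.

Definition cond_independent (Y Y' : {RV P >-> R}) (Z : {RV P >-> T'}) :=
  forall A B, measurable A -> measurable B ->
    {ae distribution P Z, forall z,
      cond_prob (Y @^-1` A `&` Y' @^-1` B) Z z =
      cond_prob (Y @^-1` A) Z z * cond_prob (Y' @^-1` B) Z z}.

End conditioning.
Arguments is_cond_prob {R d T} P {d' T'} E Z g.
Arguments cond_prob {R d T} P {d' T'} E Z.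
Arguments cond_distribution {R d T} P {d' T'} Y Z kappa.
Arguments cond_independent {R d T} P {d' T'} Y Y' Z.

(* mu is the law of (V, V'), where V and V' have a common regular conditional
   distribution given Z' and are conditionally independent given Z', and
   (V, Z') is a copy of (Y, Z). Such a mu is unique
   ([markov_product_unique]). *)
Definition is_markov_product {R : realType} d (T : measurableType d)
    (P : probability T R) d' (T' : measurableType d')
    (Y : {RV P >-> R}) (Z : {RV P >-> T'})
    (mu : probability (R * R)%type R) :=
  exists (e : measure_display) (U : measurableType e) (Q : probability U R)
    (V V' : {RV Q >-> R}) (Z' : {RV Q >-> T'}) (kappa : R.-pker T' ~> R),
    [/\ eq_in_law Q P (fun u => (V u, Z' u)) (fun w => (Y w, Z w)),
        cond_distribution Q V Z' kappa,
        cond_distribution Q V' Z' kappa,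
        cond_independent Q V V' Z' &
        forall A, measurable A -> mu A = Q ((fun u => (V u, V' u)) @^-1` A)].
Arguments is_markov_product {R d T} P {d' T'} Y Z mu.

Section markov_product_uniqueness.
Context {R : realType} {d : measure_display} {T : measurableType d}
  (P : probability T R) {d' : measure_display} {T' : measurableType d'}
  (Y : {RV P >-> R}) (Z : {RV P >-> T'}).

Lemma is_cond_prob_ae (E : set T) (g h : T' -> R) :
  is_cond_prob P E Z g -> is_cond_prob P E Z h ->
  {ae distribution P Z, forall z, g z = h z}.
Proof.
move=> [ig gE] [ih hE].
have gh A : A `<=` [set: T'] -> measurable A ->
    (\int[distribution P Z]_(z in A) (EFin \o g) z =
     \int[distribution P Z]_(z in A) (EFin \o h) z)%E.
  by move=> _ mA; rewrite /= gE// hE.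
have := integral_ae_eq measurableT ig (measurable_int _ ih) gh.
by apply: filterS => z /(_ I) /= [].
Qed.

Lemma markov_productE (mu : probability (R * R)%type R) A B :
  is_markov_product P Y Z mu -> measurable A -> measurable B ->
  mu (A `*` B) =
  (\int[distribution P Z]_z
     (cond_prob P (Y @^-1` A) Z z * cond_prob P (Y @^-1` B) Z z)%:E)%E.
Proof.
move=> [e [U [Q [V [V' [Z' [kappa [VZ VK V'K VV' muE]]]]]]]] mA mB.
have mV C : measurable C -> measurable (V @^-1` C) by exact: measurable_funPTI.
have mV' C : measurable C -> measurable (V' @^-1` C).
  exact: measurable_funPTI.
have VZE A0 C : measurable A0 -> measurable C ->
    Q (V @^-1` A0 `&` Z' @^-1` C) = P (Y @^-1` A0 `&` Z @^-1` C).
  by move=> mA0 mC; apply: (VZ (A0 `*` C)); exact: measurableX.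
have ZE C : measurable C -> Q (Z' @^-1` C) = P (Z @^-1` C).
  by move=> mC; have := VZE _ _ measurableT mC; rewrite !preimage_setT !setTI.
have ZZE (f : T' -> \bar R) C :
    (\int[distribution P Z]_(z in C) f z =
     \int[distribution Q Z']_(z in C) f z)%E.
  by apply: eq_measure_integral => D mD _; exact/esym/ZE.
have ae_tr (S : set T') : {ae distribution Q Z', forall z, S z} ->
    {ae distribution P Z, forall z, S z}.
  by case=> N [mN N0 SN]; exists N; split=> //; rewrite -N0; exact/esym/ZE.
have cV A0 : measurable A0 ->
    is_cond_prob P (Y @^-1` A0) Z (cond_prob Q (V @^-1` A0) Z').
  move=> mA0; have [iv vE] := cond_probP Z' (mV _ mA0).
  split; last by move=> C mC; rewrite ZZE vE// VZE.
  apply/integrableP; split; first exact: measurable_int iv.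
  by rewrite ZZE; have /integrableP[] := iv.
have cY A0 : measurable A0 ->
    is_cond_prob P (Y @^-1` A0) Z (cond_prob P (Y @^-1` A0) Z).
  by move=> mA0; apply: cond_probP; exact: measurable_funPTI.
have mVV' : measurable (V @^-1` A `&` V' @^-1` B).
  by apply: measurableI; [exact: mV|exact: mV'].
have [ivv vvE] := cond_probP Z' mVV'.
rewrite muE; last exact: measurableX.
rewrite (_ : _ @^-1` _ = V @^-1` A `&` V' @^-1` B)//.
rewrite -[X in Q X]setIT -(preimage_setT Z') -vvE// -ZZE.
have [iA _] := cY _ mA; have [iB _] := cY _ mB.
have mA' : measurable_fun [set: T'] (cond_prob P (Y @^-1` A) Z).
  by apply/measurable_EFinP; exact: measurable_int iA.
have mB' : measurable_fun [set: T'] (cond_prob P (Y @^-1` B) Z).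
  by apply/measurable_EFinP; exact: measurable_int iB.
apply: ae_eq_integral => //; first exact: measurable_int ivv.
  by apply/measurable_EFinP; exact: measurable_funM.
have h1 := ae_tr _ (VV' _ _ mA mB).
have h2 := is_cond_prob_ae (cV _ mA) (cY _ mA).
have h3 := is_cond_prob_ae (cV _ mB) (cY _ mB).
have h4 := ae_tr _ (VK _ mB).
have h5 := ae_tr _ (V'K _ mB).
have h6 : {ae distribution P Z, forall z,
    cond_prob Q (V' @^-1` B) Z' z = cond_prob P (Y @^-1` B) Z z}.
  move: h3 h4 h5; apply: filterS3 => z /= <- e4 e5.
  by apply: EFin_inj; rewrite -e4 -e5.
by move: h1 h2 h6; apply: filterS3 => z /= -> -> ->.
Qed.

Lemma markov_product_unique (mu1 mu2 : probability (R * R)%type R) :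
  is_markov_product P Y Z mu1 -> is_markov_product P Y Z mu2 ->
  forall A, measurable A -> mu1 A = mu2 A.
Proof.
move=> h1 h2.
apply: (measure_unique
  [set A `*` B | A in measurable & B in measurable] (fun=> [set: R * R])).
- exact: measurable_prod_measurableType.
- move=> _ _ [A1 mA1 [B1 mB1 <-]] [A2 mA2 [B2 mB2 <-]].
  exists (A1 `&` A2); first exact: measurableI.
  exists (B1 `&` B2); first exact: measurableI.
  by rewrite setXI.
- by move=> _; exists setT => //; exists setT => //; rewrite setXTT.
- by rewrite bigcup_const//; exists 0%N.
- move=> _ [A mA [B mB <-]]; apply: (etrans (markov_productE h1 mA mB)).
  exact/esym/markov_productE.
- by move=> _; rewrite (le_lt_trans (probability_le1 mu1 measurableT))//;
    exact: ltry.
Qed.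

End markov_product_uniqueness.

(* The Markov products exist and converge weakly. *)
Definition markov_products_cvg {R : realType}
    (dn : nat -> measure_display) (Tn : forall n, measurableType (dn n))
    (Pn : forall n, probability (Tn n) R)
    d (T : measurableType d) (P : probability T R)
    d' (T' : measurableType d')
    (Yn : forall n, {RV (Pn n) >-> R}) (Zn : forall n, {RV (Pn n) >-> T'})
    (Y : {RV P >-> R}) (Z : {RV P >-> T'}) :=
  exists (mun : nat -> probability (R * R)%type R)
    (mu : probability (R * R)%type R),
    [/\ forall n, is_markov_product (Pn n) (Yn n) (Zn n) (mun n),
        is_markov_product P Y Z mu &
        weak_cvg2 mun mu].
Arguments markov_products_cvg {R dn Tn} Pn {d T} P {d' T'} Yn Zn Y Z.

Section dependence_measures.
Context {R : realType} {d : measure_display} {T : measurableType d}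
  (P : probability T R).

Definition xi (Y : {RV P >-> R}) d' (T' : measurableType d')
    (X : {RV P >-> T'}) : R :=
  fine (\int[distribution P Y]_y
          'V_P[cond_prob P [set w | (y <= Y w)%R] X \o X])%E /
  fine (\int[distribution P Y]_y 'V_P[\1_[set w | (y <= Y w)%R]])%E.

Definition dependence_T q p (Y : {RV P >-> q.-tuple R})
    (X : {RV P >-> p.-tuple R}) : R :=
  1 - (q%:R - \sum_(i < q)
         xi (component Y i) (join_vector X (preceding_rev Y i))) /
      (q%:R - \sum_(i < q)
         if i == 0%N :> nat then 0
         else xi (component Y i) (preceding_rev Y i)).

End dependence_measures.

Arguments xi {R d T} P Y {d' T'} X.
Arguments dependence_T {R d T} P {q p} Y X.

(* Main.v *)
Require Import Defs.
From HB Require Import structures.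
From mathcomp Require Import all_boot all_order all_algebra.
From mathcomp Require Import all_classical all_reals all_analysis.
From mathcomp Require Import measurable_realfun.
From mathcomp Require Import ring lra.

Set Implicit Arguments.
Unset Strict Implicit.
Unset Printing Implicit Defensive.

Import Order.TTheory GRing.Theory Num.Theory.
Import numFieldNormedType.Exports.

Local Open Scope classical_set_scope.
Local Open Scope ring_scope.

(* A nonnegative vector W = R S_(D+1) is determined by its orthant probabilities
   P(W >= w) = E[(1 - s/R)_+^D], where s is the sum of the positive parts of w.
   Hence m <= D coordinates Z of W have a density on the positive cone that
   depends on the sum of the coordinates only, and the conditional survival
   function of another coordinate V given Z is a ratio of two such densities.
   Writing R as a quantile transform of a uniform variable, convergence in
   distribution becomes almost sure convergence, so that all these functions
   converge pointwise. The Markov product of (V, Z) is realized by Z and two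
   independent quantile transforms of the conditional survival function; a
   Scheffe-type dominated convergence theorem then yields (a), as well as the
   convergence of the numerators of xi, while the denominators do not depend on
   n because the marginals are continuous. For the same reason the maps in (b)
   are the identity. *)

(** Laws are identified through orthants, so no density is ever found by differentiation:
    integrating a truncated power over an orthant raises its index by one per coordinate, and a
    candidate density of [m] coordinates is verified by climbing from index [D - m] back to [D]. The
    bound [m <= D] holds because a conditioning vector omits at least the coordinate being
    predicted. The radius has a continuous distribution function but possibly no density; the
    absence of atoms is what makes the integrands converge almost surely, since for [m = D] the
    slice density jumps at [R = s]. The obstacle is the origin: the density of [Z] is only known to
    be at most a multiple of [s^(-m)], which is not integrable there, so no single dominating
    function is at hand; equality of total masses takes its place. Moreover xi integrates a
    conditional variance against the law of [V], which itself moves with n. The same convergence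
    theorem is therefore used at two levels, on [m] coordinates for the conditional variance and on
    one coordinate for the outer integral. *)

(** * Truncated powers *)

Section truncated_power.
Context {R : realType}.
Notation mu := (@lebesgue_measure R).

(** At the origin [0^0 = 1], so [tpow 0] is the indicator of the closed half-line. The factorial
    makes integration over a half-line raise the index by one without a constant. *)
Definition tpow (j : nat) (x : R) : R := if 0 <= x then x ^+ j / j`!%:R else 0.

Lemma tpow_ge0 j x : 0 <= tpow j x.
Proof. by rewrite /tpow; case: ifPn => // x0; rewrite divr_ge0// exprn_ge0. Qed.

Lemma tpow_lt0 j x : x < 0 -> tpow j x = 0.
Proof. by move=> x0; rewrite /tpow leNgt x0. Qed.

Lemma tpowE j x : 0 <= x -> tpow j x = x ^+ j / j`!%:R.
Proof. by rewrite /tpow => ->. Qed.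

Lemma ler_tpow j x y : x <= y -> tpow j x <= tpow j y.
Proof.
move=> xy; have [x0|x0] := ltP x 0; first by rewrite tpow_lt0// tpow_ge0.
rewrite !tpowE//; last exact: le_trans xy.
by rewrite ler_pM2r ?invr_gt0 ?ltr0n ?fact_gt0// lerXn2r// nnegrE (le_trans x0).
Qed.

Lemma measurable_tpow j : measurable_fun [set: R] (tpow j).
Proof.
apply: nondecreasing_measurable => // x y; exact: ler_tpow.
Qed.

(** Beyond [c] the integrand vanishes, and on [[a, c]] a primitive is [- (c - t)^(j+1) / (j+1)!]. *)
Lemma integral_tpow j (a c : R) :
  (\int[mu]_(t in `[a, +oo[) (tpow j (c - t))%:E = (tpow j.+1 (c - a))%:E)%E.
Proof.
have [ca|ac] := ltP c a.
  rewrite tpow_lt0 ?subr_lt0// integral0_eq// => t /=.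
  rewrite in_itv/= andbT => a_t.
  by rewrite tpow_lt0// subr_lt0 (lt_le_trans ca).
have -> : `[a, +oo[%classic = `[a, c] `|` `]c, +oo[ :> set R.
  rewrite -itv_bndbnd_setU// bnd_simp//.
rewrite ge0_integral_setU//=; last 3 first.
- apply/measurable_EFinP/measurable_funTS.
  by apply: (measurableT_comp (measurable_tpow j)); exact: measurable_funB.
- by move=> x _; rewrite lee_fin tpow_ge0.
- apply/disj_setPS => x [/=]; rewrite !in_itv/= andbT => /andP[_ xc] cx.
  by move: (lt_le_trans cx xc); rewrite ltxx.
rewrite [X in (_ + X)%E]integral0_eq ?adde0; last first.
  by move=> x /=; rewrite in_itv/= andbT => cx; rewrite tpow_lt0// subr_lt0.
(* The fundamental theorem of calculus below asks for [a < c]; for [a = c] both sides are 0. *)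
move: ac; rewrite le_eqVlt => /predU1P[->|ac].
  by rewrite set_itv1 integral_set1 subrr tpowE// exprS mul0r mul0r.
transitivity (\int[mu]_(t in `[a, c]) ((c - t) ^+ j / j`!%:R)%:E)%E.
  apply: eq_integral => x; rewrite inE/= in_itv/= => /andP[_ xc].
  by rewrite tpowE// subr_ge0.
pose F : R -> R := (- (j.+1)`!%:R^-1) *: ((cst c - id) ^+ j.+1).
have FE t : F t = - ((c - t) ^+ j.+1 / (j.+1)`!%:R).
  rewrite /F -[LHS]/(- _ * ((cst c - id) ^+ j.+1) t).
  rewrite mulNr mulrC; congr (- (_ / _)).
  by elim: j.+1 => [//|k]; rewrite !exprS => <-.
have dF (t : R) : is_derive t 1 F ((c - t) ^+ j / j`!%:R).
  rewrite /F; apply: is_derive_eq.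
  rewrite /GRing.scale /=.
  rewrite factS natrM invfM.
  have h : j`!%:R != 0 :> R by rewrite pnatr_eq0 -lt0n fact_gt0.
  rewrite [(cst c - id) t]/(c - t); field.
  by rewrite h/= nat1r pnatr_eq0.
rewrite (@continuous_FTC2 _ _ F)//.
- by rewrite !FE subrr expr0n/= mul0r oppr0 -EFinD add0r opprK tpowE// subr_ge0 ltW.
- apply: continuous_subspaceT => t; apply: cvgM; last exact: cvg_cst.
  apply: (@cvg_comp _ _ _ (fun t : R => c - t) (fun y : R => y ^+ j)).
    by apply: cvgB; [exact: cvg_cst|exact: cvg_id].
  exact: exprn_continuous.
- have cF (t : R) : {for t, continuous F}.
    by apply: differentiable_continuous; apply/derivable1_diffP; case: (dF t).
  split=> [t _||].
  + by case: (dF t).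
  + by apply: cvg_at_right_filter; exact: cF.
  + by apply: cvg_at_left_filter; exact: cF.
- by move=> t _; rewrite derive1E; apply: derive_val.
Qed.
End truncated_power.

(** * Lebesgue measure on tuples as a sigma-finite measure *)

Section lebesgue_on_tuples.
Context {R : realType}.
Notation mu := (@lebesgue_measure R).

Section cons_measure.
Context {n : nat} (nu : {sigma_finite_measure set (n.-tuple R) -> \bar R}).

Definition cons_pair (x : R * n.-tuple R) : n.+1.-tuple R :=
  cons_tuple x.1 x.2.

Definition uncons_pair (u : n.+1.-tuple R) : R * n.-tuple R :=
  (thead u, [tuple of behead u]).

Lemma cons_pairK : cancel cons_pair uncons_pair.
Proof.
move=> [x u]; rewrite /uncons_pair /cons_pair /= theadE; congr pair.
by apply/val_inj.
Qed.

Lemma measurable_cons_pair : measurable_fun [set: R * n.-tuple R] cons_pair.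
Proof. exact: measurable_cons. Qed.

Lemma measurable_uncons_pair : measurable_fun [set: n.+1.-tuple R] uncons_pair.
Proof.
apply: measurable_fun_pair; last exact: measurable_behead.
exact: measurable_tnth.
Qed.

(** Unlike the bare set function [lebesgue_tuple], an image of a product measure comes with
    additivity, and sigma-finiteness is within reach; Tonelli and Radon-Nikodym rely on both. *)
Definition cons_measure : set (n.+1.-tuple R) -> \bar R :=
  pushforward (mu \x nu)%E cons_pair.

Let cons_measure0 : cons_measure set0 = 0%E.
Proof. by rewrite /cons_measure /pushforward preimage_set0 measure0. Qed.

Let cons_measure_ge0 A : (0 <= cons_measure A)%E.
Proof. by rewrite /cons_measure /pushforward; exact: measure_ge0. Qed.

Let cons_measure_sigma_additive : semi_sigma_additive cons_measure.
Proof.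
pose m : {measure set _ -> \bar R} :=
  [the measure _ R of pushforward (mu \x nu)%E cons_pair].
exact: (@measure_semi_sigma_additive _ _ _ (m measurable_cons_pair)).
Qed.

HB.instance Definition _ := isMeasure.Build _ _ _ cons_measure
  cons_measure0 cons_measure_ge0 cons_measure_sigma_additive.

(** Both exhausting sequences are taken increasing, so that one index, the larger of the two,
    catches both coordinates. *)
Let cons_measure_sigma_finite : sigma_finite [set: n.+1.-tuple R] cons_measure.
Proof.
have /sigma_finiteP[F [TF ndF Foo]] := sigma_finiteT mu.
have /sigma_finiteP[G [TG ndG Goo]] := sigma_finiteT nu.
exists (fun k => uncons_pair @^-1` (F k `*` G k)).
  apply/seteqP; split => // u _.
  have [k _ Fk] : (\bigcup_k F k) (uncons_pair u).1 by rewrite -TF.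
  have [l _ Gl] : (\bigcup_k G k) (uncons_pair u).2 by rewrite -TG.
  exists (maxn k l) => //; split.
    by move: Fk; apply/subsetPset/ndF/leq_maxl.
  by move: Gl; apply/subsetPset/ndG/leq_maxr.
move=> k; have [mF Fk] := Foo k; have [mG Gk] := Goo k; split.
  rewrite -[X in measurable X]setTI.
  by apply: measurable_uncons_pair => //; exact: measurableX.
rewrite /cons_measure /pushforward (_ : _ @^-1` _ = F k `*` G k); last first.
  by apply/seteqP; split => u; rewrite /preimage /mkset cons_pairK.
by rewrite product_measure1E// lte_mul_pinfty// ge0_fin_numE.
Qed.

HB.instance Definition _ := Measure_isSigmaFinite.Build _ _ _ cons_measure
  cons_measure_sigma_finite.

End cons_measure.

Fixpoint leb n : {sigma_finite_measure set (n.-tuple R) -> \bar R} :=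
  if n is m.+1 then cons_measure (leb m) else \d_([tuple] : 0.-tuple R).

(** A product measure integrates the measures of sections, which is the recursion of
    [lebesgue_tuple]; measurability of [A] passes to the sections. *)
Lemma lebesgue_tupleE n (A : set (n.-tuple R)) : measurable A ->
  lebesgue_tuple A = leb n A.
Proof.
elim: n => [//|n IH] in A *; move=> mA /=.
rewrite /cons_measure /pushforward /product_measure1 /=.
apply: eq_integral => x _; rewrite IH.
  by congr (leb n _); apply/seteqP; split => u /=; rewrite xsectionE.
rewrite (_ : mkset _ = (fun u => cons_pair (x, u)) @^-1` A)//.
rewrite -[X in measurable X]setTI.
apply: (measurableT_comp measurable_cons_pair) => //.
Qed.

Lemma ge0_integral_leb_cons n (f : n.+1.-tuple R -> \bar R) :
  measurable_fun [set: n.+1.-tuple R] f -> (forall u, 0 <= f u)%E ->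
  (\int[leb n.+1]_u f u = \int[mu]_x \int[leb n]_u f (cons_tuple x u))%E.
Proof.
move=> mf f0; rewrite [LHS]/= ge0_integral_pushforward//=.
  rewrite preimage_setT fubini_tonelli1//=.
  by apply: measurableT_comp => //; exact: measurable_cons_pair.
exact: measurable_cons_pair.
Qed.

End lebesgue_on_tuples.

(** * Orthants: integrals of truncated powers, determination of measures *)

Section orthants.
Context {R : realType}.
Notation mu := (@lebesgue_measure R).

Definition tsum n (u : n.-tuple R) : R := \sum_(i < n) tnth u i.

Definition orthant n (a : n.-tuple R) : set (n.-tuple R) :=
  [set u | forall i, tnth a i <= tnth u i].

Lemma measurable_tsum n : measurable_fun [set: n.-tuple R] (@tsum n).
Proof. by apply: measurable_sum => i; exact: measurable_tnth. Qed.

Lemma measurable_orthant n (a : n.-tuple R) : measurable (orthant a).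
Proof.
rewrite (_ : orthant a =
  \bigcap_(i in [set: 'I_n]) ((@tnth n R)^~ i @^-1` `[tnth a i, +oo[)).
  apply: fin_bigcap_measurable => // i _.
  rewrite -[X in measurable X]setTI; apply: measurable_tnth => //.
by apply/seteqP; split => u /= au i; have := au i;
  rewrite /= in_itv/= ?andbT; [move=> h _; exact: h|exact].
Qed.

Lemma tsum_cons n (x : R) (u : n.-tuple R) :
  tsum (cons_tuple x u) = x + tsum u.
Proof.
rewrite /tsum big_ord_recl/= tnth0; congr (_ + _).
by apply: eq_bigr => i _; rewrite tnthS.
Qed.

Lemma orthant_cons n (x y : R) (a u : n.-tuple R) :
  orthant (cons_tuple x a) (cons_tuple y u) <-> x <= y /\ orthant a u.
Proof.
split=> [h|[xy au] i].
  split; first by have := h ord0; rewrite !tnth0.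
  by move=> i; have := h (lift ord0 i); rewrite !tnthS.
by case: (unliftP ord0 i) => [k|] ->; rewrite ?tnthS ?tnth0.
Qed.

Lemma measurable_tpow_tsum n j (c : R) :
  measurable_fun [set: n.-tuple R] (fun u => (tpow j (c - tsum u))%:E).
Proof.
apply/measurable_EFinP; apply: (measurableT_comp (measurable_tpow j)).
by apply: measurable_funB => //; exact: measurable_tsum.
Qed.

(** Each coordinate integrated out contributes one use of [integral_tpow]. The induction generalizes
    [c], because the first coordinate is absorbed into it. *)
Lemma integral_orthant_tpow n j (a : n.-tuple R) (c : R) :
  (\int[leb n]_(u in orthant a) (tpow j (c - tsum u))%:E =
   (tpow (j + n) (c - tsum a))%:E)%E.
Proof.
elim: n => [|n IH] in a c *; last first.
  have -> : a = cons_tuple (thead a) [tuple of behead a].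
    by apply/val_inj; rewrite [LHS](congr1 val (tuple_eta a)).
  move: (thead a) [tuple of behead a] => x0 {}a.
  rewrite integral_mkcond ge0_integral_leb_cons; last 2 first.
  - apply/(measurable_restrictT _ _).1; first exact: measurable_orthant.
    by apply: measurable_funTS; exact: measurable_tpow_tsum.
  - by move=> u; rewrite patchE; case: ifPn => // _; rewrite lee_fin tpow_ge0.
  rewrite tsum_cons [x0 + _]addrC opprD addrA addnS -integral_tpow.
  rewrite [RHS]integral_mkcond; apply: eq_integral => x _.
  rewrite [RHS]patchE; case: ifPn => [|/negP] ax.
    rewrite addrAC -IH [RHS]integral_mkcond; apply: eq_integral => u _.
    move: ax; rewrite inE/= in_itv/= andbT => ax.
    rewrite !patchE tsum_cons opprD addrA (_ : _ \in _ = (u \in orthant a))//.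
    by apply/idP/idP; rewrite !inE; [case/orthant_cons|move=> h; exact/orthant_cons].
  apply: integral0_eq => u _; rewrite patchE ifN//; apply/negP; rewrite inE.
  by move=> /orthant_cons[xx _]; apply: ax; rewrite inE/= in_itv/= xx.
- rewrite addn0 (_ : orthant a = setT); last first.
    by apply/seteqP; split => // u _ [].
  rewrite integral_dirac ?diracT ?mul1e//; last exact: measurable_tpow_tsum.
  by congr (tpow j (c - _))%:E; rewrite /tsum !big_ord0.
Qed.

Lemma tnth_lower_bound n (u : n.-tuple R) :
  exists k : nat, forall l, - (k%:R) <= tnth u l.
Proof.
exists (\max_(l < n) (Num.truncn `|tnth u l|).+1) => l.
rewrite lerNl (le_trans (ler_norm _))// normrN.
rewrite (le_trans (ltW (truncnS_gt _)))// ler_nat.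
exact: (@leq_bigmax _ (fun l => (Num.truncn `|tnth u l|).+1)).
Qed.

(** A coordinate half-space is the union over [k] of the orthants whose other corner coordinates are
    [-k]. *)
Lemma measurable_tuple_orthants n :
  @measurable _ (n.-tuple R) = <<s range (@orthant n) >>.
Proof.
apply/seteqP; split; last first.
  apply: smallest_sub; first exact: sigma_algebra_measurable.
  by move=> _ [a _ <-]; exact: measurable_orthant.
move=> A mA.
pose T := g_sigma_algebraType (range (@orthant n)).
suff mid : measurable_fun [set: T] (id : T -> n.-tuple R).
  by have := mid measurableT A mA; rewrite setTI preimage_id.
apply/measurable_fun_tnthP => i.
apply: (measurability (@RGenCInfty.G R)).
  exact: RGenCInfty.measurableE.
move=> _ [_ [x ->] <-]; rewrite setTI.
rewrite (_ : _ @^-1` _ = \bigcup_k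
  (orthant [tuple if l == i then x else - k%:R | l < n] : set T)).
  apply: bigcup_measurable => k _.
  by apply: sub_sigma_algebra; eexists.
apply/seteqP; split => u /=.
  rewrite in_itv/= andbT => xu.
  have [k uk] : exists k : nat, forall l, - (k%:R) <= tnth u l.
    exact: tnth_lower_bound.
  by exists k => // l; rewrite tnth_mktuple; case: eqP => // ->.
by move=> [k _ /(_ i)]; rewrite tnth_mktuple eqxx in_itv/= andbT.
Qed.

(** Orthants form a generating pi-system, corners combining by maxima, and those with corner [-k]
    exhaust the space. *)
Lemma measure_eq_orthant n (m1 m2 : {measure set (n.-tuple R) -> \bar R}) :
  (m1 setT < +oo)%E -> (forall a, m1 (orthant a) = m2 (orthant a)) ->
  forall A, measurable A -> m1 A = m2 A.
Proof.
move=> m1y m12.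
apply: (measure_unique (range (@orthant n))
  (fun k => orthant [tuple - (k%:R : R) | l < n])).
- exact: measurable_tuple_orthants.
- move=> _ _ [a _ <-] [b _ <-].
  exists [tuple Num.max (tnth a i) (tnth b i) | i < n] => //.
  apply/seteqP; split => u /=.
    by move=> h; split => i; have := h i; rewrite tnth_mktuple ge_max => /andP[].
  by move=> [au bu] i; rewrite tnth_mktuple ge_max au bu.
- by move=> k; eexists.
- apply/seteqP; split => // u _; have [k uk] := tnth_lower_bound u.
  by exists k => // l; rewrite tnth_mktuple.
- by move=> _ [a _ <-].
- move=> k; apply: le_lt_trans m1y; apply: le_measure; rewrite ?inE//.
  exact: measurable_orthant.
Qed.

End orthants.

(** * The uniform law on the simplex *)

Section simplex.
Context {R : realType}.

Definition psum n (w : n.-tuple R) : R := \sum_(i < n) Num.max 0 (tnth w i).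

Lemma tpow_div (j : nat) (x r : R) : 0 < r -> tpow j (x / r) = tpow j x / r ^+ j.
Proof.
move=> r0; have [x0|x0] := ltP x 0.
  by rewrite !tpow_lt0 ?mul0r// pmulr_llt0// invr_gt0.
rewrite !tpowE ?divr_ge0 ?(ltW r0)// exprMn exprVn.
by rewrite mulrAC.
Qed.

Lemma simplex_chart0 k (u : k.-tuple R) :
  tnth (@simplex_chart R k.+1 u) ord0 = 1 - tsum u.
Proof. by rewrite tnth_mktuple/= big_tuple. Qed.

Lemma simplex_chartS k (u : k.-tuple R) (j : 'I_k) :
  tnth (@simplex_chart R k.+1 u) (lift ord0 j) = tnth u j.
Proof. by rewrite tnth_mktuple/= add0n (tnth_nth 0). Qed.

(** The chart computes the first coordinate as 1 minus the sum of the others, so its lower bound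
    becomes an upper bound on that sum. The remaining lower bounds merge with nonnegativity into
    positive parts, and the norm condition is then automatic. *)
Lemma simplex_orthantE k (x0 : R) (x : k.-tuple R) :
  @simplex_chart R k.+1 @^-1` (unit_simplex (k := k.+1) `&` orthant (cons_tuple x0 x)) =
  orthant [tuple Num.max 0 (tnth x i) | i < k] `&`
    [set u | 0 <= 1 - Num.max 0 x0 - tsum u].
Proof.
apply/seteqP; split => u.
  move=> [[u0 _] xu]; split.
    move=> i; rewrite tnth_mktuple ge_max.
    have := u0 (lift ord0 i); have := xu (lift ord0 i).
    by rewrite !simplex_chartS tnthS => -> ->.
  have := u0 ord0; have := xu ord0; rewrite simplex_chart0 tnth0 => h1 h2.
  have : Num.max 0 x0 <= 1 - tsum u by rewrite ge_max h1 h2.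
  by rewrite /mkset; lra.
move=> [xu]; rewrite /mkset => ux0.
have {}ux0 : Num.max 0 x0 <= 1 - tsum u by lra.
have u0 i : 0 <= tnth (@simplex_chart R k.+1 u) i.
  case: (unliftP ord0 i) => [j|] ->; rewrite ?simplex_chartS ?simplex_chart0.
    by apply: le_trans (xu j); rewrite tnth_mktuple le_max lexx.
  by apply: le_trans ux0; rewrite le_max lexx.
split; first split => //.
  under eq_bigr do rewrite ger0_norm//.
  rewrite big_ord_recl simplex_chart0.
  under eq_bigr do rewrite simplex_chartS.
  by rewrite subrK.
move=> i.
case: (unliftP ord0 i) => [j|] ->; rewrite ?simplex_chartS ?simplex_chart0 ?tnthS ?tnth0.
  by apply: le_trans (xu j); rewrite tnth_mktuple le_max lexx orbT.
by apply: le_trans ux0; rewrite le_max lexx orbT.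
Qed.

Lemma psum_cons k (x0 : R) (x : k.-tuple R) :
  psum (cons_tuple x0 x) = Num.max 0 x0 + psum x.
Proof.
rewrite /psum big_ord_recl/= tnth0; congr (_ + _).
by apply: eq_bigr => i _; rewrite tnthS.
Qed.

(** The indicator of the half-space cut off by the first coordinate is a [tpow 0], so the volume is
    an orthant integral, of index [0 + k]. *)
Lemma lebesgue_simplex_orthant k (x : k.+1.-tuple R) :
  lebesgue_tuple (@simplex_chart R k.+1 @^-1`
    (unit_simplex (k := k.+1) `&` orthant x)) = (tpow k (1 - psum x))%:E.
Proof.
have -> : x = cons_tuple (thead x) [tuple of behead x].
  by apply/val_inj; rewrite [LHS](congr1 val (tuple_eta x)).
move: (thead x) [tuple of behead x] => x0 {}x.
rewrite simplex_orthantE.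
have mB : measurable [set u : k.-tuple R | 0 <= 1 - Num.max 0 x0 - tsum u].
  rewrite (_ : mkset _ = (fun u => 1 - Num.max 0 x0 - tsum u) @^-1` `[0, +oo[).
    rewrite -[X in measurable X]setTI; apply: measurable_funB => //.
    exact: measurable_tsum.
  by apply/seteqP; split => u; rewrite /preimage /mkset in_itv/= andbT.
have mA : measurable (orthant [tuple Num.max 0 (tnth x i) | i < k]).
  exact: measurable_orthant.
rewrite lebesgue_tupleE; last exact: measurableI.
rewrite setIC -integral_indic//.
rewrite psum_cons opprD addrA.
have -> : psum x = tsum [tuple Num.max 0 (tnth x i) | i < k].
  by apply: eq_bigr => i _; rewrite tnth_mktuple.
rewrite -[X in tpow X _](add0n k) -integral_orthant_tpow.
apply: eq_integral => u _; congr EFin; rewrite indicE /tpow.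
case: ifPn => h; first by rewrite mem_set// expr0 divr1.
by rewrite memNset//; apply/negP.
Qed.

(** The normalizing volume is that of the simplex cut with the orthant at 0, namely [1 / k!]. *)
Lemma uniform_on_simplex_orthant d (T : measurableType d)
    (P : probability T R) k (S : {RV P >-> k.+1.-tuple R}) :
  uniform_on_simplex P S -> forall x,
  P (S @^-1` orthant x) = (k`!%:R * tpow k (1 - psum x))%:E.
Proof.
move=> uS x; rewrite uS; last exact: measurable_orthant.
rewrite lebesgue_simplex_orthant.
have -> : unit_simplex (k := k.+1) =
    unit_simplex (k := k.+1) `&` orthant [tuple (0 : R) | i < k.+1].
  apply/esym/setIidPl => u [u0 _] i; rewrite tnth_mktuple; exact: u0.
rewrite lebesgue_simplex_orthant /=.
have -> : psum [tuple (0 : R) | i < k.+1] = 0.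
  by rewrite /psum big1// => i _; rewrite tnth_mktuple maxxx.
by rewrite subr0 (tpowE _ ler01) expr1n div1r invrK mulrC.
Qed.

End simplex.

(** * Orthant probabilities of l1-symmetric vectors *)

Section radial.
Context {R : realType}.

(* [D`! (r - s)_+^j / (j`! r^D)], the density at sum [s] of [D - j] coordinates
   of a uniform vector on the simplex of size [r] in dimension [D + 1]. *)
Definition slice_density (D j : nat) (s r : R) : R :=
  D`!%:R * tpow j (r - s) / r ^+ D.

Context {d : measure_display} {T : measurableType d} (Q : probability T R)
  (rad : {RV Q >-> R}).

Definition mean_density D j (s : R) : \bar R :=
  (\int[Q]_w (slice_density D j s (rad w))%:E)%E.

Lemma measurable_inv : measurable_fun [set: R] (@GRing.inv R).
Proof.
have -> : [set: R] = [set x | x != 0] `|` [set 0].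
  by apply/seteqP; split => // x _; have [->|x0] := eqVneq x 0; [right|left].
have oU : open [set x : R | x != 0].
  rewrite (_ : mkset _ = ~` [set 0]); last first.
    by apply/seteqP; split => x /= /eqP.
  by apply: closed_openC; apply: accessible_closed_set1; apply: hausdorff_accessible.
apply/measurable_funU => //.
- exact: open_measurable.
split.
  apply: open_continuous_measurable_fun => // x; rewrite inE /= => x0.
  exact: inv_continuous.
exact: measurable_fun_set1.
Qed.

Lemma slice_density_ge0 D j (s r : R) : 0 <= r -> 0 <= slice_density D j s r.
Proof. by move=> r0; rewrite !mulr_ge0 ?tpow_ge0// invr_ge0 exprn_ge0. Qed.

Lemma measurable_slice_density D j (s : R) :
  measurable_fun [set: R] (slice_density D j s).
Proof.
apply: measurable_funM.
  apply: measurable_funM => //.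
  by apply: (measurableT_comp (measurable_tpow j)); exact: measurable_funB.
apply: (measurableT_comp measurable_inv); exact: measurable_funX.
Qed.

(** By independence the law of [(rad, S)] is a product. The section at a radius [r > 0] is the
    orthant with corner [w / r], and homogeneity of [tpow] turns its probability into
    [slice_density]. *)
Lemma l1_symmetric_orthant d' (T' : measurableType d') (P : probability T' R)
    k (W : {RV P >-> k.+1.-tuple R}) :
  cdf rad 0 = 0%E -> l1_symmetric_with P W Q rad -> forall w,
  P (W @^-1` orthant w) = mean_density k k (psum w).
Proof.
move=> rad0 [rad_ge0 [S [uS indep lawW]]] w.
rewrite lawW; last exact: measurable_orthant.
pose A := [set z : R * k.+1.-tuple R | forall i, tnth w i <= z.1 * tnth z.2 i].
have mscale : measurable_fun [set: R * k.+1.-tuple R]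
    (fun z => [tuple z.1 * tnth z.2 i | i < k.+1]).
  apply/measurable_fun_tnthP => i.
  rewrite (_ : _ \o _ = (fun z => z.1 * tnth z.2 i)); last first.
    by apply/funext => z /=; rewrite tnth_mktuple.
  apply: measurable_funM => //.
  by apply: (measurableT_comp (measurable_tnth i)).
have mA : measurable A.
  have -> : A = (fun z => [tuple z.1 * tnth z.2 i | i < k.+1]) @^-1` orthant w.
    by apply/seteqP; split => z /= h i; have := h i; rewrite tnth_mktuple.
  rewrite -[X in measurable X]setTI.
  by apply: mscale => //; exact: measurable_orthant.
have -> : (fun u => [tuple rad u * tnth (S u) i | i < k.+1]) @^-1` orthant w =
    (fun u => (rad u, S u)) @^-1` A.
  by apply/seteqP; split => u /= h i; have := h i; rewrite tnth_mktuple.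
have mRS : measurable_fun [set: T] (fun u => (rad u, S u)).
  exact: measurable_fun_pair.
pose m : {measure set (R * k.+1.-tuple R)%type -> \bar R} :=
  [the measure _ R of pushforward Q (fun u => (rad u, S u))].
have -> : Q ((fun u => (rad u, S u)) @^-1` A) =
    (distribution Q rad \x distribution Q S)%E A.
  apply/esym; apply: (@product_measure_unique _ _ _ _ _
    (distribution Q rad) (distribution Q S) (m mRS)); [|exact: mA] => B C mB mC.
  exact: indep.
have mF : measurable_fun [set: R]
    (fun r => distribution Q S (xsection A r)).
  exact: (@measurable_fun_xsection _ _ _ _ _ (distribution Q S)).
rewrite /product_measure1 /= /mean_density ge0_integral_distribution//.
apply: ae_eq_integral => //.
- by apply: (measurableT_comp mF); exact: measurable_funPT.
- apply/measurable_EFinP.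
  by apply: (measurableT_comp (measurable_slice_density _ _ _)).
(* Division by the radius fails here; the set is null by [cdf rad 0 = 0]. *)
exists (rad @^-1` `]-oo, 0]); split => //.
  by rewrite -[X in measurable X]setTI; apply: measurable_funPT.
move=> u /= /not_implyP[_ h]; rewrite in_itv/= leNgt; apply/negP => r0; apply: h.
have -> : xsection A (rad u) = orthant [tuple tnth w i / rad u | i < k.+1].
  apply/seteqP; split => s; rewrite xsectionE /=.
    by move=> h i; rewrite tnth_mktuple ler_pdivrMr// mulrC; exact: h.
  by move=> h i; have := h i; rewrite tnth_mktuple ler_pdivrMr// mulrC.
rewrite /distribution /pushforward (uniform_on_simplex_orthant uS).
have -> : psum [tuple tnth w i / rad u | i < k.+1] = psum w / rad u.
  rewrite /psum mulr_suml; apply: eq_bigr => i _; rewrite tnth_mktuple.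
  by rewrite maxr_pMl ?mul0r// invr_ge0 ltW.
rewrite /slice_density -mulrA -tpow_div// mulrBl divff// gt_eqF//.
Qed.

End radial.

(** * Survival functions and their quantile transforms *)

Section survival_quantile.
Context {R : realType}.

(* Survival functions v |-> P(V >= v) of nonnegative variables V. *)
Definition survival (G : R -> R) := [/\ {homo G : v w / v <= w >-> w <= v},
  forall v, v <= 0 -> G v = 1,
  forall u v, (forall w, w < v -> u <= G w) -> u <= G v,
  forall v, 0 <= G v &
  forall u, 0 < u -> exists v, G v < u].

(** The generalized inverse of a nonincreasing function. The value 0 off []0, 1]], a null set for
    the uniform law, keeps it nonnegative and measurable. *)
Definition survq (G : R -> R) (u : R) : R :=
  if 0 < u <= 1 then sup [set v | u <= G v] else 0.

(** Left-continuity of [G] makes the supremum a maximum, so the equivalence has no exceptional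
    points. Measurability, law and convergence of [survq] all rest on it. *)
Lemma le_survq (G : R -> R) (u v : R) : survival G -> 0 < u <= 1 ->
  (v <= survq G u) = (u <= G v).
Proof.
move=> [Gni G1 Gleft G0 Ginf] u01; rewrite /survq u01.
have [u0 u1] := andP u01.
have [v1 Gv1] := Ginf _ u0.
have ub : ubound [set v | u <= G v] v1.
  move=> w /= uw; rewrite leNgt; apply/negP => v1w.
  by move: (Gni _ _ (ltW v1w)); rewrite leNgt (lt_le_trans Gv1).
have hs : has_sup [set v | u <= G v].
  by split; [exists 0; rewrite /= G1|exists v1].
apply/idP/idP => [vs|uv]; last by apply: (ub_le_sup hs.2).
apply: Gleft => w wv.
have sw : 0 < sup [set v | u <= G v] - w by rewrite subr_gt0 (lt_le_trans wv).
have [e /= ue we] := sup_adherent sw hs.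
apply: (le_trans ue); apply: Gni; apply: ltW.
by move: we; rewrite opprB addrC subrK.
Qed.

Lemma survq_ge0 (G : R -> R) (u : R) : survival G -> 0 <= survq G u.
Proof.
move=> sG; have [u01|u01] := boolP (0 < u <= 1); last first.
  by rewrite /survq (negbTE u01).
rewrite le_survq//; have [_ G1 _ _ _] := sG; rewrite G1//.
by case/andP: u01.
Qed.

(** Slightly above the limit quantile, [G] is strictly below [u], which passes to [Gn]. Slightly
    below it, only [u <= G] is known; testing at a rational point, where equality is excluded, makes
    this strict as well. Thus only countably many [u] are lost. *)
Lemma survq_cvg (Gn : nat -> R -> R) (G : R -> R) (u : R) :
  (forall n, survival (Gn n)) -> survival G ->
  (forall v, Gn n v @[n --> \oo] --> G v) ->
  0 < u <= 1 -> (forall q : rat, u != G (ratr q)) ->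
  survq (Gn n) u @[n --> \oo] --> survq G u.
Proof.
move=> sGn sG GnG u01 uG.
apply/cvgrPdist_lt => e e0.
have h1 : \forall n \near \oo, survq G u - e < survq (Gn n) u.
  have [q /andP[q1 q2]] : exists q : rat, survq G u - e < ratr q < survq G u.
    have := @rat_in_itvoo R (survq G u - e) (survq G u) ltac:(lra).
    by move=> [q]; rewrite in_itv/= => ?; exists q.
  have Gq : u < G (ratr q) by rewrite lt_neqAle uG/= -le_survq// ltW.
  near=> n; apply: (lt_le_trans q1); rewrite le_survq//; apply: ltW.
  near: n; exact: (cvgr_gt _ (GnG (ratr q))).
have h2 : \forall n \near \oo, survq (Gn n) u < survq G u + e.
  have Gq : G (survq G u + e) < u.
    by rewrite ltNge -le_survq// -ltNge; lra.
  near=> n; rewrite ltNge le_survq// -ltNge.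
  near: n; exact: (cvgr_lt _ (GnG (survq G u + e))).
by move: h1 h2; apply: filterS2 => n h1 h2; rewrite ltr_distl; lra.
Unshelve. all: by end_near. Qed.

(** By [le_survq] the superlevel set at [v] is the set [u <= G z v] as long as [u] lies in []0, 1]];
    elsewhere [survq] is 0. *)
Lemma measurable_survq d (T : measurableType d) (G : T -> R -> R) :
  (forall z, survival (G z)) ->
  (forall v, measurable_fun [set: T] (G^~ v)) ->
  measurable_fun [set: T * R] (fun zu => survq (G zu.1) zu.2).
Proof.
move=> sG mG.
apply: (measurability (@RGenCInfty.G R)).
  exact: RGenCInfty.measurableE.
move=> _ [_ [v ->] <-]; rewrite setTI.
pose B := [set zu : T * R | 0 < zu.2 <= 1].
have mB : measurable B.
  rewrite (_ : B = snd @^-1` `]0, 1]); last first.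
    by apply/seteqP; split => zu; rewrite /B /preimage /mkset in_itv.
  by rewrite -[X in measurable X]setTI; apply: measurable_snd.
rewrite (_ : _ @^-1` _ = (B `&` [set zu | 0 <= G zu.1 v - zu.2]) `|`
    (~` B `&` [set zu | v <= 0])); last first.
  apply/seteqP; split => -[z u]; rewrite /B /preimage /setI /setU /setC /mkset /= in_itv/= andbT.
    have [u01|u01] := boolP (0 < u <= 1).
      by rewrite le_survq// => h; left; rewrite subr_ge0.
    by rewrite /survq (negbTE u01) => ?; right.
  case=> [[u01]|[]].
    by rewrite le_survq// subr_ge0.
  by rewrite /survq; move=> /negP /negbTE ->.
apply: measurableU; apply: measurableI => //.
- rewrite (_ : mkset _ = (fun zu : T * R => G zu.1 v - zu.2) @^-1` `[0, +oo[).
    rewrite -[X in measurable X]setTI; apply: measurable_funB => //.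
    by apply: (measurableT_comp (mG v)).
  by apply/seteqP; split => zu; rewrite /preimage /mkset in_itv/= andbT.
- exact: measurableC.
- by have [v0|v0] := leP v 0; rewrite ?set_true ?set_false.
Qed.

Let idTR : measurableTypeR R -> R := idfun.

#[local] HB.instance Definition _ := @isMeasurableFun.Build _ _ _ _ idTR
  (@measurable_id _ _ setT).

(* [uniform_prob] lives on [measurableTypeR R], a copy of [R]. *)
Definition unif : probability R R :=
  distribution (uniform_prob (@ltr01 R)) idTR.

Lemma unifE (A : set R) : measurable A ->
  unif A = lebesgue_measure (A `&` `[0, 1]).
Proof.
move=> mA; rewrite -[LHS]/(uniform_prob (@ltr01 R) A).
transitivity (\int[uniform_prob (@ltr01 R)]_x (\1_A x)%:E)%E.
  by rewrite integral_indic// setIT.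
rewrite integral_uniform//.
  by rewrite subr0 invr1 mul1e integral_indic.
exact/measurable_EFinP.
Qed.

Lemma unif_itv (x : R) : 0 <= x <= 1 -> unif [set` `]0, x]] = x%:E.
Proof.
move=> /andP[x0 x1]; rewrite unifE// setIidl.
  by rewrite lebesgue_measure_itv/= lte_fin; case: ltgtP x0 => // [x0|<-] _; rewrite ?sube0.
by move=> y /=; rewrite !in_itv/= => /andP[y0 yx]; rewrite ltW// (le_trans yx).
Qed.

Lemma unif_setC_itv : unif (~` [set` `]0, 1]]) = 0%E.
Proof.
by rewrite probability_setC// unif_itv ?subee// ler01 lexx.
Qed.

Lemma unif_countable (C : set R) : countable C -> unif.-negligible C.
Proof.
move=> cC; exists C; split => //; first exact: countable_measurable.
apply/eqP; rewrite eq_le measure_ge0 andbT unifE; last exact: countable_measurable.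
rewrite -(countable_lebesgue_measure0 cC); apply: le_measure; rewrite ?inE//.
  by apply: measurableI => //; exact: countable_measurable.
exact: countable_measurable.
Qed.

(** Up to a null set the event is the interval []0, G v]]. *)
Lemma unif_survq (G : R -> R) (v : R) : survival G ->
  unif [set u | v <= survq G u] = (G v)%:E.
Proof.
move=> sG; have [Gni G1 _ G0 _] := sG.
have Gv1 : G v <= 1.
  by have [v0|v0] := leP v 0; [rewrite G1|rewrite -(G1 0)// Gni// ltW].
rewrite (_ : mkset _ = [set` `]0, G v]] `|` (~` `]0, 1] `&` [set _ | v <= 0])); last first.
  apply/seteqP; split => u; rewrite /setI /setU /setC /mkset /= !in_itv/=.
    have [u01|u01] := boolP (0 < u <= 1).
      by rewrite le_survq// => ->; left; case/andP: u01 => ->.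
    by rewrite /survq (negbTE u01) => ?; right.
  case=> [/andP[u0 uv]|[u01]].
    by rewrite le_survq// u0 (le_trans uv).
  by rewrite /survq; move: u01 => /negP /negbTE ->.
have mN : measurable (~` `]0, 1] `&` [set _ | v <= 0] : set R).
  apply: measurableI; first exact: measurableC.
  by have [v0|v0] := leP v 0; rewrite ?set_true ?set_false.
rewrite -[RHS]unif_itv ?G0//; apply: measureU0 => //.
apply/eqP; rewrite eq_le measure_ge0 andbT -unif_setC_itv.
by apply: le_measure; rewrite ?inE//; exact: measurableC.
Qed.

Lemma ae_survq_cvg (Gn : nat -> R -> R) (G : R -> R) :
  (forall n, survival (Gn n)) -> survival G ->
  (forall v, Gn n v @[n --> \oo] --> G v) ->
  {ae unif, forall u, survq (Gn n) u @[n --> \oo] --> survq G u}.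
Proof.
move=> sGn sG GnG.
pose C := range (fun q : rat => G (ratr q)).
have : unif.-negligible (~` `]0, 1] `|` C).
  apply: negligibleU.
    by exists (~` `]0, 1]); split => //; [exact: measurableC|exact: unif_setC_itv].
  apply: unif_countable; apply: (sub_countable (card_image_le _ _)).
  exact: countableP.
apply: negligibleS => u /= h; apply: contrapT => /not_orP[/= u01 uC]; apply: h.
apply: survq_cvg => //.
  by move: u01; rewrite in_itv/= => /contrapT.
by move=> q; apply/eqP => uq; apply: uC; exists q.
Qed.

End survival_quantile.

(** * Laws with a continuous distribution function *)

Section continuous_law.
Context {R : realType}.

Lemma measure_eq_itvcy (m1 m2 : {measure set R -> \bar R}) :
  (m1 setT < +oo)%E -> (forall a, m1 [set` `[a, +oo[] = m2 [set` `[a, +oo[]) ->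
  forall A, measurable A -> m1 A = m2 A.
Proof.
move=> m1y m12.
apply: (measure_unique (@RGenCInfty.G R) (fun k => [set` `[- k%:R, +oo[])).
- exact: RGenCInfty.measurableE.
- move=> _ _ [a ->] [b ->]; exists (Num.max a b).
  apply/seteqP; split => u /=; rewrite !in_itv/= !andbT ge_max.
    by move=> [-> ->].
  by move=> /andP.
- by move=> k; eexists.
- apply/seteqP; split => // u _; exists (Num.truncn `|u|).+1 => //=.
  rewrite in_itv/= andbT lerNl (le_trans (ler_norm _))// normrN.
  exact: (ltW (truncnS_gt _)).
- by move=> _ [a ->].
- by move=> k; apply: le_lt_trans m1y; apply: le_measure; rewrite ?inE.
Qed.

Context {d : measure_display} {T : measurableType d} (Q : probability T R)
  (X : {RV Q >-> R}).

(** This is P(X > v) by definition; continuity of the distribution function makes it P(X >= v), the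
    convention of [survival], in [csurvE]. *)
Definition csurv (v : R) : R := 1 - fine (cdf X v).

Lemma cdf_fin_num v : cdf X v \is a fin_num.
Proof. exact: fin_num_measure. Qed.

Hypothesis cX : continuous (cdf X).

Lemma continuous_csurv : continuous csurv.
Proof.
move=> v; apply: cvgB; first exact: cvg_cst.
apply: fine_cvg; rewrite fineK ?cdf_fin_num//; exact: cX.
Qed.

Lemma csurv_open v : distribution Q X `]v, +oo[ = (csurv v)%:E.
Proof. by rewrite -setCitvl probability_setC// EFinB fineK ?cdf_fin_num. Qed.

(** The point lies in []w, v]] for every [w < v], whose mass [csurv w - csurv v] tends to 0. *)
Lemma distribution_set1 v : distribution Q X [set v] = 0%E.
Proof.
apply/eqP; rewrite eq_le measure_ge0 andbT; apply/lee_addgt0Pr => e e0; rewrite add0e.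
have /cvgrPdist_lt /(_ e e0) := cvg_at_left_filter (@continuous_csurv v) => vw.
near v^'- => w.
have wv : w < v by near: w; exact: nbhs_left_lt.
have cvw : `|csurv v - csurv w| < e by near: w.
apply: (@le_trans _ _ (distribution Q X (`]w, +oo[ `\` `]v, +oo[))).
  apply: le_measure; rewrite ?inE//; first exact: measurableD.
  move=> x /= ->; rewrite !in_itv/= !andbT ltxx; split => //.
rewrite measureD//; last by rewrite (le_lt_trans (probability_le1 _ _))// ltry.
rewrite setIidr; last first.
  by apply: subset_itvr; rewrite bnd_simp ltW.
rewrite (_ : (_ - _)%E = ((csurv w)%:E - (csurv v)%:E)%E); last by rewrite -!csurv_open.
by rewrite -EFinB lee_fin (le_trans (ler_norm _))// distrC ltW.
Unshelve. all: by end_near. Qed.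

Lemma csurvE v : distribution Q X `[v, +oo[ = (csurv v)%:E.
Proof.
have -> : `[v, +oo[%classic = [set v] `|` `]v, +oo[ :> set R.
  apply/seteqP; split => x /=; rewrite !in_itv/= !andbT.
    by rewrite le_eqVlt => /predU1P[->|]; [left|right].
  by case=> [->|/ltW].
by rewrite setUC -csurv_open; apply: measureU0 => //; exact: distribution_set1.
Qed.

Hypothesis X0 : cdf X 0 = 0%E.

Lemma survival_csurv : survival csurv.
Proof.
have cni : {homo csurv : v w / v <= w >-> w <= v}.
  move=> v w vw; rewrite lerB// fine_le ?cdf_fin_num//.
  exact: cdf_nondecreasing.
split => //.
- move=> v v0; rewrite /csurv (_ : cdf X v = 0%E) ?subr0//.
  by apply/eqP; rewrite eq_le cdf_ge0 andbT -X0 cdf_nondecreasing.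
- move=> u v h; rewrite leNgt; apply/negP => vu.
  have cw : \forall w \near v^'-, csurv w < u.
    exact: (cvgr_lt _ (cvg_at_left_filter (@continuous_csurv v))).
  near v^'- => w.
  have wv : w < v by near: w; exact: nbhs_left_lt.
  have : csurv w < u by near: w.
  by rewrite ltNge h.
- by move=> v; rewrite -lee_fin -csurvE.
- move=> u u0.
  have c1 : \forall v \near +oo, 1 - u < fine (cdf X v).
    apply: (cvgr_gt (1 : R)); last by rewrite gtrBl.
    exact: (fine_cvg (cvg_cdfy1 X)).
  near (+oo : set_system R) => v; exists v; rewrite /csurv ltrBlDr -ltrBlDl.
  by near: v.
Unshelve. all: by end_near. Qed.

Lemma measurable_survq1 (G : R -> R) : survival G ->
  measurable_fun [set: R] (survq G).
Proof.
move=> sG.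
have h := @measurable_survq R _ unit (fun=> G) (fun=> sG) (fun=> measurable_cst _).
exact: (measurableT_comp h (pair1_measurable tt)).
Qed.

Lemma csurv_law (A : set R) : measurable A ->
  distribution Q X A = unif (survq csurv @^-1` A).
Proof.
have mS := measurable_survq1 survival_csurv.
pose m : {measure set R -> \bar R} :=
  [the measure _ R of pushforward unif (survq csurv)].
apply: (@measure_eq_itvcy (distribution Q X) (m mS)) => //.
  by rewrite (le_lt_trans (probability_le1 _ _))// ltry.
move=> a; apply: (etrans (csurvE a)); rewrite -(unif_survq _ survival_csurv).
rewrite /m/= /pushforward; congr (unif _).
by apply/seteqP; split => x /=; rewrite in_itv/= andbT.
Qed.

Lemma ge0_integral_csurv (f : R -> \bar R) :
  measurable_fun [set: R] f -> (forall x, 0 <= f x)%E ->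
  (\int[Q]_w f (X w) = \int[unif]_u f (survq csurv u))%E.
Proof.
move=> mf f0.
have mS := measurable_survq1 survival_csurv.
rewrite -[RHS](@ge0_integral_pushforward _ _ _ _ _ _ mS _ setT f)//.
rewrite -[LHS](@ge0_integral_distribution _ _ _ _ _ _ X f)//.
by apply: eq_measure_integral => A mA _; exact: csurv_law.
Qed.

End continuous_law.

(** * Bounds and limits of slice densities *)

Section slice.
Context {R : realType}.

(** The density is nonzero only for [r >= s >= c], where [(r - s)^j / j! <= r^j] and
    [r^j / r^D <= c^(-(D - j))]. Asking for [0 < c ^+ (D - j)] instead of [0 < c] admits [c = 0]
    when [j = D], the case of survival functions. *)
Lemma slice_density_le D j (c s r : R) : (j <= D)%N -> 0 <= c -> c <= s ->
  0 <= r -> 0 < c ^+ (D - j) ->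
  slice_density D j s r <= D`!%:R / c ^+ (D - j).
Proof.
move=> jD c0 cs; rewrite le_eqVlt => /predU1P[<-|r0] cD; rewrite /slice_density.
  case: D => [|D] in jD cD *; last by rewrite expr0n invr0 mulr0 divr_ge0// ltW.
  move: jD; rewrite leqn0 => /eqP ->; rewrite subnn !expr0 ler_wpM2r// ler_piMr//.
  by rewrite /tpow; case: ifP => // _; rewrite divr1.
have [rs|sr] := ltP r s.
  by rewrite tpow_lt0 ?subr_lt0// mulr0 mul0r divr_ge0// ltW.
rewrite -mulrA ler_wpM2l// ler_pdivrMr ?exprn_gt0// mulrC ler_pdivlMr//.
rewrite tpowE ?subr_ge0//.
apply: (@le_trans _ _ (r ^+ j * r ^+ (D - j))); last by rewrite -exprD subnKC.
apply: ler_pM.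
- by rewrite divr_ge0// exprn_ge0// subr_ge0.
- exact: ltW.
- apply: (@le_trans _ _ ((r - s) ^+ j)).
    by rewrite ler_pdivrMr ?ltr0n ?fact_gt0// ler_peMr ?exprn_ge0 ?subr_ge0// ler1n fact_gt0.
  by rewrite lerXn2r// ?nnegrE ?subr_ge0 ?(ltW r0)// lerBlDr lerDl (le_trans c0).
- by rewrite lerXn2r// ?nnegrE ?(ltW r0)// (le_trans cs).
Qed.

(** The origin is excluded because [tpow 0] jumps there. *)
Lemma cvg_tpow j (xn : nat -> R) (x : R) : x != 0 -> xn n @[n --> \oo] --> x ->
  tpow j (xn n) @[n --> \oo] --> tpow j x.
Proof.
move=> x0 xnx; have [xlt|xgt|/eqP] := ltgtP x 0; last by rewrite (negbTE x0).
  rewrite tpow_lt0//; apply: cvg_near_cst.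
  by near=> n; rewrite tpow_lt0//; near: n; exact: (cvgr_lt _ xnx).
have h : \forall n \near \oo, tpow j (xn n) = xn n ^+ j / j`!%:R.
  by near=> n; rewrite tpowE// ltW//; near: n; exact: (cvgr_gt _ xnx).
rewrite tpowE ?ltW//.
apply: cvg_trans (_ : xn n ^+ j / j`!%:R @[n --> \oo] --> x ^+ j / j`!%:R).
  by apply: near_eq_cvg; apply: filterS h => n ->.
apply: cvgM; last exact: cvg_cst.
exact: (cvg_comp _ _ xnx (@exprn_continuous R j x)).
Unshelve. all: by end_near. Qed.

Lemma cvg_slice_density D j (sn rn : nat -> R) (s r : R) :
  0 < r -> r != s -> sn n @[n --> \oo] --> s -> rn n @[n --> \oo] --> r ->
  slice_density D j (sn n) (rn n) @[n --> \oo] --> slice_density D j s r.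
Proof.
move=> r0 rs sns rnr; apply: cvgM.
  apply: cvgM; first exact: cvg_cst.
  by apply: cvg_tpow; [rewrite subr_eq0|exact: cvgB].
apply: cvgV; first by rewrite expf_neq0// gt_eqF.
exact: (cvg_comp _ _ rnr (@exprn_continuous R D r)).
Qed.

Lemma slice_density_nonincreasing D j (s s' r : R) : 0 <= r -> s <= s' ->
  slice_density D j s' r <= slice_density D j s r.
Proof.
move=> r0 ss; rewrite ler_wpM2r ?invr_ge0 ?exprn_ge0// ler_wpM2l//.
by rewrite ler_tpow// lerB.
Qed.

End slice.

(** * Mean densities on a common probability space *)

Section mean_density.
Context {R : realType} {d : measure_display} {T : measurableType d}
  (Q : probability T R) (rad : {RV Q >-> R}).

Definition radial := [/\ continuous (cdf rad), cdf rad 0 = 0%E &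
  forall w, 0 <= rad w].

Lemma mean_density_ge0 D j s : (forall w, 0 <= rad w) ->
  (0 <= mean_density rad D j s)%E.
Proof. by move=> r0; apply: integral_ge0 => w _; rewrite lee_fin slice_density_ge0. Qed.

Lemma measurable_slice_rad D j :
  measurable_fun [set: R * T] (fun sw => (slice_density D j sw.1 (rad sw.2))%:E).
Proof.
have mr : measurable_fun [set: R * T] (fun sw => rad sw.2).
  by apply: measurableT_comp.
apply/measurable_EFinP; apply: measurable_funM.
  apply: measurable_funM => //.
  by apply: (measurableT_comp (measurable_tpow j)); exact: measurable_funB.
by apply: (measurableT_comp measurable_inv); exact: measurable_funX.
Qed.

Lemma measurable_mean_density D j : (forall w, 0 <= rad w) ->
  measurable_fun [set: R] (mean_density rad D j).
Proof.
move=> r0; apply: (measurable_fun_fubini_tonelli_F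
  (fun sw : R * T => (slice_density D j sw.1 (rad sw.2))%:E)).
  exact: measurable_slice_rad.
by move=> sw; rewrite lee_fin slice_density_ge0.
Qed.

Hypothesis rrad : radial.

Lemma unif_survq_null (A : set R) : measurable A -> distribution Q rad A = 0%E ->
  {ae unif, forall u, ~ A (survq (csurv rad) u)}.
Proof.
have [cr r0 rge0] := rrad.
move=> mA A0; exists (survq (csurv rad) @^-1` A); split.
- rewrite -[X in measurable X]setTI; apply: measurable_survq1 => //.
  exact: survival_csurv.
- by rewrite -csurv_law.
- by move=> u /= /contrapT.
Qed.

(* Here the integral runs over one probability space for all laws of [rad]. *)
Lemma mean_density_coupling D j s :
  mean_density rad D j s =
  (\int[unif]_u (slice_density D j s (survq (csurv rad) u))%:E)%E.
Proof.
have [cr r0 rge0] := rrad.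
(* The transfer to [unif] asks for an integrand that is nonnegative at all real arguments; the
   positive part provides it and leaves radii and their quantiles unchanged. *)
transitivity (\int[Q]_w (slice_density D j s (Num.max 0 (rad w)))%:E)%E.
  by apply: eq_integral => w _; rewrite max_r.
rewrite (ge0_integral_csurv cr r0 (f := fun r => (slice_density D j s (Num.max 0 r))%:E)).
- apply: eq_integral => u _; rewrite max_r// survq_ge0//.
  exact: survival_csurv.
- apply/measurable_EFinP; apply: (measurableT_comp (measurable_slice_density D j s)).
  by apply: measurable_maxr.
- by move=> r; rewrite lee_fin slice_density_ge0// le_max lexx.
Qed.

End mean_density.

Section density_bounds.
Context {R : realType} {d : measure_display} {T : measurableType d}
  (Q : probability T R) (rad : {RV Q >-> R}).
Hypothesis rrad : radial rad.

Lemma mean_density_le D j (c s : R) : (j <= D)%N -> 0 <= c -> c <= s ->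
  0 < c ^+ (D - j) ->
  (mean_density rad D j s <= (D`!%:R / c ^+ (D - j))%:E)%E.
Proof.
have [_ _ r0] := rrad; move=> jD c0 cs cD.
apply: (@le_trans _ _ (\int[Q]_w (D`!%:R / c ^+ (D - j))%:E)%E).
  apply: ge0_le_integral => //.
  - by move=> w _; rewrite lee_fin slice_density_ge0.
  - apply/measurable_EFinP.
    exact: (measurableT_comp (measurable_slice_density D j s)).
  - by move=> w _; rewrite lee_fin slice_density_le.
rewrite integral_cst//.
by rewrite [X in (_ * X)%E](probability_setT Q) mule1.
Qed.

(** Faithful where [mean_densityE] applies. At [s = 0] with [j < D] the expectation may be infinite,
    and [fine] then returns 0. *)
Definition hdens D j (s : R) : R := fine (mean_density rad D j s).

Lemma mean_densityE D j s : (j <= D)%N -> 0 <= s -> 0 < s ^+ (D - j) ->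
  mean_density rad D j s = (hdens D j s)%:E.
Proof.
have [_ _ r0] := rrad; move=> jD s0 sD; rewrite fineK// ge0_fin_numE.
  by rewrite (le_lt_trans (mean_density_le jD s0 (lexx s) sD))// ltry.
exact: mean_density_ge0.
Qed.

Lemma hdens_ge0 D j s : 0 <= hdens D j s.
Proof. by have [_ _ r0] := rrad; apply: fine_ge0; exact: mean_density_ge0. Qed.

Lemma measurable_hdens D j : measurable_fun [set: R] (hdens D j).
Proof.
have [_ _ r0] := rrad; by apply: measurableT_comp => //; exact: measurable_mean_density.
Qed.

Lemma mean_density_nonincreasing D j (s s' : R) : s <= s' ->
  (mean_density rad D j s' <= mean_density rad D j s)%E.
Proof.
have [_ _ r0] := rrad; move=> ss.
have m z : measurable_fun [set: T] (fun w => (slice_density D j z (rad w))%:E).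
  by apply/measurable_EFinP; exact: (measurableT_comp (measurable_slice_density D j z)).
apply: ge0_le_integral => //.
- by move=> w _; rewrite lee_fin slice_density_ge0.
- by move=> w _; rewrite lee_fin slice_density_nonincreasing.
Qed.

Lemma hdens_nonincreasing D j (s s' : R) : (j <= D)%N ->
  0 <= s -> 0 < s ^+ (D - j) -> s <= s' -> hdens D j s' <= hdens D j s.
Proof.
move=> jD s0 sD ss; rewrite -lee_fin -!mean_densityE//.
- exact: mean_density_nonincreasing.
- exact: le_trans ss.
- by rewrite (lt_le_trans sD)// lerXn2r// nnegrE// (le_trans s0).
Qed.

Lemma hdens_le D j (s : R) : (j <= D)%N -> 0 <= s -> 0 < s ^+ (D - j) ->
  hdens D j s <= D`!%:R / s ^+ (D - j).
Proof.
by move=> jD s0 sD; rewrite -lee_fin -mean_densityE// mean_density_le.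
Qed.

(** The integrand is [r^D / r^D = 1] except at [r = 0], which has probability 0. *)
Lemma hdens0 D : hdens D D 0 = 1.
Proof.
have [cr r00 r0] := rrad.
apply: EFin_inj; rewrite -mean_densityE//; last by rewrite subnn.
rewrite mean_density_coupling// -[RHS](@probability_setT _ _ _ (unif : probability R R)).
rewrite -[RHS]mul1e -integral_cst//; apply: ae_eq_integral => //.
  apply/measurable_EFinP; apply: (measurableT_comp (measurable_slice_density D D 0)).
  by apply: measurable_survq1; exact: survival_csurv.
have := unif_survq_null rrad (measurable_set1 0) (distribution_set1 cr 0).
apply: filterS => u /eqP u0 _; congr EFin.
have q0 : 0 < survq (csurv rad) u.
  by rewrite lt_neqAle eq_sym u0 survq_ge0//; exact: survival_csurv.
rewrite /slice_density subr0 tpowE ?ltW// mulrCA divff ?mulr1 ?divff//.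
by rewrite expf_neq0// gt_eqF.
Qed.

(** Tonelli: for each radius the factor [D! / r^D] does not depend on [x], and the hypothesis
    evaluates the rest at [c = rad w]. *)
Lemma integral_mean_density d' (T' : measurableType d')
    (m : {sigma_finite_measure set T' -> \bar R}) (A : set T') (S : T' -> R)
    D j j' (a : R) : measurable A -> measurable_fun [set: T'] S ->
  (forall c, (\int[m]_(x in A) (tpow j (c - S x))%:E = (tpow j' (c - a))%:E)%E) ->
  (\int[m]_(x in A) mean_density rad D j (S x) = mean_density rad D j' a)%E.
Proof.
have [_ _ r0] := rrad; move=> mA mS h.
pose f (xw : T' * T) := ((slice_density D j (S xw.1) (rad xw.2))%:E * (\1_A xw.1)%:E)%E.
have mf : measurable_fun [set: T' * T] f.
  apply: emeasurable_funM.
    have mSr : measurable_fun [set: T' * T] (fun xw => (S xw.1, xw.2)).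
      by apply: measurable_fun_pair => //; exact: measurableT_comp.
    exact: (measurableT_comp (measurable_slice_rad rad D j) mSr).
  by apply/measurable_EFinP; apply: measurableT_comp.
have f0 xw : (0 <= f xw)%E by rewrite mule_ge0// lee_fin ?slice_density_ge0.
transitivity (\int[m]_x \int[Q]_w f (x, w))%E.
  rewrite integral_mkcond epatch_indic; apply: eq_integral => x _.
  rewrite /f/= ge0_integralZr//.
  - apply/measurable_EFinP.
    exact: (measurableT_comp (measurable_slice_density D j (S x))).
  - by move=> w _; rewrite lee_fin slice_density_ge0.
rewrite fubini_tonelli//; apply: eq_integral => w _.
have k0 : 0 <= D`!%:R / rad w ^+ D by rewrite divr_ge0// exprn_ge0.
transitivity (\int[m]_(x in A) ((D`!%:R / rad w ^+ D)%:E * (tpow j (rad w - S x))%:E))%E.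
  rewrite [RHS]integral_mkcond epatch_indic; apply: eq_integral => x _.
  rewrite /f/=; congr (_ * _)%E; rewrite -EFinM; congr EFin.
  by rewrite /slice_density mulrAC.
rewrite ge0_integralZl//; last 2 first.
- apply/measurable_EFinP/measurable_funTS.
  by apply: (measurableT_comp (measurable_tpow j)); exact: measurable_funB.
- by move=> x _; rewrite lee_fin tpow_ge0.
by rewrite h -EFinM /slice_density [in RHS]mulrAC.
Qed.

End density_bounds.

Lemma csurv_cvg {R : realType} (en : nat -> measure_display)
    (Un : forall n, measurableType (en n)) (Qn : forall n, probability (Un n) R)
    (radn : forall n, {RV (Qn n) >-> R})
    (e : measure_display) (U : measurableType e) (Q : probability U R)
    (rad : {RV Q >-> R}) : continuous (cdf rad) ->
  cvg_in_distribution Qn radn Q rad ->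
  forall v, csurv (radn n) v @[n --> \oo] --> csurv rad v.
Proof.
move=> cr rc v; apply: cvgB; first exact: cvg_cst.
apply: fine_cvg; rewrite fineK ?cdf_fin_num//; apply: rc; exact: cr.
Qed.

(** Dominated convergence on [unif]: the common lower bound [c] of the arguments supplies a constant
    dominating function, and convergence can fail only where the limit radius is 0 or [s], or on the
    null set of [ae_survq_cvg]. Moving arguments [sn] make the lemma yield continuity too, with
    constant radii. *)
Lemma hdens_cvg {R : realType} (en : nat -> measure_display)
    (Un : forall n, measurableType (en n)) (Qn : forall n, probability (Un n) R)
    (radn : forall n, {RV (Qn n) >-> R})
    (e : measure_display) (U : measurableType e) (Q : probability U R)
    (rad : {RV Q >-> R}) (D j : nat) (sn : nat -> R) (c s : R) :
  (forall n, radial (radn n)) -> radial rad ->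
  (forall v, csurv (radn n) v @[n --> \oo] --> csurv rad v) ->
  (j <= D)%N -> 0 <= c -> 0 < c ^+ (D - j) -> (forall n, c <= sn n) ->
  sn n @[n --> \oo] --> s ->
  hdens (radn n) D j (sn n) @[n --> \oo] --> hdens rad D j s.
Proof.
move=> rrn rr cc jD c0 cD csn sns.
have cs : c <= s.
  by rewrite -(cvg_lim _ sns)//; apply: limr_ge; [exact: cvgP sns|exact: nearW].
have s0 n : 0 <= sn n by exact: le_trans (csn n).
have cD' x : c <= x -> 0 < x ^+ (D - j).
  by move=> cx; rewrite (lt_le_trans cD)// lerXn2r// nnegrE// (le_trans c0).
apply: fine_cvg; rewrite -mean_densityE ?cD'//; last exact: le_trans cs.
rewrite mean_density_coupling//.
under eq_fun do rewrite mean_density_coupling//.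
have mq n : measurable_fun [set: R] (survq (csurv (radn n))).
  by apply: measurable_survq1; have [? ? _] := rrn n; exact: survival_csurv.
have mq' : measurable_fun [set: R] (survq (csurv rad)).
  by apply: measurable_survq1; have [? ? _] := rr; exact: survival_csurv.
have mf n : measurable_fun [set: R]
    (fun u => (slice_density D j (sn n) (survq (csurv (radn n)) u))%:E).
  by apply/measurable_EFinP; exact: (measurableT_comp (measurable_slice_density _ _ _)).
have mf' : measurable_fun [set: R]
    (fun u => (slice_density D j s (survq (csurv rad) u))%:E).
  by apply/measurable_EFinP; exact: (measurableT_comp (measurable_slice_density _ _ _)).
have sv n : survival (csurv (radn n)).
  by have [? ? _] := rrn n; exact: survival_csurv.
have sv' : survival (csurv rad) by have [? ? _] := rr; exact: survival_csurv.
have cr : continuous (cdf rad) by have [] := rr.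
have h1 : {ae unif, forall u, setT u ->
    (slice_density D j (sn n) (survq (csurv (radn n)) u))%:E @[n --> \oo] -->
    (slice_density D j s (survq (csurv rad) u))%:E}.
  have a1 := unif_survq_null rr (measurable_set1 0) (distribution_set1 cr 0).
  have a2 := unif_survq_null rr (measurable_set1 s) (distribution_set1 cr s).
  have a3 := ae_survq_cvg sv sv' cc.
  move: a1 a2 a3; apply: filterS3 => u /eqP q0 /eqP qs qc _.
  apply: cvg_EFin; first exact: nearW.
  apply: cvg_slice_density => //.
  by rewrite lt_neqAle eq_sym q0 survq_ge0.
have h2 : unif.-integrable setT (cst (D`!%:R / c ^+ (D - j))%:E).
  exact: finite_measure_integrable_cst.
have h3 : {ae unif, forall u n, setT u ->
    (`|(slice_density D j (sn n) (survq (csurv (radn n)) u))%:E| <=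
     cst (D`!%:R / c ^+ (D - j))%:E u)%E}.
  apply: aeW => u n _; rewrite gee0_abs lee_fin.
    by rewrite slice_density_le// survq_ge0.
  by rewrite slice_density_ge0// survq_ge0.
by have [_ _ h] := dominated_convergence measurableT mf mf' h1 h2 h3; exact: h.
Qed.

(** * Integration against densities and convergence of integrals *)

Section density.
Context {R : realType} d (T : measurableType d).
Local Open Scope ereal_scope.

(** The formula holds for the Radon-Nikodym derivative, and [g], having the same integrals over
    measurable sets, equals it almost everywhere. *)
Lemma ge0_integral_density (nu : {finite_measure set T -> \bar R})
    (mu : {sigma_finite_measure set T -> \bar R}) (g : T -> R) :
  measurable_fun [set: T] g -> (forall x, 0 <= g x)%R ->
  (forall A, measurable A -> nu A = \int[mu]_(x in A) (g x)%:E) ->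
  forall f, measurable_fun [set: T] f -> (forall x, 0 <= f x) ->
  \int[nu]_x f x = \int[mu]_x (f x * (g x)%:E).
Proof.
move=> mg g0 nuE f mf f0.
have numu : nu `<< mu.
  apply/null_content_dominatesP => A mA A0.
  by rewrite nuE// null_set_integral//; exact/measurable_EFinP/measurable_funTS.
have iRN := Radon_Nikodym_SigmaFinite.f_integrable numu.
have mRN := measurable_int _ iRN.
rewrite -(Radon_Nikodym_SigmaFinite.change_of_variables numu)//.
apply: ae_eq_integral => //.
- exact: emeasurable_funM.
- by apply: emeasurable_funM => //; exact/measurable_EFinP.
have : ae_eq mu setT (Radon_Nikodym_SigmaFinite.f nu mu) (EFin \o g).
  apply: integral_ae_eq => //; first exact/measurable_EFinP.
  move=> E _ mE; rewrite -Radon_Nikodym_SigmaFinite.f_integral//.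
  exact: nuE.
by apply: filterS => x /(_ I) /= -> _.
Qed.

Lemma integral_density_le (mu : {measure set T -> \bar R}) (h : T -> R) (M : R)
    (phi : T -> R) : measurable_fun [set: T] h -> (forall x, 0 <= h x)%R ->
  \int[mu]_x (h x)%:E < +oo -> measurable_fun [set: T] phi ->
  (forall x, `|phi x| <= M)%R ->
  mu.-integrable setT (fun x => (phi x * h x)%:E) /\
  `|\int[mu]_x (phi x * h x)%:E| <= M%:E * \int[mu]_x (h x)%:E.
Proof.
move=> mh h0 hy mphi phiM.
have M0 : (0 <= M)%R by rewrite (le_trans _ (phiM point)).
have mph : measurable_fun [set: T] (fun x => (phi x * h x)%:E).
  by apply/measurable_EFinP; exact: measurable_funM.
have le : \int[mu]_x `|(phi x * h x)%:E| <= M%:E * \int[mu]_x (h x)%:E.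
  rewrite -ge0_integralZl//; last 2 first.
  - exact/measurable_EFinP.
  - by move=> x _; rewrite lee_fin.
  apply: ge0_le_integral => //.
  - exact: measurableT_comp.
  - by apply: measurable_funeM; exact/measurable_EFinP.
  - by move=> x _; rewrite -EFinM lee_fin normrM (ger0_norm (h0 x)) ler_wpM2r.
split.
  apply/integrableP; split => //; apply: le_lt_trans le _.
  by rewrite lte_mul_pinfty.
by apply: le_trans (le_abse_integral _ _ _) le.
Qed.

(* [phin n] converges only where the limit density is positive; the mass of
   [hn n] that [min (hn n) h] misses vanishes since all densities integrate
   to 1. *)
Lemma scheffe_dct (mu : {measure set T -> \bar R}) (hn : nat -> T -> R)
    (h : T -> R) (phin : nat -> T -> R) (phi : T -> R) (M : R) :
  (forall n, measurable_fun [set: T] (hn n)) -> measurable_fun [set: T] h ->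
  (forall n x, 0 <= hn n x)%R -> (forall x, 0 <= h x)%R ->
  (forall n, \int[mu]_x (hn n x)%:E = 1) -> \int[mu]_x (h x)%:E = 1 ->
  {ae mu, forall x, hn n x @[n --> \oo] --> h x} ->
  (forall n, measurable_fun [set: T] (phin n)) -> measurable_fun [set: T] phi ->
  (forall n x, `|phin n x| <= M)%R -> (forall x, `|phi x| <= M)%R ->
  {ae mu, forall x, (0 < h x)%R -> phin n x @[n --> \oo] --> phi x} ->
  \int[mu]_x (phin n x * hn n x)%:E @[n --> \oo] -->
  \int[mu]_x (phi x * h x)%:E.
Proof.
move=> mhn mh hn0 h0 ihn ih hnh mphin mphi phinM phiM phinphi.
pose k n x := Num.min (hn n x) (h x).
have mk n : measurable_fun [set: T] (k n) by exact: measurable_minr.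
have k0 n x : (0 <= k n x)%R by rewrite le_min hn0 h0.
have kh n x : (k n x <= h x)%R by rewrite ge_min lexx orbT.
have khn n x : (k n x <= hn n x)%R by rewrite ge_min lexx.
have kcvg : {ae mu, forall x, k n x @[n --> \oo] --> h x}.
  move: hnh; apply: filterS => x hx.
  apply/cvgrPdist_lt => e e0.
  have /cvgrPdist_lt /(_ e e0) := hx; apply: filterS => n.
  by rewrite /k minEle; case: ifPn => // _ _; rewrite subrr normr0.
(* Stated for arbitrary test functions because it serves twice: for [phin], and for the constant 1,
   which shows that the mass of [k n] tends to 1. Where [h] vanishes so does [k n]; elsewhere
   [K * h] dominates. *)
have key (psin : nat -> T -> R) (psi : T -> R) (K : R) :
    (forall n, measurable_fun [set: T] (psin n)) -> measurable_fun [set: T] psi ->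
    (forall n x, `|psin n x| <= K)%R ->
    {ae mu, forall x, (0 < h x)%R -> psin n x @[n --> \oo] --> psi x} ->
    \int[mu]_x (psin n x * k n x)%:E @[n --> \oo] -->
    \int[mu]_x (psi x * h x)%:E.
  move=> mpsin mpsi psinK psinpsi.
  have K0 : (0 <= K)%R by rewrite (le_trans _ (psinK 0%N point)).
  have m1 n : measurable_fun [set: T] (fun x => (psin n x * k n x)%:E).
    by apply/measurable_EFinP; exact: measurable_funM.
  have m2 : measurable_fun [set: T] (fun x => (psi x * h x)%:E).
    by apply/measurable_EFinP; exact: measurable_funM.
  have h1 : {ae mu, forall x, setT x ->
      (psin n x * k n x)%:E @[n --> \oo] --> (psi x * h x)%:E}.
    move: kcvg psinpsi; apply: filterS2 => x kx px _.
    apply: cvg_EFin; first exact: nearW.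
    have [hx|hx] := ltP 0%R (h x); first exact: cvgM (px hx) kx.
    have hx0 : h x = 0%R by apply/eqP; rewrite eq_le hx h0.
    have kx0 n : k n x = 0%R.
      by apply/eqP; rewrite eq_le k0 andbT -hx0 kh.
    rewrite hx0 mulr0; apply: cvg_near_cst; apply: nearW => n /=.
    by rewrite kx0 mulr0.
  have h2 : mu.-integrable setT (fun x => (K * h x)%:E).
    have [] := @integral_density_le mu h K (cst K) mh h0 _ _ _ => //.
    - by rewrite ih ltry.
    - by move=> x; rewrite ger0_norm.
  have h3 : {ae mu, forall x n, setT x -> `|(psin n x * k n x)%:E| <= (K * h x)%:E}.
    apply: aeW => x n _; rewrite lee_fin normrM ler_pM//.
    by rewrite ger0_norm.
  by have [_ _ H] := dominated_convergence measurableT m1 m2 h1 h2 h3; exact: H.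
have ik n : \int[mu]_x (k n x)%:E <= 1.
  rewrite -(ihn n); apply: ge0_le_integral => //.
  - by move=> x _; rewrite lee_fin.
  - exact/measurable_EFinP.
  - exact/measurable_EFinP.
  - by move=> x _; rewrite lee_fin.
have cA := key phin phi M mphin mphi phinM phinphi.
have c1 : \int[mu]_x (k n x)%:E @[n --> \oo] --> 1.
  have n1 (n : nat) (x : T) : (`|cst 1%R x| <= 1 :> R)%R by rewrite normr1.
  have c1 : {ae mu, forall x, (0 < h x)%R ->
      (fun=> cst 1%R x : R) n @[n --> \oo] --> (cst 1%R x : R)}.
    by apply: aeW => x _; exact: cvg_cst.
  have := key (fun=> cst 1%R) (cst 1%R) 1%R (fun=> measurable_cst _)
    (measurable_cst _) n1 c1.
  under eq_fun do under eq_integral do rewrite mul1r.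
  by under eq_integral do rewrite mul1r; rewrite ih.
have ikn n : mu.-integrable setT (fun x => (phin n x * k n x)%:E) /\
    `|\int[mu]_x (phin n x * k n x)%:E| <= M%:E * \int[mu]_x (k n x)%:E.
  by apply: integral_density_le => //; rewrite (le_lt_trans (ik n))// ltry.
pose B n := \int[mu]_x (phin n x * (hn n x - k n x))%:E.
have ihk n : \int[mu]_x (hn n x - k n x)%:E = 1 - \int[mu]_x (k n x)%:E.
  under eq_integral do rewrite EFinB.
  rewrite integralB//= ?ihn//.
  - apply/integrableP; split; first exact/measurable_EFinP.
    by under eq_integral do rewrite gee0_abs ?lee_fin//; rewrite ihn ltry.
  - apply/integrableP; split; first exact/measurable_EFinP.
    by under eq_integral do rewrite gee0_abs ?lee_fin//;
      rewrite (le_lt_trans (ik n))// ltry.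
have iB n : mu.-integrable setT (fun x => (phin n x * (hn n x - k n x))%:E) /\
    `|B n| <= M%:E * (1 - \int[mu]_x (k n x)%:E).
  rewrite -ihk; apply: integral_density_le => //.
  - exact: measurable_funB.
  - by move=> x; rewrite subr_ge0.
  - apply: (@le_lt_trans _ _ (\int[mu]_x (hn n x)%:E)); last by rewrite ihn ltry.
    apply: ge0_le_integral => //.
    + by move=> x _; rewrite lee_fin subr_ge0.
    + by apply/measurable_EFinP; exact: measurable_funB.
    + exact/measurable_EFinP.
    + by move=> x _; rewrite lee_fin gerBl.
have Bcvg : B n @[n --> \oo] --> 0.
  apply/cvg_abse0P; apply: (@squeeze_cvge _ _ _ _ (cst 0) _
      (fun n => M%:E * (1 - \int[mu]_x (k n x)%:E))).
  - by apply: nearW => n; rewrite abse_ge0/=; have [] := iB n.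
  - exact: cvg_cst.
  - rewrite [X in _ --> X](_ : _ = M%:E * (1 - 1)); last by rewrite subee// mule0.
    apply: cvgeZl => //; apply: cvgeB => //; exact: cvg_cst.
rewrite [X in _ --> X](_ : _ = \int[mu]_x (phi x * h x)%:E + 0); last by rewrite adde0.
have -> : (fun n => \int[mu]_x (phin n x * hn n x)%:E) =
    (fun n => \int[mu]_x (phin n x * k n x)%:E + B n).
  apply/funext => n; rewrite /B -integralD//; [|exact: (ikn n).1|exact: (iB n).1].
  by apply: eq_integral => x _; rewrite -EFinD -mulrDr addrC subrK.
by apply: cvgeD => //; rewrite fin_num_adde_defl.
Qed.

End density.

(** * Conditional laws realized by quantile transforms *)

Section rectangles.
Context {R : realType} d1 d2 (T1 : measurableType d1) (T2 : measurableType d2).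

Lemma measure_eq_rect (m1 m2 : {measure set (T1 * T2) -> \bar R}) :
  (m1 setT < +oo)%E ->
  (forall A B, measurable A -> measurable B -> m1 (A `*` B) = m2 (A `*` B)) ->
  forall A, measurable A -> m1 A = m2 A.
Proof.
move=> m1y m12.
apply: (measure_unique [set A `*` B | A in measurable & B in measurable]
  (fun=> setT)).
- exact: measurable_prod_measurableType.
- move=> _ _ [A1 mA1 [B1 mB1 <-]] [A2 mA2 [B2 mB2 <-]].
  exists (A1 `&` A2); first exact: measurableI.
  by exists (B1 `&` B2); [exact: measurableI|rewrite setXI].
- by move=> _; exists setT => //; exists setT => //; rewrite setXTT.
- by rewrite bigcup_const//; exists 0%N.
- by move=> _ [A mA [B mB <-]]; exact: m12.
- by [].
Qed.

End rectangles.

Definition mfun_of {d1 d2} {T1 : measurableType d1} {T2 : measurableType d2}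
    (f : T1 -> T2) (mf : measurable_fun [set: T1] f) : {mfun T1 >-> T2} :=
  HB.pack_for {mfun T1 >-> T2} f (isMeasurableFun.Build _ _ _ _ f mf).

Section survival_kernel.
Context {R : realType} {d'} {T' : measurableType d'} (G : T' -> R -> R).
Hypothesis sG : forall z, survival (G z).
Hypothesis mG : forall v, measurable_fun [set: T'] (G^~ v).

Let mV : measurable_fun [set: T' * R] (fun zu => survq (G zu.1) zu.2).
Proof. exact: measurable_survq. Qed.

Let mVz z : measurable_fun [set: R] (survq (G z)).
Proof. exact: (measurableT_comp mV (pair1_measurable z)). Qed.

Definition skern (z : T') : {measure set R -> \bar R} :=
  distribution unif (mfun_of (mVz z)).

Lemma skernE z A : skern z A = unif (survq (G z) @^-1` A).
Proof. by []. Qed.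

(** The value at [z] is the uniform measure of the section at [z] of a set that is measurable in the
    product, by joint measurability of the quantile. *)
Lemma measurable_skern (A : set R) : measurable A ->
  measurable_fun [set: T'] (skern ^~ A).
Proof.
move=> mA.
pose B := (fun zu : T' * R => survq (G zu.1) zu.2) @^-1` A.
have mB : measurable B by rewrite -[X in measurable X]setTI; exact: mV.
have := @measurable_fun_xsection _ _ _ _ _ unif B mB.
apply: eq_measurable_fun => z _; rewrite skernE /=; congr (unif _).
by apply/seteqP; split => u; rewrite xsectionE.
Qed.

Lemma skernT z : skern z setT = 1%E.
Proof. exact: probability_setT. Qed.

HB.instance Definition _ := isKernel.Build _ _ T' R R skern measurable_skern.

HB.instance Definition _ := Kernel_isProbability.Build _ _ T' R R skern skernT.

Lemma skern_itvcy z v : skern z `[v, +oo[%classic = (G z v)%:E.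
Proof.
rewrite skernE -(unif_survq v (sG z)); congr (unif _).
by apply/seteqP; split => u /=; rewrite in_itv/= andbT.
Qed.

Section joint_law.
Context {d} {T : measurableType d} (P : probability T R) (Y : {RV P >-> R})
  (Z : {RV P >-> T'}).
Hypothesis joint : forall v B, measurable B ->
  (P (Y @^-1` [set` `[v, +oo[] `&` Z @^-1` B) =
   \int[distribution P Z]_(z in B) (G z v)%:E)%E.

Notation PZ := (distribution P Z).

Definition markov_space : probability (T' * (R * R))%type R :=
  (PZ \x (unif \x unif))%E.

Let mS (p : R * R -> R) : measurable_fun [set: R * R] p ->
  measurable_fun [set: T' * (R * R)] (fun x => survq (G x.1) (p x.2)).
Proof.
move=> mp; have mq : measurable_fun [set: T' * (R * R)] (fun x => (x.1, p x.2)).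
  by apply: measurable_fun_pair => //; exact: measurableT_comp.
exact: (measurableT_comp mV mq).
Qed.

Definition markov_fst : {RV markov_space >-> R} := mfun_of (mS measurable_fst).
Definition markov_snd : {RV markov_space >-> R} := mfun_of (mS measurable_snd).
Definition markov_cond : {RV markov_space >-> T'} := mfun_of measurable_fst.

Let mrv {d0} {T0 : measurableType d0} (X : {mfun (T' * (R * R))%type >-> T0}) A :
  measurable A -> measurable (X @^-1` A).
Proof. by move=> mA; rewrite -[X in measurable X]setTI; exact: measurable_funPT. Qed.

(** For fixed [z] the event is a rectangle in the two uniform variables; this factorization is the
    conditional independence. *)
Lemma markov_spaceE A A' B : measurable A -> measurable A' -> measurable B ->
  markov_space ((markov_fst @^-1` A `&` markov_snd @^-1` A') `&` markov_cond @^-1` B) =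
  (\int[PZ]_(z in B) (skern z A * skern z A'))%E.
Proof.
move=> mA mA' mB; rewrite [RHS]integral_mkcond.
set E := (X in markov_space X).
transitivity (\int[PZ]_z (unif \x unif)%E (xsection E z))%E; first by [].
apply: eq_integral => z _; rewrite patchE; case: ifPn => zB.
  rewrite (_ : xsection _ z =
      (survq (G z) @^-1` A) `*` (survq (G z) @^-1` A')).
    rewrite !skernE; apply: product_measure1E.
      by rewrite -[X in measurable X]setTI; exact: mVz.
    by rewrite -[X in measurable X]setTI; exact: mVz.
  apply/seteqP; split => u; rewrite xsectionE; first by case.
  by move=> [uA uA']; split => //; exact/set_mem.
rewrite (_ : xsection _ z = set0) ?measure0//.
apply/seteqP; split => u //; rewrite xsectionE => -[_ h].
by move: zB; rewrite notin_setE.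
Qed.

(** The hypothesis [joint] speaks of half-lines only. For fixed [B] both sides are finite measures
    in [A], and half-lines determine those. *)
Lemma joint_skern A B : measurable A -> measurable B ->
  (P (Y @^-1` A `&` Z @^-1` B) = \int[PZ]_(z in B) skern z A)%E.
Proof.
move=> mA mB.
have mZB : measurable (Z @^-1` B).
  by rewrite -[X in measurable X]setTI; exact: measurable_funPT.
have mY : measurable_fun [set: T] Y by exact: measurable_funPT.
pose m1 : {measure set R -> \bar R} :=
  [the measure _ R of pushforward (mrestr P mZB) Y].
have mcB : measurable (markov_cond @^-1` B) by exact: mrv.
have mf : measurable_fun [set: T' * (R * R)] markov_fst by exact: measurable_funPT.
(* The integral of the kernel as an image of the restricted Markov space, so that its additivity in
   [A] is inherited. *)
pose m2 : {measure set R -> \bar R} :=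
  [the measure _ R of pushforward (mrestr markov_space mcB) markov_fst].
have m2E C : measurable C -> m2 mf C = (\int[PZ]_(z in B) skern z C)%E.
  move=> mC; rewrite /m2 /= /pushforward /mrestr.
  rewrite -[X in X `&` _]setIT -(preimage_setT markov_snd) markov_spaceE//.
  by apply: eq_integral => z _; rewrite [X in (_ * X)%E]skernT mule1.
rewrite -m2E//; apply: (@measure_eq_itvcy R (m1 mY) (m2 mf)) => //.
  rewrite /m1/= /pushforward /mrestr (le_lt_trans (probability_le1 _ _))// ?ltry//.
  by apply: measurableI => //; rewrite preimage_setT.
move=> a; rewrite m2E//; apply: (etrans (joint _ mB)).
by apply: eq_integral => z _; rewrite skern_itvcy.
Qed.

Lemma markov_fst_law :
  eq_in_law markov_space P (fun u => (markov_fst u, markov_cond u)) (fun w => (Y w, Z w)).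
Proof.
have m1 : measurable_fun [set: T' * (R * R)] (fun u => (markov_fst u, markov_cond u)).
  by apply: measurable_fun_pair; exact: measurable_funPT.
have m2 : measurable_fun [set: T] (fun w => (Y w, Z w)).
  by apply: measurable_fun_pair; exact: measurable_funPT.
move=> A mA.
apply: (@measure_eq_rect _ _ _ _ _ (distribution markov_space (mfun_of m1))
  (distribution P (mfun_of m2))) => //.
  by rewrite (le_lt_trans (probability_le1 _ _))// ltry.
move=> B C mB mC; apply: etrans (esym (joint_skern mB mC)).
rewrite -[LHS]/(markov_space (markov_fst @^-1` B `&` markov_cond @^-1` C)).
rewrite -[X in X `&` _]setIT -(preimage_setT markov_snd) markov_spaceE//.
by apply: eq_integral => z _; rewrite [X in (_ * X)%E]skernT mule1.
Qed.

End joint_law.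

End survival_kernel.

(** * The Markov product built from a survival kernel *)

Section markov_product.
Context {R : realType} {d'} {T' : measurableType d'} (G : T' -> R -> R).
Hypothesis sG : forall z, survival (G z).
Hypothesis mG : forall v, measurable_fun [set: T'] (G^~ v).
Context {d} {T : measurableType d} (P : probability T R) (Y : {RV P >-> R})
  (Z : {RV P >-> T'}).
Hypothesis joint : forall v B, measurable B ->
  (P (Y @^-1` [set` `[v, +oo[] `&` Z @^-1` B) =
   \int[distribution P Z]_(z in B) (G z v)%:E)%E.

Notation PZ := (distribution P Z).
Notation Q := (markov_space Z).
Notation V1 := (markov_fst sG mG Z).
Notation V2 := (markov_snd sG mG Z).
Notation Z' := (markov_cond Z).
Notation kappa := (skern sG mG).

Lemma skern_fin z A : measurable A -> kappa z A \is a fin_num.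
Proof. by move=> mA; exact: fin_num_measure. Qed.

Lemma fine_skern01 z A : measurable A -> 0 <= fine (kappa z A) <= 1.
Proof.
move=> mA; apply/andP; split; first exact: fine_ge0.
by rewrite -lee_fin fineK ?skern_fin// -(skernT sG mG z) le_measure ?inE.
Qed.

Lemma integral_markov_cond (f : T' -> \bar R) B : measurable B ->
  (\int[distribution Q Z']_(z in B) f z = \int[PZ]_(z in B) f z)%E.
Proof.
move=> mB; apply: eq_measure_integral => A mA _.
have := markov_spaceE sG mG Z measurableT measurableT mA.
rewrite !preimage_setT !setTI => h; apply: etrans h _.
transitivity (\int[PZ]_(z in A) 1)%E; last by rewrite integral_cst// mul1e.
by apply: eq_integral => z _; rewrite !skernT mule1.
Qed.

Lemma is_cond_prob_skern A A' : measurable A -> measurable A' ->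
  is_cond_prob Q (V1 @^-1` A `&` V2 @^-1` A') Z'
    (fun z => fine (kappa z A) * fine (kappa z A')).
Proof.
move=> mA mA'.
have mk B : measurable B -> measurable_fun [set: T'] (fun z => fine (kappa z B)).
  by move=> mB; apply: measurableT_comp => //; exact: measurable_kernel.
split.
  apply: (@le_integrable _ _ _ _ _ _ _ (cst 1%E)) => //.
  - by apply/measurable_EFinP; apply: measurable_funM; exact: mk.
  - move=> z _; rewrite gee0_abs /= ?normr1 lee_fin.
      have /andP[? ?] := fine_skern01 z mA; have /andP[? ?] := fine_skern01 z mA'.
      by rewrite mulr_ile1.
    by rewrite mulr_ge0// fine_ge0.
  - exact: finite_measure_integrable_cst.
move=> B mB; rewrite integral_markov_cond//; apply: etrans (esym (markov_spaceE sG mG Z mA mA' mB)).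
by apply: eq_integral => z _; rewrite EFinM !fineK ?skern_fin.
Qed.

Lemma is_cond_prob_skern1 A : measurable A ->
  is_cond_prob Q (V1 @^-1` A) Z' (fun z => fine (kappa z A)).
Proof.
move=> mA; have := is_cond_prob_skern mA measurableT.
rewrite preimage_setT setIT.
by under eq_fun do rewrite [X in _ * fine X]skernT mulr1.
Qed.

Lemma is_cond_prob_skern2 A : measurable A ->
  is_cond_prob Q (V2 @^-1` A) Z' (fun z => fine (kappa z A)).
Proof.
move=> mA; have := is_cond_prob_skern measurableT mA.
rewrite preimage_setT setTI.
by under eq_fun do rewrite [X in fine X * _]skernT mul1r.
Qed.

Let mrv {d0} {T0 : measurableType d0} (X : {mfun (T' * (R * R))%type >-> T0}) A :
  measurable A -> measurable (X @^-1` A).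
Proof. by move=> mA; rewrite -[X in measurable X]setTI; exact: measurable_funPT. Qed.

Let ae_skern (V : {RV Q >-> R}) A : measurable A ->
  is_cond_prob Q (V @^-1` A) Z' (fun z => fine (kappa z A)) ->
  {ae distribution Q Z', forall z,
    fine (kappa z A) = cond_prob Q (V @^-1` A) Z' z}.
Proof.
move=> mA h; apply: is_cond_prob_ae h _; apply: cond_probP; exact: mrv.
Qed.

Let mV12 : measurable_fun [set: T' * (R * R)] (fun u => (V1 u, V2 u)).
Proof. by apply: measurable_fun_pair; exact: measurable_funPT. Qed.

Definition markov_law : probability (R * R)%type R :=
  distribution Q (mfun_of mV12).

(** The kernel provides versions of all conditional probabilities involved, and these agree almost
    everywhere with the chosen [cond_prob]. *)
Lemma markov_lawP : is_markov_product P Y Z markov_law.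
Proof.
exists _, _, Q, V1, V2, Z', kappa; split.
- exact: markov_fst_law.
- move=> A mA; have := ae_skern mA (is_cond_prob_skern1 mA).
  by apply: filterS => z <-; rewrite fineK// skern_fin.
- move=> A mA; have := ae_skern mA (is_cond_prob_skern2 mA).
  by apply: filterS => z <-; rewrite fineK// skern_fin.
- move=> A B mA mB.
  have h1 := ae_skern mA (is_cond_prob_skern1 mA).
  have h2 := ae_skern mB (is_cond_prob_skern2 mB).
  have h3 : {ae distribution Q Z', forall z,
      fine (kappa z A) * fine (kappa z B) =
      cond_prob Q (V1 @^-1` A `&` V2 @^-1` B) Z' z}.
    apply: is_cond_prob_ae (is_cond_prob_skern mA mB) _; apply: cond_probP.
    by apply: measurableI; exact: mrv.
  by move: h1 h2 h3; apply: filterS3 => z <- <- <-.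
- by [].
Qed.

(** The conditional expectation of [f] at the pair given [Z = z]; it is finite for bounded
    measurable [f]. *)
Definition markov_mean (f : R * R -> R) (z : T') : R :=
  fine (\int[unif \x unif]_u (f (survq (G z) u.1, survq (G z) u.2))%:E)%E.

Lemma integral_markov_law (f : R * R -> R) (M : R) :
  measurable_fun [set: R * R] f -> (forall x, `|f x| <= M) ->
  [/\ (\int[markov_law]_x (f x)%:E = \int[PZ]_z (markov_mean f z)%:E)%E,
    measurable_fun [set: T'] (markov_mean f) &
    forall z, `|markov_mean f z| <= M].
Proof.
move=> mf fM.
have M0 : 0 <= M by rewrite (le_trans _ (fM point)).
pose uu : probability (R * R)%type R := (unif \x unif)%E.
pose F (x : T' * (R * R)) : \bar R := (f (V1 x, V2 x))%:E.
have mF : measurable_fun [set: T' * (R * R)] F.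
  by apply/measurable_EFinP; exact: (measurableT_comp mf mV12).
have iF : Q.-integrable setT F.
  apply: (@le_integrable _ _ _ _ _ _ _ (cst M%:E)) => //.
  - by move=> x _; rewrite /F/= lee_fin (ger0_norm M0).
  - exact: finite_measure_integrable_cst.
have mFz z : measurable_fun [set: R * R] (fun u => F (z, u)).
  exact: (measurableT_comp mF (pair1_measurable z)).
have bF z : (`|\int[unif \x unif]_u F (z, u)| <= M%:E)%E.
  apply: le_trans (le_abse_integral _ _ _) _ => //.
  apply: (@le_trans _ _ (\int[(unif \x unif)%E]_u M%:E)%E).
    apply: ge0_le_integral => //.
    - exact: measurableT_comp.
    - by move=> u _; rewrite /F lee_fin.
  rewrite integral_cst//.
  by rewrite [X in (_ * X)%E](@probability_setT _ _ _ (unif \x unif : probability _ _)%E) mule1.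
have finF z : (\int[unif \x unif]_u F (z, u))%E \is a fin_num.
  by rewrite fin_num_abs (le_lt_trans (bF z))// ltry.
have mmE z : (markov_mean f z)%:E = (\int[unif \x unif]_u F (z, u))%E.
  by rewrite /markov_mean fineK//; exact: finF.
split.
- rewrite /markov_law integral_pushforward//.
  + rewrite preimage_setT -[LHS]/(\int[Q]_x F x)%E.
    rewrite -(@integral12_prod_meas1 _ _ _ _ _ PZ uu F iF).
    by apply: eq_integral => z _; rewrite mmE.
  + exact/measurable_EFinP.
- have := @measurable_fubini_F _ _ _ _ _ PZ uu F iF.
  by move=> mm; apply/measurable_EFinP; apply: eq_measurable_fun mm => z _; exact/esym/mmE.
- by move=> z; rewrite -lee_fin -abse_EFin mmE.
Qed.

(** The hypothesis [joint] says that [G] is a version; this ties it to the version chosen in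
    [xi]. *)
Lemma cond_prob_survival v :
  {ae PZ, forall z, cond_prob P [set w | v <= Y w] Z z = G z v}.
Proof.
have E : [set w | v <= Y w] = Y @^-1` [set` `[v, +oo[].
  by apply/seteqP; split => w /=; rewrite in_itv/= andbT.
rewrite E; apply: (is_cond_prob_ae (E := Y @^-1` [set` `[v, +oo[])).
  apply: cond_probP; rewrite -[X in measurable X]setTI; exact: measurable_funPT.
split; last by move=> B mB; rewrite joint.
apply: (@le_integrable _ _ _ _ _ _ _ (cst 1%E)) => //.
- exact/measurable_EFinP.
- move=> z _; have [Gni G1 _ G0 _] := sG z.
  rewrite gee0_abs /= ?normr1 lee_fin//.
  by have [v0|v0] := leP v 0; [rewrite G1|rewrite -(G1 0)// Gni// ltW].
- exact: finite_measure_integrable_cst.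
Qed.

End markov_product.

(** * Measures given by densities, and the positive cone *)

Section density_measure.
Context {R : realType} d (T : measurableType d) (mu : {measure set T -> \bar R})
  (g : {mfun T >-> R}).

(* The absolute value makes this a measure for every g. *)
Definition density_measure (A : set T) : \bar R := (\int[mu]_(x in A) `|g x|%:E)%E.

Let density_measure0 : density_measure set0 = 0%E.
Proof. by rewrite /density_measure integral_set0. Qed.

Let density_measure_ge0 A : (0 <= density_measure A)%E.
Proof. by apply: integral_ge0 => x _; rewrite lee_fin. Qed.

Let density_measure_sigma_additive : semi_sigma_additive density_measure.
Proof.
move=> F mF tF mUF; rewrite /density_measure; apply: cvg_toP.
  apply: ereal_nondecreasing_is_cvgn => m n mn.
  apply: lee_sum_nneg_natr => // k _ _.
  by apply: integral_ge0 => x _; rewrite lee_fin.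
rewrite ge0_integral_bigcup//.
apply: measurable_funTS; apply/measurable_EFinP.
by apply: measurableT_comp.
Qed.

HB.instance Definition _ := isMeasure.Build _ _ _ density_measure
  density_measure0 density_measure_ge0 density_measure_sigma_additive.

End density_measure.

Lemma cvg_maxr0 {R : realType} (xn : nat -> R) (x : R) :
  xn k @[k --> \oo] --> x -> Num.max 0 (xn k) @[k --> \oo] --> Num.max 0 x.
Proof.
move=> xnx; apply/cvgrPdist_lt => e e0.
have /cvgrPdist_lt /(_ e e0) := xnx; apply: filterS => n.
apply: le_lt_trans; rewrite -[leRHS]normrN.
by case: (leP 0 x) => x0; case: (leP 0 (xn n)) => xn0; rewrite ?subrr ?normr0//
  ler_norml; have := ler_norm (- (x - xn n)); have := lerNnormlW (lexx `|- (x - xn n)|);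
  lra.
Qed.

Section positive_cone.
Context {R : realType}.

Definition pos_tuple m (a : m.-tuple R) : m.-tuple R :=
  [tuple Num.max 0 (tnth a i) | i < m].

Lemma tsum_pos_tuple m (a : m.-tuple R) : tsum (pos_tuple a) = psum a.
Proof. by apply: eq_bigr => i _; rewrite tnth_mktuple. Qed.

(** Positivity of the sum removes the origin, where the mean density may be infinite. *)
Definition pos_cone m : set (m.-tuple R) :=
  [set z | (forall i, 0 <= tnth z i) /\ 0 < tsum z].

Lemma measurable_pos_cone m : measurable (@pos_cone m).
Proof.
have -> : @pos_cone m = orthant [tuple 0 | i < m] `&` (@tsum R m @^-1` `]0, +oo[).
  apply/seteqP; split => z [/= z0 sz]; split.
  - by move=> i; rewrite tnth_mktuple.
  - by rewrite /= in_itv/= andbT.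
  - by move=> i; have := z0 i; rewrite tnth_mktuple.
  - by move: sz; rewrite in_itv/= andbT.
apply: measurableI; first exact: measurable_orthant.
by rewrite -[X in measurable X]setTI; apply: measurable_tsum.
Qed.

(** The indicator of [tsum z <= 0] is a [tpow 0], so the measure is [tpow m 0], which is 0 for
    [m > 0]. *)
Lemma leb_vertex m : (0 < m)%N ->
  (leb m).-negligible [set z : m.-tuple R | (forall i, 0 <= tnth z i) /\ tsum z <= 0].
Proof.
move=> m0.
have mB : measurable [set z : m.-tuple R | 0 <= 0 - tsum z].
  rewrite (_ : mkset _ = (fun z => 0 - tsum z) @^-1` `[0, +oo[).
    rewrite -[X in measurable X]setTI; apply: measurable_funB => //.
    exact: measurable_tsum.
  by apply/seteqP; split => u; rewrite /preimage /mkset in_itv/= andbT.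
exists (orthant [tuple 0 | i < m] `&` [set z : m.-tuple R | 0 <= 0 - tsum z]); split.
- by apply: measurableI => //; exact: measurable_orthant.
- transitivity (\int[leb m]_(z in orthant [tuple (0 : R)%R | i < m])
      (tpow 0 (0 - tsum z : R)%R)%:E)%E; last first.
    rewrite integral_orthant_tpow (_ : tsum _ = 0); last first.
      by rewrite /tsum big1// => i _; rewrite tnth_mktuple.
    by rewrite subrr tpowE// add0n expr0n eqn0Ngt m0 mul0r.
  rewrite setIC -integral_indic//; last exact: measurable_orthant.
  apply: eq_integral => z _; congr EFin; rewrite indicE /tpow.
  case: ifPn => h; first by rewrite mem_set// expr0 divr1.
  by rewrite memNset//; apply/negP.
- move=> z [z0 sz]; split; last by rewrite /mkset sub0r oppr_ge0.
  by move=> i; rewrite tnth_mktuple.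
Qed.

End positive_cone.

(** * Conditional survival functions *)

Section conditional_survival.
Context {R : realType} {e : measure_display} {U : measurableType e}
  (Q : probability U R) (rad : {RV Q >-> R}).
Hypothesis rrad : radial rad.
Context (D m : nat).
Hypothesis m0 : (0 < m)%N.
Hypothesis mD : (m <= D)%N.
Notation j := (D - m)%N.
Notation h := (hdens rad D j).

(* For v = 0 the density of m coordinates; for v > 0 the part of it carried by
   the event that another given coordinate is at least v. *)
Definition cone_dens (v : R) (z : m.-tuple R) : R :=
  h (v + tsum z) * \1_(@pos_cone R m) z.

Lemma cone_dens_ge0 v z : 0 <= cone_dens v z.
Proof. by rewrite mulr_ge0// hdens_ge0. Qed.

Lemma measurable_cone_dens v : measurable_fun [set: m.-tuple R] (cone_dens v).
Proof.
apply: measurable_funM.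
  apply: (measurableT_comp (measurable_hdens rrad D j)).
  by apply: measurable_funD => //; exact: measurable_tsum.
by apply: measurable_indic; exact: measurable_pos_cone.
Qed.

Lemma codim_expr_gt0 (x : R) : 0 < x -> 0 < x ^+ (D - j).
Proof. by move=> x0; rewrite exprn_gt0. Qed.

(** Off the cone the density is 0, so the corner may be replaced by its positive part; the only
    discrepancy is at the vertex. The [m] integrations then lift the index [D - m] to [D]. *)
Lemma integral_cone_dens (v : R) (a : m.-tuple R) : 0 <= v ->
  (\int[leb m]_(z in orthant a) (cone_dens v z)%:E =
   mean_density rad D D (v + psum a))%E.
Proof.
move=> v0.
transitivity (\int[leb m]_(z in orthant (pos_tuple a))
    mean_density rad D j (v + tsum z))%E; last first.
  transitivity (mean_density rad D (j + m) (v + tsum (pos_tuple a))); last first.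
    by rewrite subnK// tsum_pos_tuple.
  apply: integral_mean_density => //.
  - exact: measurable_orthant.
  - by apply: measurable_funD => //; exact: measurable_tsum.
  - move=> c; rewrite opprD addrA -integral_orthant_tpow.
    by apply: eq_integral => z _; rewrite opprD addrA.
rewrite integral_mkcond [RHS]integral_mkcond; apply: ae_eq_integral => //.
- apply/(measurable_restrictT _ _).1; first exact: measurable_orthant.
  by apply: measurable_funTS; apply/measurable_EFinP; exact: measurable_cone_dens.
- apply/(measurable_restrictT _ _).1; first exact: measurable_orthant.
  apply: measurable_funTS; have [_ _ r0] := rrad.
  apply: (measurableT_comp (measurable_mean_density D j r0)).
  by apply: measurable_funD => //; exact: measurable_tsum.
apply: negligibleS (leb_vertex m0) => z /= /not_implyP[_ zne].
apply: contrapT => zv; apply: zne; rewrite !patchE /cone_dens indicE.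
have [z0|z0] := pselect (forall i, 0 <= tnth z i).
  have sz : 0 < tsum z by rewrite ltNge; apply/negP => sz; apply: zv.
  rewrite [z \in @pos_cone R m]mem_set// mulr1.
  rewrite (_ : (z \in orthant (pos_tuple a)) = (z \in orthant a)).
    case: ifP => // _; rewrite mean_densityE//; first exact: leq_subr.
      by rewrite addr_ge0// ltW.
    by rewrite codim_expr_gt0// ltr_wpDl.
  apply/idP/idP; rewrite !inE => za i; have := za i; rewrite ?tnth_mktuple ge_max.
    by case/andP.
  by rewrite z0.
rewrite [z \in @pos_cone R m]memNset ?mulr0; last by case.
rewrite [z \in orthant (pos_tuple a)]memNset; first by case: ifP.
move=> za; apply: z0 => i; have := za i; rewrite tnth_mktuple ge_max.
by case/andP.
Qed.

(* Where the density vanishes the value is that of the Dirac mass at 0, so that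
   [cond_surv z] is a survival function for every z. *)
Definition cond_surv (z : m.-tuple R) (v : R) : R :=
  if 0 < cone_dens 0 z then cone_dens (Num.max 0 v) z / cone_dens 0 z
  else (v <= 0)%R%:R.

Lemma measurable_cond_surv v : measurable_fun [set: m.-tuple R] (cond_surv^~ v).
Proof.
apply: measurable_fun_ifT => //.
- by apply: measurable_fun_ltr => //; exact: measurable_cone_dens.
- apply: measurable_funM; first exact: measurable_cone_dens.
  by apply: (measurableT_comp measurable_inv); exact: measurable_cone_dens.
Qed.

Lemma cone_dens_gt0 z : 0 < cone_dens 0 z ->
  [/\ pos_cone z, 0 < tsum z & forall v, cone_dens v z = h (v + tsum z)].
Proof.
rewrite /cone_dens indicE; have [zc|zc] := boolP (z \in @pos_cone R m); last first.
  by rewrite mulr0 ltxx.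
move=> _; split; [exact: set_mem|by case/set_mem: zc|by move=> v; rewrite mulr1].
Qed.

Lemma cone_dens_nonincreasing z v w : 0 <= v -> v <= w ->
  cone_dens w z <= cone_dens v z.
Proof.
move=> v0 vw; rewrite /cone_dens indicE; have [zc|zc] := boolP (z \in @pos_cone R m); last first.
  by rewrite !mulr0.
have [_ sz] := set_mem zc; rewrite !mulr1 hdens_nonincreasing//; first exact: leq_subr.
- by rewrite addr_ge0// ltW.
- by rewrite codim_expr_gt0// ltr_wpDl.
- by rewrite lerD2r.
Qed.

(** Where [cone_dens 0 z] vanishes, monotonicity forces the right-hand side to vanish too, so the
    default value of [cond_surv] does no harm. *)
Lemma cond_survM z v : cond_surv z v * cone_dens 0 z = cone_dens (Num.max 0 v) z.
Proof.
rewrite /cond_surv; case: ifPn => z0; first by rewrite divfK// gt_eqF.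
have zz : cone_dens 0 z = 0 by apply/eqP; rewrite eq_le cone_dens_ge0 leNgt z0.
rewrite zz mulr0; apply/esym/eqP; rewrite eq_le cone_dens_ge0 andbT -[leRHS]zz.
by rewrite cone_dens_nonincreasing// le_max lexx.
Qed.

Lemma survival_cond_surv z : survival (cond_surv z).
Proof.
have [z0|z0] := boolP (0 < cone_dens 0 z); last first.
  have -> : cond_surv z = fun v => (v <= 0)%R%:R.
    by apply/funext => v; rewrite /cond_surv (negbTE z0).
  split.
  - by move=> v w vw; rewrite ler_nat; case: (leP w 0) => // /(le_trans vw) ->.
  - by move=> v ->.
  - move=> u v uv; have [v0|v0] := leP v 0.
      by have := uv (v - 1); rewrite ltrBlDr ltrDl ltr01 => /(_ isT); rewrite lerBlDr (le_trans v0).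
    have v2 : 0 < v / 2 by rewrite divr_gt0.
    have := uv (v / 2); rewrite [v / 2 <= 0]leNgt v2; apply.
    by rewrite ltr_pdivrMr// mulr_natr mulr2n ltrDl.
  - by [].
  - by move=> u u0; exists 1; rewrite leNgt ltr01.
have -> : cond_surv z = fun v => cone_dens (Num.max 0 v) z / cone_dens 0 z.
  by apply/funext => v; rewrite /cond_surv z0.
have [[zp _] sz cE] := cone_dens_gt0 z0.
split.
- move=> v w vw; rewrite ler_pM2r ?invr_gt0// cone_dens_nonincreasing//.
    by rewrite le_max lexx.
  by rewrite ge_max !le_max lexx vw orbT.
- by move=> v v0; rewrite max_l// divff// gt_eqF.
- move=> u v uv.
  (* Left-continuity is tested along one sequence increasing to [v], with [hdens_cvg] for a constant
     sequence of radii. *)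
  pose w k := v - k.+1%:R^-1.
  have wv k : w k < v by rewrite ltrBlDr ltrDl.
  have wcvg : w k @[k --> \oo] --> v.
    rewrite -[X in _ --> X]subr0; apply: cvgB; first exact: cvg_cst.
    exact: cvg_harmonic.
  have mcvg : Num.max 0 (w k) + tsum z @[k --> \oo] --> Num.max 0 v + tsum z.
    by apply: cvgD; [exact: cvg_maxr0|exact: cvg_cst].
  have hc : h (Num.max 0 (w k) + tsum z) @[k --> \oo] --> h (Num.max 0 v + tsum z).
    apply: (@hdens_cvg R _ _ _ (fun=> rad) _ _ _ rad D j _ (tsum z)) => //.
    - by move=> x; exact: cvg_cst.
    - exact: leq_subr.
    - exact: ltW.
    - exact: codim_expr_gt0.
    - by move=> k; rewrite lerDr le_max lexx.
  have gc : cone_dens (Num.max 0 (w k)) z / cone_dens 0 z @[k --> \oo] -->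
      cone_dens (Num.max 0 v) z / cone_dens 0 z.
    under eq_fun do rewrite cE; rewrite cE.
    by apply: cvgM hc _; exact: cvg_cst.
  rewrite -(cvg_lim _ gc)//; apply: limr_ge; first exact: cvgP gc.
  by apply: nearW => k; exact: uv.
- by move=> v; rewrite divr_ge0// cone_dens_ge0.
- move=> u u0.
  have uc : 0 < u * cone_dens 0 z by rewrite mulr_gt0.
  (* The goal is [D! / (v + tsum z)^m < u * cone_dens 0 z]. The second summand achieves it for
     exponent 1, and [v >= 1] makes the power [m >= 1] at least its base. *)
  pose v := 1 + D`!%:R / (u * cone_dens 0 z).
  have v1 : 1 <= v by rewrite /v lerDl divr_ge0// ltW.
  have v0 : 0 <= v by rewrite (le_trans ler01).
  have vs : v < v + tsum z by rewrite ltrDl.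
  exists v; rewrite max_r// ltr_pdivrMr// cE.
  apply: (@le_lt_trans _ _ (D`!%:R / (v + tsum z) ^+ (D - j))).
    apply: hdens_le => //; first exact: leq_subr.
      by rewrite addr_ge0// ltW.
    by rewrite codim_expr_gt0// addr_gt0// (lt_le_trans ltr01).
  rewrite ltr_pdivrMr; last by rewrite codim_expr_gt0// addr_gt0// (lt_le_trans ltr01).
  rewrite mulrC -ltr_pdivrMr//.
  apply: (@lt_le_trans _ _ v); first by rewrite /v ltrDr.
  apply: (le_trans (ltW vs)); rewrite subKn//.
  have v1s : 1 <= v + tsum z by rewrite (le_trans v1)// ltW.
  by rewrite -[leLHS]expr1; apply: ler_weXn2l.
Qed.

End conditional_survival.

(** * Joint law of a coordinate and a conditioning vector *)

Section bounded_density.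
Context {R : realType} d (T : measurableType d).
Local Open Scope ereal_scope.

(** Adding [M] makes [phi] nonnegative; the constant is subtracted again since [g] integrates to
    1. *)
Lemma bounded_integral_density (nu : probability T R)
    (mu : {sigma_finite_measure set T -> \bar R}) (g : T -> R) (phi : T -> R) (M : R) :
  measurable_fun [set: T] g -> (forall x, 0 <= g x)%R ->
  (forall A, measurable A -> nu A = \int[mu]_(x in A) (g x)%:E) ->
  measurable_fun [set: T] phi -> (forall x, `|phi x| <= M)%R ->
  \int[nu]_x (phi x)%:E = \int[mu]_x (phi x * g x)%:E.
Proof.
move=> mg g0 nuE mphi phiM.
have ig : \int[mu]_x (g x)%:E = 1 by rewrite -nuE// probability_setT.
have gy : \int[mu]_x (g x)%:E < +oo by rewrite ig ltry.
have M0 : (0 <= M)%R by rewrite (le_trans _ (phiM point)).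
have [i1 _] := integral_density_le mg g0 gy mphi phiM.
have [i2 _] := @integral_density_le R _ T mu g M (cst M) mg g0 gy (measurable_cst _)
  (fun=> eq_ind_r (fun y => y <= M)%R (lexx M) (ger0_norm M0)).
have i3 : nu.-integrable setT (EFin \o phi).
  apply: (@le_integrable _ _ _ _ _ _ _ (cst M%:E)) => //.
  - exact/measurable_EFinP.
  - by move=> x _; rewrite /= lee_fin (ger0_norm M0).
  - exact: finite_measure_integrable_cst.
have i4 : nu.-integrable setT (cst M%:E) by exact: finite_measure_integrable_cst.
have : \int[nu]_x ((phi x)%:E + M%:E) = \int[mu]_x ((phi x * g x)%:E + (M * g x)%:E).
  under [RHS]eq_integral do rewrite -EFinD -mulrDl EFinM.
  rewrite -(@ge0_integral_density _ _ _ nu mu g mg g0 nuE (fun x => (phi x + M)%:E)).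
  - by apply: eq_integral => x _; rewrite EFinD.
  - by apply/measurable_EFinP; exact: measurable_funD.
  - by move=> x; rewrite lee_fin -lerBlDr sub0r; have /ler_normlP[] := phiM x; lra.
rewrite integralD// integralD// integral_cst// [X in _ + _ * X](probability_setT nu) mule1.
rewrite [X in _ = _ + X](_ : _ = M%:E); last first.
  under eq_integral do rewrite EFinM.
  rewrite integralZl ?ig ?mule1//.
  apply/integrableP; split; first exact/measurable_EFinP.
  by under eq_integral do rewrite gee0_abs ?lee_fin//; rewrite ig ltry.
by move/(congr1 (fun x => x - M%:E)); rewrite !addeK.
Qed.

End bounded_density.

Section l1_pair.
Context {R : realType} {e : measure_display} {U : measurableType e}
  (Q : probability U R) (rad : {RV Q >-> R}) (D m : nat)
  {d : measure_display} {T : measurableType d}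
  (P : probability T R) (V : {RV P >-> R}) (Z : {RV P >-> m.-tuple R}).

(* Z has the law of m coordinates of rad * S_(D+1), and in [l1_pair] V is another
   coordinate of the same vector. *)
Definition l1_law := forall a, P (Z @^-1` orthant a) = mean_density rad D D (psum a).

Definition l1_pair := l1_law /\
  (forall v a, P (V @^-1` [set` `[v, +oo[] `&` Z @^-1` orthant a) =
     mean_density rad D D (Num.max 0 v + psum a)).

Hypothesis rrad : radial rad.
Hypothesis m0 : (0 < m)%N.
Hypothesis mD : (m <= D)%N.

Lemma l1_law_density (hZ : l1_law) A : measurable A ->
  distribution P Z A = (\int[leb m]_(z in A) (cone_dens rad D 0 z)%:E)%E.
Proof.
move=> mA.
pose g : {mfun m.-tuple R >-> R} := mfun_of (measurable_cone_dens (m := m) rrad D 0).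
have gE B : (\int[leb m]_(z in B) (cone_dens rad D 0 z)%:E)%E = density_measure (leb m) g B.
  by apply: eq_integral => z _; rewrite /g/= ger0_norm// cone_dens_ge0.
rewrite gE; apply: (@measure_eq_orthant _ _ (distribution P Z) (density_measure (leb m) g)) => //.
  by rewrite (le_lt_trans (probability_le1 _ _))// ltry.
move=> a; apply: etrans (gE _); rewrite integral_cone_dens// add0r; exact: hZ.
Qed.

Hypothesis VZ : l1_pair.

(** Both sides are finite measures in [B], compared on orthants. There the law of [Z] is replaced by
    its density, which cancels the denominator of [cond_surv]. *)
Lemma l1_pair_joint v B : measurable B ->
  (P (V @^-1` [set` `[v, +oo[] `&` Z @^-1` B) =
   \int[distribution P Z]_(z in B) (cond_surv rad D z v)%:E)%E.
Proof.
move=> mB.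
have sG := survival_cond_surv rrad m0 mD.
pose g : {mfun m.-tuple R >-> R} := mfun_of (measurable_cond_surv (m := m) rrad D v).
have G0 (z : m.-tuple R) : 0 <= cond_surv rad D z v by have [_ _ _ + _] := sG z; apply.
have gE C : (\int[distribution P Z]_(z in C) (cond_surv rad D z v)%:E)%E =
    density_measure (distribution P Z) g C.
  by apply: eq_integral => z _; rewrite /g/= ger0_norm.
have mV : measurable (V @^-1` [set` `[v, +oo[]).
  by rewrite -[X in measurable X]setTI; exact: measurable_funPT.
have mZ : measurable_fun [set: T] Z by exact: measurable_funPT.
pose m1 : {measure set (m.-tuple R) -> \bar R} :=
  [the measure _ R of pushforward (mrestr P mV) Z].
have m1E C : m1 mZ C = P (V @^-1` [set` `[v, +oo[] `&` Z @^-1` C).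
  by rewrite /m1/= /pushforward /mrestr setIC.
rewrite gE -m1E.
apply: (@measure_eq_orthant _ _ (m1 mZ) (density_measure (distribution P Z) g)) => //.
  rewrite [X in (X < _)%E]m1E (le_lt_trans (probability_le1 _ _))// ?ltry//.
  by apply: measurableI => //; rewrite preimage_setT.
move=> a; apply: (etrans (m1E _)); rewrite VZ.2; apply: etrans (gE _).
rewrite [RHS]integral_mkcond.
rewrite (@ge0_integral_density _ _ _ (distribution P Z) (leb m) (cone_dens rad D 0)).
- rewrite -integral_cone_dens ?le_max ?lexx// integral_mkcond.
  apply: eq_integral => z _; rewrite !patchE; case: ifPn => _; last by rewrite mul0e.
  by rewrite -EFinM cond_survM.
- exact: measurable_cone_dens.
- by move=> z; exact: cone_dens_ge0.
- exact: (l1_law_density VZ.1).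
- apply/(measurable_restrictT _ _).1; first exact: measurable_orthant.
  by apply: measurable_funTS; apply/measurable_EFinP; exact: measurable_cond_surv.
- by move=> z; rewrite patchE; case: ifPn => // _; rewrite lee_fin.
Qed.

End l1_pair.

(** * Borel structure of the plane *)

Section continuous_two_variables.
Context {R : realType}.

(** Test functions are continuous for the product topology, while the measures live on the product
    sigma-algebra; rational rectangles link the two. *)
Lemma open_measurable2 (A : set (R * R)) : open A -> measurable A.
Proof.
move=> oA.
pose B (q : (rat * rat) * (rat * rat)) : set (R * R) :=
  `]ratr q.1.1, ratr q.1.2[ `*` `]ratr q.2.1, ratr q.2.2[.
pose I := [set q | B q `<=` A].
have -> : A = \bigcup_(q in I) B q.
  apply/seteqP; split => [[x y] Axy|z [q Iq Bq]]; last exact: Iq.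
  have : nbhs (x, y) A by exact: open_nbhs_nbhs.
  move=> /nbhs_ballP[e /= e0 eA].
  have [a] := @rat_in_itvoo R (x - e) x ltac:(lra).
  have [b] := @rat_in_itvoo R x (x + e) ltac:(lra).
  have [c] := @rat_in_itvoo R (y - e) y ltac:(lra).
  have [f] := @rat_in_itvoo R y (y + e) ltac:(lra).
  rewrite !in_itv/= => /andP[f1 f2] /andP[c1 c2] /andP[b1 b2] /andP[a1 a2].
  exists ((a, b), (c, f)); last by split => /=; rewrite in_itv/= ?a2 ?b1 ?c2 ?f1.
  move=> [x' y'] [/=]; rewrite !in_itv/= => /andP[x1 x2] /andP[y1 y2].
  by apply: eA; split; rewrite /ball/= ltr_distl; apply/andP; split; lra.
rewrite bigcup_mkcond; apply: countable_bigcupT_measurable => // q.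
by case: ifPn => _; [exact: measurableX|exact: measurable0].
Qed.

Lemma continuous_measurable_fun2 (f : R * R -> R) : continuous f ->
  measurable_fun [set: R * R] f.
Proof.
move=> cf; apply: (measurability (@RGenOpens.G R)).
  exact: RGenOpens.measurableE.
move=> _ [_ [x [y ->]] <-]; rewrite setTI; apply: open_measurable2.
by apply: open_comp => // z _; exact: cf.
Qed.

End continuous_two_variables.

(** * Weak convergence of Markov products *)

Section markov_convergence.
Context {R : realType} (D m : nat).
Context (en : nat -> measure_display) (Un : forall n, measurableType (en n))
  (Qn : forall n, probability (Un n) R) (radn : forall n, {RV (Qn n) >-> R}).
Context (e : measure_display) (U : measurableType e) (Q : probability U R)
  (rad : {RV Q >-> R}).
Hypothesis rrn : forall n, radial (radn n).
Hypothesis rr : radial rad.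
Hypothesis radc : forall v, csurv (radn n) v @[n --> \oo] --> csurv rad v.
Hypothesis m0 : (0 < m)%N.
Hypothesis mD : (m <= D)%N.

Lemma cone_dens_cvg (v : R) (z : m.-tuple R) : 0 <= v ->
  cone_dens (radn n) D v z @[n --> \oo] --> cone_dens rad D v z.
Proof.
move=> v0; rewrite /cone_dens; have [zc|zc] := boolP (z \in @pos_cone R m); last first.
  rewrite indicE (negbTE zc) mulr0; under eq_fun do rewrite mulr0.
  exact: cvg_cst.
have [_ sz] := set_mem zc; have vs : 0 < v + tsum z by rewrite ltr_wpDl.
apply: cvgM; last exact: cvg_cst.
apply: (@hdens_cvg R _ _ _ _ _ _ _ rad D _ _ (v + tsum z)) => //.
- exact: leq_subr.
- exact: ltW.
- exact: codim_expr_gt0.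
- exact: cvg_cst.
Qed.

(** A positive limit density makes the densities eventually positive, so the default branch is
    eventually left. *)
Lemma cond_surv_cvg (v : R) (z : m.-tuple R) : 0 < cone_dens rad D 0 z ->
  cond_surv (radn n) D z v @[n --> \oo] --> cond_surv rad D z v.
Proof.
move=> z0; have c0 := @cone_dens_cvg 0 z (lexx 0).
rewrite [X in _ --> X]/cond_surv z0.
have cq : cone_dens (radn n) D (Num.max 0 v) z / cone_dens (radn n) D 0 z @[n --> \oo] -->
    cone_dens rad D (Num.max 0 v) z / cone_dens rad D 0 z.
  apply: cvgM; first by apply: cone_dens_cvg; rewrite le_max lexx.
  by apply: cvgV => //; rewrite gt_eqF.
apply: cvg_trans cq; apply: near_eq_cvg.
near=> n; rewrite /cond_surv ifT//.
by near: n; exact: (cvgr_gt _ c0).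
Unshelve. all: by end_near. Qed.

Let sG z := survival_cond_surv rr m0 mD z.
Let mG v := measurable_cond_surv (m := m) rr D v.
Let sGn n z := survival_cond_surv (rrn n) m0 mD z.
Let mGn n v := measurable_cond_surv (m := m) (rrn n) D v.

(** Bounded convergence under two independent uniforms: both quantiles converge off the strips
    [N * R] and [R * N], and [f] is continuous. *)
Lemma markov_mean_cvg (f : R * R -> R) (M : R) (z : m.-tuple R) :
  continuous f -> (forall x, `|f x| <= M) -> 0 < cone_dens rad D 0 z ->
  markov_mean (@cond_surv R _ _ _ (radn n) D m) f z @[n --> \oo] -->
  markov_mean (@cond_surv R _ _ _ rad D m) f z.
Proof.
move=> cf fM z0.
pose uu : probability (R * R)%type R := (unif \x unif)%E.
have mf := continuous_measurable_fun2 cf.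
have M0 : 0 <= M by rewrite (le_trans _ (fM point)).
have mq (G : R -> R) : survival G ->
    measurable_fun [set: R * R] (fun u => (f (survq G u.1, survq G u.2))%:E).
  move=> sG0; apply/measurable_EFinP.
  have mp : measurable_fun [set: R * R] (fun u => (survq G u.1, survq G u.2)).
    by apply: measurable_fun_pair; apply: (measurableT_comp (measurable_survq1 sG0)).
  exact: (measurableT_comp mf mp).
have aeq : {ae unif, forall u, survq (cond_surv (radn n) D z) u @[n --> \oo] -->
    survq (cond_surv rad D z) u}.
  by apply: ae_survq_cvg => // v; exact: cond_surv_cvg.
have [N [mN N0 NS]] := aeq.
have h1 : {ae uu, forall u, setT u ->
    (f (survq (cond_surv (radn n) D z) u.1, survq (cond_surv (radn n) D z) u.2))%:E
      @[n --> \oo] -->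
    (f (survq (cond_surv rad D z) u.1, survq (cond_surv rad D z) u.2))%:E}.
  exists ((N `*` setT) `|` (setT `*` N)); split.
  - by apply: measurableU; exact: measurableX.
  - apply: null_set_setU; try exact: measurableX.
      by apply: (etrans (product_measure1E unif unif mN measurableT)); rewrite [X in (X * _)%E]N0 mul0e.
    by apply: (etrans (product_measure1E unif unif measurableT mN)); rewrite [X in (_ * X)%E]N0 mule0.
  - move=> u /= /not_implyP[_ h].
    have [u1|u1] := pselect (N u.1); first by left.
    have [u2|u2] := pselect (N u.2); first by right.
    exfalso; apply: h; apply: cvg_EFin; first exact: nearW.
    have c1 : survq (cond_surv (radn n) D z) u.1 @[n --> \oo] --> survq (cond_surv rad D z) u.1.
      by apply: contrapT => h; apply: u1; apply: NS.
    have c2 : survq (cond_surv (radn n) D z) u.2 @[n --> \oo] --> survq (cond_surv rad D z) u.2.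
      by apply: contrapT => h; apply: u2; apply: NS.
    have c12 : (survq (cond_surv (radn n) D z) u.1, survq (cond_surv (radn n) D z) u.2)
        @[n --> \oo] -->
        (survq (cond_surv rad D z) u.1, survq (cond_surv rad D z) u.2).
      by apply: (@cvg_pair nat R R \oo (nbhs (survq (cond_surv rad D z) u.1)) (nbhs (survq (cond_surv rad D z) u.2))).
    have cfu := cf (survq (cond_surv rad D z) u.1, survq (cond_surv rad D z) u.2).
    exact: (continuous_cvg _ cfu c12).
have h2 : uu.-integrable setT (cst M%:E) by exact: finite_measure_integrable_cst.
have h3 : {ae uu, forall u n, setT u ->
    (`|(f (survq (cond_surv (radn n) D z) u.1, survq (cond_surv (radn n) D z) u.2))%:E|
      <= cst M%:E u)%E}.
  by apply: aeW => u n _; rewrite lee_fin.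
have [i1 _ h] := dominated_convergence measurableT (fun n => mq _ (sGn n z)) (mq _ (sG z)) h1 h2 h3.
apply: fine_cvg; rewrite /markov_mean fineK; first exact: h.
exact: integrable_fin_num i1.
Qed.

Context (dn : nat -> measure_display) (Tn : forall n, measurableType (dn n))
  (Pn : forall n, probability (Tn n) R) (Vn : forall n, {RV (Pn n) >-> R})
  (Zn : forall n, {RV (Pn n) >-> m.-tuple R}).
Context (d : measure_display) (T : measurableType d) (P : probability T R)
  (V : {RV P >-> R}) (Z : {RV P >-> m.-tuple R}).
(** Written with [cone_dens], all integrals are over one measure space and [scheffe_dct] applies. It
    serves for conditional means of test functions, for squared conditional survival functions and,
    with [m = 1], for the outer integral of xi. *)
Lemma l1_law_integral_cvg (phin : nat -> m.-tuple R -> R) (phi : m.-tuple R -> R) (M : R) :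
  (forall n, l1_law (radn n) D (Zn n)) -> l1_law rad D Z ->
  (forall n, measurable_fun [set: m.-tuple R] (phin n)) ->
  measurable_fun [set: m.-tuple R] phi ->
  (forall n z, `|phin n z| <= M) -> (forall z, `|phi z| <= M) ->
  (forall z, 0 < cone_dens rad D 0 z -> phin n z @[n --> \oo] --> phi z) ->
  (\int[distribution (Pn n) (Zn n)]_z (phin n z)%:E)%E @[n --> \oo] -->
  (\int[distribution P Z]_z (phi z)%:E)%E.
Proof.
move=> ZnL ZL mphin mphi phinM phiM phic.
rewrite (bounded_integral_density (measurable_cone_dens (m := m) rr D 0)
  (cone_dens_ge0 rr D 0) (l1_law_density rr m0 mD ZL) mphi phiM).
rewrite (_ : (fun n => _) =
    (fun n => \int[leb m]_z (phin n z * cone_dens (radn n) D 0 z)%:E)%E); last first.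
  apply/funext => n.
  exact: (bounded_integral_density (measurable_cone_dens (m := m) (rrn n) D 0)
    (cone_dens_ge0 (rrn n) D 0) (l1_law_density (rrn n) m0 mD (ZnL n)) (mphin n) (phinM n)).
apply: (@scheffe_dct R _ _ (leb m) _ _ _ _ M) => //.
- by move=> n; exact: measurable_cone_dens.
- exact: measurable_cone_dens.
- by move=> n z; exact: cone_dens_ge0.
- by move=> z; exact: cone_dens_ge0.
- by move=> n; rewrite -(l1_law_density (rrn n) m0 mD (ZnL n))// probability_setT.
- by rewrite -(l1_law_density rr m0 mD ZL)// probability_setT.
- by apply: aeW => z; exact: cone_dens_cvg.
- exact: aeW.
Qed.

Hypothesis VZn : forall n, l1_pair (radn n) D (Vn n) (Zn n).
Hypothesis VZ : l1_pair rad D V Z.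

Lemma l1_pair_markov_cvg : markov_products_cvg Pn P Vn Zn V Z.
Proof.
exists (fun n => markov_law (sGn n) (mGn n) (Zn n)), (markov_law sG mG Z); split.
- by move=> n; apply: markov_lawP => v B mB; exact: l1_pair_joint.
- by apply: markov_lawP => v B mB; exact: l1_pair_joint.
move=> f cf [M fM]; have mf := continuous_measurable_fun2 cf.
have [E mE bE] := integral_markov_law sG mG Z mf fM.
have h n := integral_markov_law (sGn n) (mGn n) (Zn n) mf fM.
rewrite E (_ : (fun n => _) = (fun n => \int[distribution (Pn n) (Zn n)]_z
    (markov_mean (@cond_surv R _ _ _ (radn n) D m) f z)%:E)%E); last first.
  by apply/funext => n; have [] := h n.
apply: (@l1_law_integral_cvg
  (fun n => markov_mean (@cond_surv R _ _ _ (radn n) D m) f)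
  (markov_mean (@cond_surv R _ _ _ rad D m) f) M).
- by move=> n; have [] := VZn n.
- by have [] := VZ.
- by move=> n; have [_ + _] := h n; exact.
- exact: mE.
- by move=> n; have [_ _] := h n; exact.
- exact: bE.
- by move=> z; exact: markov_mean_cvg.
Qed.

End markov_convergence.

(** * Subvectors of an l1-symmetric vector *)

Section subvectors.
Context {R : realType} {e : measure_display} {U : measurableType e}
  (Q : probability U R) (rad : {RV Q >-> R}) (D k : nat)
  {d : measure_display} {T : measurableType d}
  (P : probability T R) (W : {RV P >-> k.-tuple R}).
Hypothesis rrad : radial rad.
Hypothesis lawW : l1_law rad D W.

Lemma mean_density0 : mean_density rad D D 0 = 1%E.
Proof. by rewrite mean_densityE// ?subnn// hdens0. Qed.

Lemma l1_law_ge0 : P (~` (W @^-1` orthant [tuple 0 | i < k])) = 0%E.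
Proof.
have mW : measurable (W @^-1` orthant [tuple (0 : R) | i < k]).
  by rewrite -[X in measurable X]setTI; apply: measurable_funPT => //; exact: measurable_orthant.
rewrite probability_setC// lawW (_ : psum _ = 0) ?mean_density0 ?subee//.
by rewrite /psum big1// => i _; rewrite tnth_mktuple maxxx.
Qed.

(** Components of [W] are almost surely nonnegative, so a bound on some of them is an orthant event
    for [W] with corner 0 in the others, and zeros leave [psum] unchanged. *)
Lemma l1_law_sub m (Z : {RV P >-> m.-tuple R}) (f : 'I_m -> 'I_k) :
  injective f -> (forall w l, tnth (Z w) l = tnth (W w) (f l)) ->
  l1_law rad D Z.
Proof.
move=> finj ZE a.
(* By injectivity each sum has at most one term: it is the bound carried over by [f], or 0 off the
   image. *)
pose w := [tuple \sum_(l < m | f l == i) Num.max 0 (tnth a l) | i < k].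
have wf l : tnth w (f l) = Num.max 0 (tnth a l).
  rewrite tnth_mktuple (big_pred1 l)// => l'.
  by rewrite /= (inj_eq finj).
have w0 i : 0 <= tnth w i.
  by rewrite tnth_mktuple sumr_ge0// => l _; rewrite le_max lexx.
have -> : psum a = psum w.
  rewrite /psum (eq_bigr (fun i => tnth w i)); last by move=> i _; rewrite max_r.
  under [RHS]eq_bigr do rewrite tnth_mktuple.
  rewrite (exchange_big_dep xpredT)//=; apply: eq_bigr => l _.
  by rewrite (big_pred1 (f l))// => i; rewrite eq_sym.
rewrite -lawW.
have mS (A : set (k.-tuple R)) : measurable A -> measurable (W @^-1` A).
  by move=> mA; rewrite -[X in measurable X]setTI; exact: measurable_funPT.
have mZ : measurable (Z @^-1` orthant a).
  by rewrite -[X in measurable X]setTI; apply: measurable_funPT => //; exact: measurable_orthant.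
have mO := measurable_orthant [tuple (0 : R) | i < k].
have mw := measurable_orthant w.
have -> : W @^-1` orthant w = Z @^-1` orthant a `\` ~` (W @^-1` orthant [tuple 0 | i < k]).
  apply/seteqP; split => x.
    move=> xw; split.
      by move=> l; rewrite ZE; apply: le_trans (xw (f l)); rewrite wf le_max lexx orbT.
    by apply => i; rewrite tnth_mktuple; exact: le_trans (w0 i) (xw i).
  move=> [xa /contrapT x0] i.
  have xi0 : 0 <= tnth (W x) i by have := x0 i; rewrite tnth_mktuple.
  have [[l fl]|nf] := pselect (exists l, f l = i).
    by rewrite -fl wf ge_max fl xi0 -fl -ZE xa.
  rewrite tnth_mktuple big_pred0// => l; apply/negbTE/eqP => fl.
  by apply: nf; exists l.
rewrite measureD//=; [|exact/measurableC/mS|by rewrite (le_lt_trans (probability_le1 _ _))// ltry].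
rewrite (_ : P (_ `&` _) = 0%E) ?sube0//.
apply/eqP; rewrite eq_le measure_ge0 andbT -l1_law_ge0; apply: le_measure; rewrite ?inE//.
- by apply: measurableI => //; exact/measurableC/mS.
- exact/measurableC/mS.
Qed.

(** Prepending [V] to [Z] gives again a subvector, read off along [f']. *)
Lemma l1_pair_sub m (V : {RV P >-> R}) (Z : {RV P >-> m.-tuple R})
    (k0 : 'I_k) (f : 'I_m -> 'I_k) :
  injective f -> (forall l, f l != k0) ->
  (forall w, V w = tnth (W w) k0) ->
  (forall w l, tnth (Z w) l = tnth (W w) (f l)) ->
  l1_pair rad D V Z.
Proof.
move=> finj fk0 VE ZE; split; first exact: l1_law_sub ZE.
move=> v a.
have mVZ : measurable_fun [set: T] (fun w => cons_tuple (V w) (Z w)).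
  by apply: measurable_cons; exact: measurable_funPT.
pose f' (l : 'I_m.+1) := if unlift ord0 l is Some l' then f l' else k0.
have f'inj : injective f'.
  move=> l1 l2; rewrite /f'.
  case: (unliftP ord0 l1) => [l1'|] ->; case: (unliftP ord0 l2) => [l2'|] ->;
    rewrite ?liftK ?unlift_none//.
  - by move=> /finj ->.
  - by move=> /eqP; rewrite (negbTE (fk0 _)).
  - by move=> /esym /eqP; rewrite (negbTE (fk0 _)).
have := @l1_law_sub _ (mfun_of mVZ) f' f'inj _ (cons_tuple v a).
rewrite psum_cons => <-.
  congr (P _); apply/seteqP; split => x.
    by move=> [/=]; rewrite in_itv/= andbT => vV aZ; apply/orthant_cons.
  by move=> /orthant_cons[vV aZ]; split => //=; rewrite in_itv/= andbT.
move=> w l; rewrite /f'.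
by case: (unliftP ord0 l) => [l'|] ->; rewrite ?liftK ?unlift_none ?tnthS ?tnth0.
Qed.

End subvectors.

(** * Marginals and their quantile functions *)

Section tail.
Context {R : realType} {e : measure_display} {U : measurableType e}
  (Q : probability U R) (rad : {RV Q >-> R}) (D : nat).
Hypothesis rrad : radial rad.

(* The survival function of a single coordinate. *)
Definition tail (v : R) : R := hdens rad D D (Num.max 0 v).

(** [hdens_cvg] with constant radii; [j = D] allows the lower bound 0. *)
Lemma continuous_tail : continuous tail.
Proof.
move=> v; have hv := (@cvg_nbhsP R R^o tail v (tail v)).2; apply: hv => u uv.
apply: (@hdens_cvg R _ _ _ (fun=> rad) _ _ _ rad D D _ 0) => //.
- by move=> x; exact: cvg_cst.
- by rewrite subnn.
- by move=> n; rewrite le_max lexx.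
- exact: cvg_maxr0.
Qed.

Lemma mean_density_tail v : mean_density rad D D (Num.max 0 v) = (tail v)%:E.
Proof. by rewrite mean_densityE// ?subnn// le_max lexx. Qed.

Context {d : measure_display} {T : measurableType d}
  (P : probability T R) (V : {RV P >-> R}).
Hypothesis VT : forall v, P (V @^-1` [set` `[v, +oo[]) = (tail v)%:E.

Lemma tail_cdf v : cdf V v = (1 - tail v)%:E.
Proof.
suff h : distribution P V `]v, +oo[ = (tail v)%:E.
  rewrite /cdf -setCitvr; apply: (etrans (probability_setC (distribution P V) _)) => //.
  by rewrite [X in (_ - X)%E]h EFinB.
apply/eqP; rewrite eq_le; apply/andP; split.
  rewrite -VT; apply: le_measure; rewrite ?inE//; try by apply: measurable_funPTI.
  by move=> x /=; rewrite !in_itv/= !andbT => /ltW.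
apply/lee_addgt0Pr => r r0.
have /cvgrPdist_lt /(_ r r0) := cvg_at_right_filter (@continuous_tail v) => vw.
near v^'+ => w.
have wv : v < w by near: w; exact: nbhs_right_gt.
have cvw : `|tail v - tail w| < r by near: w.
apply: (@le_trans _ _ ((tail w)%:E + r%:E)%E).
  by rewrite -EFinD lee_fin -lerBlDl (le_trans (ler_norm _))// ltW.
rewrite leeD2r// -VT; apply: le_measure; rewrite ?inE//; try by apply: measurable_funPTI.
by move=> x /=; rewrite !in_itv/= !andbT; exact: lt_le_trans.
Unshelve. all: by end_near. Qed.

Lemma continuous_cdf_tail : continuous (cdf V).
Proof.
rewrite (_ : cdf V = fun v => (1 - tail v)%:E); last by apply/funext => v; exact: tail_cdf.
move=> v; apply: cvg_EFin; first exact: nearW.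
by apply: cvgB; [exact: cvg_cst|exact: continuous_tail].
Qed.

Lemma cdf_tail0 : cdf V 0 = 0%E.
Proof. by rewrite tail_cdf /tail maxxx hdens0// subrr. Qed.

Lemma csurv_tail v : csurv V v = tail v.
Proof. by rewrite /csurv tail_cdf /= opprB addrC subrK. Qed.

(** At the infimum, left-continuity of the distribution function rules out a value above [t], which
    would put smaller points into the set, and right-continuity rules out a value below [t]. Since
    [0 < t < 1], the set is bounded below by 0 and nonempty. *)
Lemma cdf_quantile t : 0 < t < 1 -> cdf V (quantile V t) = t%:E.
Proof.
move=> /andP[t0 t1]; rewrite tail_cdf; congr EFin.
pose C v := 1 - tail v.
have cC : continuous C.
  by move=> v; apply: cvgB; [exact: cvg_cst|exact: continuous_tail].
rewrite /quantile (_ : [set y | (t%:E <= cdf V y)%E] = [set y | t <= C y]); last first.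
  by apply/seteqP; split => y /=; rewrite tail_cdf lee_fin.
set E := [set y | t <= C y].
have lE : lbound E 0.
  move=> y /= ty; rewrite leNgt; apply/negP => y0; move: ty.
  have T1 : tail y = 1 by rewrite /tail (max_l (ltW y0)) hdens0.
  by rewrite /E /C /mkset T1 subrr leNgt t0.
have E0 : E !=set0.
  have [_ _ _ _ /(_ (1 - t))] := survival_csurv continuous_cdf_tail cdf_tail0.
  rewrite subr_gt0 => /(_ t1)[v]; rewrite csurv_tail => tv.
  by exists v; rewrite /E/= /C lerBrDl -lerBrDr ltW.
have hE : has_inf E by split => //; exists 0.
apply/eqP; rewrite eq_le; apply/andP; split.
  rewrite leNgt; apply/negP => tC.
  have h : \forall y \near (inf E)^'-, t < C y.
    exact: (cvgr_gt _ (cvg_at_left_filter (cC (inf E)))).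
  near (inf E)^'- => y.
  have yi : y < inf E by near: y; exact: nbhs_left_lt.
  have yE : E y by rewrite /E/= ltW//; near: y.
  by have := ge_inf hE.2 yE; rewrite leNgt yi.
rewrite leNgt; apply/negP => Ct.
have h : \forall y \near (inf E)^'+, C y < t.
  exact: (cvgr_lt _ (cvg_at_right_filter (cC (inf E)))).
near (inf E)^'+ => y.
have yi : inf E < y by near: y; exact: nbhs_right_gt.
have [z Ez zy] := inf_lt E0 yi.
have : t <= C y.
  apply: le_trans Ez _; have [hm _ _ _ _] := survival_csurv continuous_cdf_tail cdf_tail0.
  by rewrite /C lerB// -!csurv_tail hm// ltW.
by rewrite leNgt => /negP; apply; near: y.
Unshelve. all: by end_near. Qed.

End tail.

(** * Variances and the common denominator of xi *)

Section bounded_variance.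
Context {R : realType} d (T : measurableType d) (P : probability T R).
Local Open Scope ereal_scope.

Lemma bounded_integrable (X : T -> R) (M : R) : measurable_fun [set: T] X ->
  (forall w, `|X w| <= M)%R -> P.-integrable setT (EFin \o X).
Proof.
move=> mX XM; apply: (@le_integrable _ _ _ _ _ _ _ (cst M%:E)) => //.
- exact/measurable_EFinP.
- move=> x _; rewrite /= lee_fin (ger0_norm (le_trans (normr_ge0 _) (XM point))).
  exact: XM.
- exact: finite_measure_integrable_cst.
Qed.

Lemma bounded_variance (X : T -> R) : measurable_fun [set: T] X ->
  (forall w, `|X w| <= 1)%R ->
  'V_P[X] = (fine (\int[P]_w (X w ^+ 2)%:E) - fine (\int[P]_w (X w)%:E) ^+ 2)%:E.
Proof.
move=> mX X1.
pose mu : R := fine (\int[P]_w (X w)%:E).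
pose s : R := fine (\int[P]_w (X w ^+ 2)%:E).
rewrite -/mu -/s.
have iX := bounded_integrable mX X1.
have mX2 : measurable_fun [set: T] (fun w => X w ^+ 2)%R by exact: measurable_funX.
have iX2 : P.-integrable setT (EFin \o (fun w => X w ^+ 2)%R).
  by apply: (bounded_integrable mX2 (M := 1%R)) => w; rewrite normrX expr_le1.
have muE : \int[P]_w (X w)%:E = mu%:E by rewrite fineK//; exact: integrable_fin_num iX.
have sE : \int[P]_w (X w ^+ 2)%:E = s%:E by rewrite fineK//; exact: integrable_fin_num iX2.
rewrite /variance unlock unlock /= -/mu.
transitivity (\int[P]_w ((X w ^+ 2)%:E + ((- (2 * mu))%:E * (X w)%:E + (mu ^+ 2)%:E))).
  apply: eq_integral => w _; rewrite -EFinM -!EFinD; congr EFin.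
  rewrite -[LHS]/((X w - mu) * (X w - mu))%R; ring.
have i3 : P.-integrable setT (fun w => (- (2 * mu))%:E * (X w)%:E) by exact: integrableZl.
have i4 : P.-integrable setT (cst (mu ^+ 2)%:E) by exact: finite_measure_integrable_cst.
rewrite integralD//; last exact: integrableD.
rewrite integralD// integralZl// integral_cst// [X in _ + (_ + _ * X)](probability_setT P).
rewrite mule1 sE muE -EFinM -!EFinD; congr EFin.
by ring.
Qed.

Lemma variance_ae_eq (X X' : T -> R) : measurable_fun [set: T] X ->
  measurable_fun [set: T] X' -> {ae P, forall w, X w = X' w} ->
  'V_P[X] = 'V_P[X'].
Proof.
move=> mX mX' XX'; rewrite /variance unlock unlock /=.
have -> : (\int[P]_w (X w)%:E = \int[P]_w (X' w)%:E)%E.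
  apply: ae_eq_integral => //; [exact/measurable_EFinP|exact/measurable_EFinP|].
  by move: XX'; apply: filterS => w ->.
apply: ae_eq_integral => //.
- by apply/measurable_EFinP; apply: measurable_funM; exact: measurable_funB.
- by apply/measurable_EFinP; apply: measurable_funM; exact: measurable_funB.
- move: XX'; apply: filterS => w Xw _; congr EFin.
  rewrite -[LHS]/((X w - fine (\int[P]_w (X' w)%:E)) * (X w - fine (\int[P]_w (X' w)%:E)))%R.
  by rewrite Xw.
Qed.

End bounded_variance.

Section csurv_fixpoint.
Context {R : realType} d (T : measurableType d) (P : probability T R)
  (V : {RV P >-> R}).
Hypothesis cV : continuous (cdf V).
Hypothesis V0 : cdf V 0 = 0%E.

(** If the value exceeded [u], continuity would keep it above [u] slightly to the right, against
    maximality of the quantile. *)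
Lemma csurv_survq u : 0 < u <= 1 -> csurv V (survq (csurv V) u) = u.
Proof.
move=> u01; have sV := survival_csurv cV V0.
have uq : u <= csurv V (survq (csurv V) u) by rewrite -le_survq.
apply/eqP; rewrite eq_le uq andbT leNgt; apply/negP => uc.
have h : \forall v \near (survq (csurv V) u)^'+, u < csurv V v.
  exact: (cvgr_gt _ (cvg_at_right_filter (@continuous_csurv _ _ _ _ V cV _))).
near (survq (csurv V) u)^'+ => v.
have qv : survq (csurv V) u < v by near: v; exact: nbhs_right_gt.
have : v <= survq (csurv V) u by rewrite le_survq// ltW//; near: v.
by rewrite leNgt qv.
Unshelve. all: by end_near. Qed.

(** The substitution [y = survq u] turns [csurv y] into [u], so the value is the same for all such
    laws. *)
Lemma integral_csurv_var :
  (\int[distribution P V]_y (csurv V y - csurv V y ^+ 2)%:E =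
   \int[unif]_u (u - u ^+ 2)%:E)%E.
Proof.
have sV := survival_csurv cV V0.
have [hm h1 _ h0 _] := sV.
have c01 v : 0 <= csurv V v - csurv V v ^+ 2.
  have c1 : csurv V v <= 1.
    by have [v0|v0] := leP v 0; [rewrite h1|rewrite -(h1 0)// hm// ltW].
  by rewrite subr_ge0 -[leRHS]mulr1 expr2 ler_wpM2l.
have mc : measurable_fun [set: R] (fun v => (csurv V v - csurv V v ^+ 2)%:E).
  apply/measurable_EFinP; have mc : measurable_fun [set: R] (csurv V).
    by apply: continuous_measurable_fun; exact: continuous_csurv.
  by apply: measurable_funB => //; exact: measurable_funX.
rewrite ge0_integral_distribution//; apply: (etrans (ge0_integral_csurv cV V0 mc _)) => //.
apply: ae_eq_integral => //.
- exact: (measurableT_comp mc (measurable_survq1 sV)).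
- by apply/measurable_EFinP; apply: measurable_funB => //; exact: measurable_funX.
exists (~` [set` `]0, 1]]); split; [exact: measurableC|exact: unif_setC_itv|].
move=> u /= h; rewrite in_itv/= => u01; apply: h => _.
by rewrite csurv_survq.
Qed.

End csurv_fixpoint.

Section singleton.
Context {R : realType} {d : measure_display} {T : measurableType d}
  (P : probability T R) (V : {RV P >-> R}).

Lemma measurable_singleton_tuple : measurable_fun [set: T] (fun w => [tuple V w]).
Proof.
apply/measurable_fun_tnthP => i.
by rewrite (_ : _ \o _ = V)//; apply/funext => w /=; rewrite (tnth_nth 0) ord1.
Qed.

(** Lets the density and convergence results for tuples apply, with [m = 1], to the law of [V]. *)
Definition singleton_vector : {RV P >-> 1.-tuple R} := mfun_of measurable_singleton_tuple.

End singleton.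

(** * The coefficient xi through second moments *)

Section dependence.
Context {R : realType} {e : measure_display} {U : measurableType e}
  (Q : probability U R) (rad : {RV Q >-> R}) (D m : nat)
  {d : measure_display} {T : measurableType d}
  (P : probability T R) (V : {RV P >-> R}) (Z : {RV P >-> m.-tuple R}).
Hypothesis rrad : radial rad.
Hypothesis m0 : (0 < m)%N.
Hypothesis mD : (m <= D)%N.
Hypothesis VZ : l1_pair rad D V Z.
Hypothesis V1 : l1_law rad D (singleton_vector V).

Notation t := (tail rad D).

Lemma singleton_tail v : P (V @^-1` [set` `[v, +oo[]) = (t v)%:E.
Proof.
rewrite -mean_density_tail//.
have -> : Num.max 0 v = psum [tuple v] by rewrite /psum big_ord1.
rewrite -V1; congr (P _); apply/seteqP; split => w /=.
  by rewrite in_itv/= andbT => vV i; rewrite ord1.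
by move=> /(_ ord0); rewrite in_itv/= andbT.
Qed.

Lemma tail01 v : 0 <= t v <= 1.
Proof.
apply/andP; split; first exact: hdens_ge0.
by rewrite -lee_fin -singleton_tail; apply: probability_le1; exact: measurable_funPTI.
Qed.

Let sG z := survival_cond_surv rrad m0 mD z.
Let mG v := measurable_cond_surv (m := m) rrad D v.

Lemma cond_surv01 (z : m.-tuple R) v : 0 <= cond_surv rad D z v <= 1.
Proof.
have [hm h1 _ h0 _] := sG z; rewrite h0/=.
by have [v0|v0] := leP v 0; [rewrite h1|rewrite -(h1 0)// hm// ltW].
Qed.

(** The expectation of P(V >= v | Z)^2. *)
Definition second_moment (v : R) : R :=
  fine (\int[distribution P Z]_z (cond_surv rad D z v ^+ 2)%:E)%E.

Lemma integral_cond_surv v :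
  (\int[distribution P Z]_z (cond_surv rad D z v)%:E)%E = (t v)%:E.
Proof.
rewrite -singleton_tail -[X in P X]setIT -(preimage_setT Z).
exact/esym/(l1_pair_joint rrad m0 mD VZ).
Qed.

Let m2 v : measurable_fun [set: m.-tuple R] (fun z => cond_surv rad D z v ^+ 2).
Proof. exact: measurable_funX. Qed.

Let i2 v : (distribution P Z).-integrable setT (EFin \o (fun z => cond_surv rad D z v ^+ 2)).
Proof.
apply: (@bounded_integrable R _ _ (distribution P Z) _ 1 (m2 v)) => z.
by have /andP[h0 h1] := cond_surv01 z v; rewrite normrX ger0_norm// expr_le1.
Qed.

Lemma second_momentE v :
  (\int[distribution P Z]_z (cond_surv rad D z v ^+ 2)%:E)%E = (second_moment v)%:E.
Proof. by rewrite fineK//; exact: integrable_fin_num (i2 v). Qed.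

Lemma second_moment_le v : second_moment v <= t v.
Proof.
rewrite -lee_fin -second_momentE -integral_cond_surv.
apply: ge0_le_integral => //.
- by move=> z _; rewrite lee_fin sqr_ge0.
- by apply/measurable_EFinP; exact: m2.
- by apply/measurable_EFinP; exact: mG.
- move=> z _; have /andP[h0 h1] := cond_surv01 z v.
  by rewrite lee_fin expr2 ler_piMl.
Qed.

Lemma second_moment_nonincreasing v w : v <= w -> second_moment w <= second_moment v.
Proof.
move=> vw; rewrite -lee_fin -!second_momentE.
apply: ge0_le_integral => //.
- by move=> z _; rewrite lee_fin sqr_ge0.
- by apply/measurable_EFinP; exact: m2.
- by apply/measurable_EFinP; exact: m2.
- move=> z _; have [hm _ _ h0 _] := sG z.
  by rewrite lee_fin lerXn2r ?nnegrE// hm.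
Qed.

Lemma measurable_second_moment : measurable_fun [set: R] second_moment.
Proof.
have h : measurable_fun [set: R] (fun v => - second_moment v).
  by apply: nondecreasing_measurable => // v w vw; rewrite lerN2 second_moment_nonincreasing.
rewrite (_ : second_moment = (fun v => - (- second_moment v))); first exact: measurable_funN.
by apply/funext => v; rewrite opprK.
Qed.

Lemma measurable_tail : measurable_fun [set: R] t.
Proof. by apply: continuous_measurable_fun; exact: continuous_tail. Qed.

(** The chosen version may differ from [cond_surv] on a null set of [z]; pulled back along [Z] this
    is a null event, invisible to the variance. The mean is [tail], by the tower property. *)
Lemma variance_cond_prob v :
  'V_P[cond_prob P [set w | (v <= V w)%R] Z \o Z] = (second_moment v - t v ^+ 2)%:E.
Proof.
have mZ : measurable_fun [set: T] Z by exact: measurable_funPT.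
have E : [set w | v <= V w] = V @^-1` [set` `[v, +oo[].
  by apply/seteqP; split => w /=; rewrite in_itv/= andbT.
have mE : measurable [set w | v <= V w] by rewrite E; exact: measurable_funPTI.
have [ic _] := cond_probP Z mE.
have mc : measurable_fun [set: m.-tuple R] (cond_prob P [set w | v <= V w] Z).
  by apply/measurable_EFinP; exact: measurable_int ic.
have mGZ : measurable_fun [set: T] (fun w => cond_surv rad D (Z w) v).
  exact: (measurableT_comp (mG v) mZ).
rewrite (@variance_ae_eq _ _ _ P _ (fun w => cond_surv rad D (Z w) v)).
- rewrite bounded_variance//; last first.
    by move=> w; have /andP[h0 h1] := cond_surv01 (Z w) v; rewrite ger0_norm.
  congr (_ - _ ^+ 2)%:E.
    congr fine; rewrite ge0_integral_distribution//.
      by apply/measurable_EFinP; exact: m2.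
    by move=> z; rewrite lee_fin sqr_ge0.
  apply: EFin_inj; rewrite -integral_cond_surv ge0_integral_distribution//.
  + rewrite fineK//; apply: (integrable_fin_num measurableT).
    apply: (@bounded_integrable R _ _ P _ 1 mGZ) => w.
    by have /andP[h0 h1] := cond_surv01 (Z w) v; rewrite ger0_norm.
  + by apply/measurable_EFinP; exact: mG.
  + by move=> z; have /andP[h0 _] := cond_surv01 z v; rewrite lee_fin.
- exact: (measurableT_comp mc mZ).
- exact: mGZ.
- have [N [mN N0 NS]] := cond_prob_survival sG mG (l1_pair_joint rrad m0 mD VZ) v.
  exists (Z @^-1` N); split => //; first exact: measurable_funPTI.
  by move=> w /= h; apply: NS.
Qed.

Lemma variance_indic v :
  'V_P[\1_[set w | (v <= V w)%R]] = (t v - t v ^+ 2)%:E.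
Proof.
have E : [set w | v <= V w] = V @^-1` [set` `[v, +oo[].
  by apply/seteqP; split => w /=; rewrite in_itv/= andbT.
have mE : measurable [set w | v <= V w] by rewrite E; exact: measurable_funPTI.
have I : (\int[P]_w (\1_[set w | v <= V w] w)%:E = (t v)%:E)%E.
  by rewrite integral_indic// setIT E; exact: singleton_tail.
rewrite bounded_variance//; last first.
  by move=> w; rewrite indicE; case: (_ \in _); rewrite ?normr1 ?normr0.
rewrite I (_ : (\int[P]_w _)%E = (t v)%:E)// -I; apply: eq_integral => w _.
by rewrite indicE; case: (_ \in _); rewrite ?expr1n ?expr0n.
Qed.

Definition xi_num : \bar R := (\int[distribution P V]_y (second_moment y - t y ^+ 2)%:E)%E.
(** Its value 1/6 is never computed; what counts is that no law enters. *)
Definition xi_den : \bar R := (\int[unif]_u (u - u ^+ 2)%:E)%E.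

Lemma var_ge0 y : 0 <= second_moment y - t y ^+ 2.
Proof. by rewrite -lee_fin -variance_cond_prob variance_ge0. Qed.

Lemma measurable_var : measurable_fun [set: R] (fun y => second_moment y - t y ^+ 2).
Proof.
apply: measurable_funB; first exact: measurable_second_moment.
by apply: measurable_funX; exact: measurable_tail.
Qed.

Lemma xi_denE : (\int[distribution P V]_y (t y - t y ^+ 2)%:E)%E = xi_den.
Proof.
rewrite /xi_den -(integral_csurv_var (continuous_cdf_tail rrad singleton_tail)
  (cdf_tail0 rrad singleton_tail)).
by apply: eq_integral => y _; rewrite (csurv_tail rrad singleton_tail).
Qed.

Lemma xiE : xi P V Z = fine xi_num / fine xi_den.
Proof.
rewrite /xi -xi_denE; congr (fine _ / fine _).
  by apply: eq_integral => y _; exact: variance_cond_prob.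
by apply: eq_integral => y _; exact: variance_indic.
Qed.

Lemma xi_num_le : (xi_num <= xi_den)%E.
Proof.
rewrite -xi_denE; apply: ge0_le_integral => //.
- by move=> y _; rewrite lee_fin var_ge0.
- by apply/measurable_EFinP; exact: measurable_var.
- apply/measurable_EFinP; apply: measurable_funB; first exact: measurable_tail.
  by apply: measurable_funX; exact: measurable_tail.
- by move=> y _; rewrite lee_fin lerB// second_moment_le.
Qed.

Lemma xi_num_ge0 : (0 <= xi_num)%E.
Proof. by apply: integral_ge0 => y _; rewrite lee_fin var_ge0. Qed.

Lemma xi_den_fin : xi_den \is a fin_num.
Proof.
rewrite -xi_denE; apply: (integrable_fin_num measurableT).
have mt := measurable_tail.
apply: (@bounded_integrable R _ _ (distribution P V) (fun y => t y - t y ^+ 2) 1).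
  by apply: measurable_funB => //; exact: measurable_funX.
move=> y; have /andP[h0 h1] := tail01 y.
have h2 : 0 <= t y ^+ 2 <= 1 by rewrite sqr_ge0 expr_le1.
by rewrite ler_norml; apply/andP; split; lra.
Qed.

Lemma xi_num_fin : xi_num \is a fin_num.
Proof.
by rewrite ge0_fin_numE ?xi_num_ge0// (le_lt_trans xi_num_le)// ltey_eq xi_den_fin.
Qed.

(** Conditioning cannot increase the variance of an indicator. The bound keeps the denominator of T
    away from 0. *)
Lemma xi_le1 : xi P V Z <= 1.
Proof.
rewrite xiE; have h : fine xi_num <= fine xi_den.
  by rewrite fine_le ?xi_num_fin ?xi_den_fin// xi_num_le.
have [d0|d0] := ltP 0 (fine xi_den); first by rewrite ler_pdivrMr// mul1r.
have -> : fine xi_den = 0.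
  by apply/eqP; rewrite eq_le d0 fine_ge0// (le_trans xi_num_ge0 xi_num_le).
by rewrite invr0 mulr0.
Qed.

Lemma xi_num_singleton :
  xi_num = (\int[distribution P (singleton_vector V)]_z
    (second_moment (tnth z ord0) - t (tnth z ord0) ^+ 2)%:E)%E.
Proof.
rewrite /xi_num ge0_integral_distribution//; last 2 first.
- by apply/measurable_EFinP; exact: measurable_var.
- by move=> y; rewrite lee_fin var_ge0.
rewrite ge0_integral_distribution//.
- by apply/measurable_EFinP; exact: (measurableT_comp measurable_var (measurable_tnth ord0)).
- by move=> z; rewrite lee_fin var_ge0.
Qed.

End dependence.

(** * Convergence of xi *)

Section xi_convergence.
Context {R : realType} (D m : nat).
Context (en : nat -> measure_display) (Un : forall n, measurableType (en n))
  (Qn : forall n, probability (Un n) R) (radn : forall n, {RV (Qn n) >-> R}).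
Context (e : measure_display) (U : measurableType e) (Q : probability U R)
  (rad : {RV Q >-> R}).
Context (dn : nat -> measure_display) (Tn : forall n, measurableType (dn n))
  (Pn : forall n, probability (Tn n) R) (Vn : forall n, {RV (Pn n) >-> R})
  (Zn : forall n, {RV (Pn n) >-> m.-tuple R}).
Context (d : measure_display) (T : measurableType d) (P : probability T R)
  (V : {RV P >-> R}) (Z : {RV P >-> m.-tuple R}).
Hypothesis rrn : forall n, radial (radn n).
Hypothesis rr : radial rad.
Hypothesis radc : forall v, csurv (radn n) v @[n --> \oo] --> csurv rad v.
Hypothesis m0 : (0 < m)%N.
Hypothesis mD : (m <= D)%N.
Hypothesis VZn : forall n, l1_pair (radn n) D (Vn n) (Zn n).
Hypothesis VZ : l1_pair rad D V Z.
Hypothesis V1n : forall n, l1_law (radn n) D (singleton_vector (Vn n)).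
Hypothesis V1 : l1_law rad D (singleton_vector V).

Lemma tail_cvg v : tail (radn n) D v @[n --> \oo] --> tail rad D v.
Proof.
apply: (@hdens_cvg R _ _ _ _ _ _ _ rad D D (fun=> Num.max 0 v) 0) => //.
- by rewrite subnn.
- by move=> n; rewrite le_max lexx.
- exact: cvg_cst.
Qed.

Lemma second_moment_cvg v :
  second_moment (radn n) D (Zn n) v @[n --> \oo] --> second_moment rad D Z v.
Proof.
apply: fine_cvg; rewrite -(second_momentE Z rr m0 mD).
apply: (l1_law_integral_cvg (M := 1) rrn rr radc m0 mD) => //.
- by move=> n; have [] := VZn n.
- by have [] := VZ.
- by move=> n; apply: measurable_funX; exact: measurable_cond_surv.
- by apply: measurable_funX; exact: measurable_cond_surv.
- move=> n z; have /andP[h0 h1] := cond_surv01 (rrn n) m0 mD z v.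
  by rewrite normrX ger0_norm// expr_le1.
- move=> z; have /andP[h0 h1] := cond_surv01 rr m0 mD z v.
  by rewrite normrX ger0_norm// expr_le1.
- by move=> z z0; have h := cond_surv_cvg rrn rr radc (v := v) z0; rewrite expr2; exact: cvgM.
Qed.

Let var_le1 (e' : measure_display) (U' : measurableType e') (Q' : probability U' R)
  (rad' : {RV Q' >-> R}) (d' : measure_display) (T' : measurableType d')
  (P' : probability T' R) (V' : {RV P' >-> R}) (Z' : {RV P' >-> m.-tuple R}) y :
  radial rad' -> l1_pair rad' D V' Z' -> l1_law rad' D (singleton_vector V') ->
  `|second_moment rad' D Z' y - tail rad' D y ^+ 2| <= 1.
Proof.
move=> r' VZ' V1'; have h := var_ge0 r' m0 mD VZ' V1' y.
rewrite ger0_norm//; have /andP[_ t1] := tail01 r' V1' y.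
have s1 := second_moment_le r' m0 mD VZ' V1' y.
by have s2 := sqr_ge0 (tail rad' D y); lra.
Qed.

(** The denominators coincide. In the numerators the integrands converge by the theorem on [m]
    coordinates, and the integrals against the moving law of [V] by the same theorem with [m = 1]; 1
    bounds the conditional variances. *)
Lemma xi_cvg : xi (Pn n) (Vn n) (Zn n) @[n --> \oo] --> xi P V Z.
Proof.
rewrite (xiE rr m0 mD VZ V1).
rewrite (_ : (fun n => _) = (fun n => fine (xi_num (radn n) D (Vn n) (Zn n)) / fine xi_den));
  last by apply/funext => n; exact: xiE.
apply: cvgMr_tmp; apply: fine_cvg; rewrite fineK ?(xi_num_fin rr)//.
rewrite (xi_num_singleton rr m0 mD VZ V1).
rewrite (_ : (fun n => _) = (fun n => \int[distribution (Pn n) (singleton_vector (Vn n))]_z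
    (second_moment (radn n) D (Zn n) (tnth z ord0) -
     tail (radn n) D (tnth z ord0) ^+ 2)%:E)%E);
  last by apply/funext => n; exact: xi_num_singleton.
apply: (l1_law_integral_cvg (M := 1) rrn rr radc (m := 1) isT (leq_trans m0 mD)) => //.
- by move=> n; exact: (measurableT_comp (measurable_var _ (rrn n) m0 mD) (measurable_tnth ord0)).
- exact: (measurableT_comp (measurable_var _ rr m0 mD) (measurable_tnth ord0)).
- by move=> n z; exact: (var_le1 _ (rrn n) (VZn n) (V1n n)).
- by move=> z; exact: (var_le1 _ rr VZ V1).
- move=> z _; apply: cvgB; first exact: second_moment_cvg.
  by rewrite expr2; apply: cvgM; exact: tail_cvg.
Qed.

End xi_convergence.

(** * Coordinates of a joined vector *)

Section join_vector.
Context {R : realType} {e : measure_display} {U : measurableType e}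
  (Q : probability U R) (rad : {RV Q >-> R}) (D q p : nat)
  {d : measure_display} {T : measurableType d} (P : probability T R)
  (Y : {RV P >-> q.-tuple R}) (X : {RV P >-> p.-tuple R}).
Hypothesis rrad : radial rad.
Hypothesis lawYX : l1_law rad D (join_vector Y X).

Let inl_preceding (i : 'I_q) (l : 'I_i) := lshift p (widen_ord (ltnW (ltn_ord i)) l).

Let inl_preceding_inj i : injective (inl_preceding (i := i)).
Proof. by move=> l l' /lshift_inj/(congr1 val)/= /ord_inj. Qed.

Let inl_precedingN (i : 'I_q) (l : 'I_i) : inl_preceding l != lshift p i.
Proof. by rewrite -val_eqE/= ltn_eqF. Qed.

Let componentE (i : 'I_q) w : component Y i w = tnth (join_vector Y X w) (lshift p i).
Proof. by rewrite tnth_lshift. Qed.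

Let rshiftE l w : tnth (X w) l = tnth (join_vector Y X w) (rshift q l).
Proof. by rewrite tnth_rshift. Qed.

Let precedingE (i : 'I_q) l w :
  tnth (preceding Y i w) l = tnth (join_vector Y X w) (inl_preceding l).
Proof. by rewrite tnth_lshift tnth_mktuple. Qed.

Let preceding_revE (i : 'I_q) l w :
  tnth (preceding_rev Y i w) l = tnth (join_vector Y X w) (inl_preceding (rev_ord l)).
Proof. by rewrite tnth_lshift tnth_mktuple. Qed.

Lemma l1_law_component (i : 'I_q) : l1_law rad D (singleton_vector (component Y i)).
Proof.
apply: (l1_law_sub rrad lawYX (f := fun=> lshift p i)) => [l l' _|w l].
  by rewrite !ord1.
by rewrite -componentE (tnth_nth 0) ord1.
Qed.

Lemma l1_pair_others (i : 'I_q) : l1_pair rad D (component Y i) X.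
Proof.
apply: (l1_pair_sub rrad lawYX (k0 := lshift p i) (f := @rshift q p)) => //.
- exact: rshift_inj.
- by move=> l; rewrite eq_rlshift.
Qed.

Lemma l1_pair_preceding (i : 'I_q) : l1_pair rad D (component Y i) (preceding Y i).
Proof.
by apply: (l1_pair_sub rrad lawYX (k0 := lshift p i) (f := @inl_preceding i)).
Qed.

Lemma l1_pair_preceding_rev (i : 'I_q) :
  l1_pair rad D (component Y i) (preceding_rev Y i).
Proof.
apply: (l1_pair_sub rrad lawYX (k0 := lshift p i)
  (f := fun l => inl_preceding (rev_ord l))) => // l l'.
by move=> /inl_preceding_inj/rev_ord_inj.
Qed.

Lemma l1_pair_preceding_join (i : 'I_q) :
  l1_pair rad D (component Y i) (join_vector (preceding Y i) X).
Proof.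
pose f (l : 'I_(i + p)) :=
  match fintype.split l with inl l' => inl_preceding l' | inr l' => rshift q l' end.
apply: (l1_pair_sub rrad lawYX (k0 := lshift p i) (f := f)) => //.
- move=> l l'; rewrite /f.
  case: (split_ordP l) => k ->; case: (split_ordP l') => k' ->.
  + by move=> /inl_preceding_inj ->.
  + by move=> /eqP; rewrite eq_lrshift.
  + by move=> /eqP; rewrite eq_rlshift.
  + by move=> /rshift_inj ->.
- by move=> l; rewrite /f; case: fintype.split => k //; rewrite eq_rlshift.
- move=> w l; rewrite /f; case: (split_ordP l) => k ->.
    by rewrite [LHS]tnth_lshift precedingE.
  by rewrite [LHS]tnth_rshift rshiftE.
Qed.

(** T conditions on [X] followed by the earlier components in decreasing order, the Markov products
    on the increasing order followed by [X]; both are injective selections of coordinates. *)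
Lemma l1_pair_join_preceding_rev (i : 'I_q) :
  l1_pair rad D (component Y i) (join_vector X (preceding_rev Y i)).
Proof.
pose f (l : 'I_(p + i)) :=
  match fintype.split l with inl l' => rshift q l' | inr l' => inl_preceding (rev_ord l') end.
apply: (l1_pair_sub rrad lawYX (k0 := lshift p i) (f := f)) => //.
- move=> l l'; rewrite /f.
  case: (split_ordP l) => k ->; case: (split_ordP l') => k' ->.
  + by move=> /rshift_inj ->.
  + by move=> /eqP; rewrite eq_rlshift.
  + by move=> /eqP; rewrite eq_lrshift.
  + by move=> /inl_preceding_inj/rev_ord_inj ->.
- by move=> l; rewrite /f; case: fintype.split => k //; rewrite eq_rlshift.
- move=> w l; rewrite /f; case: (split_ordP l) => k ->.
    by rewrite [LHS]tnth_lshift rshiftE.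
  by rewrite [LHS]tnth_rshift preceding_revE.
Qed.

End join_vector.

(** * From the symmetry hypotheses to the limits *)

Lemma l1_symmetric_law {R : realType} {e : measure_display} {U : measurableType e}
    (Q : probability U R) (rad : {RV Q >-> R}) k {d : measure_display}
    {T : measurableType d} (P : probability T R) (W : {RV P >-> k.-tuple R}) :
  (0 < k)%N -> cdf rad 0 = 0%E -> l1_symmetric_with P W Q rad ->
  l1_law rad k.-1 W.
Proof. by case: k W => // k W _; exact: l1_symmetric_orthant. Qed.

Theorem theorem5p7 (R : realType) (q p : nat) (q_gt0 : (0 < q)%N)
  (p_gt0 : (0 < p)%N)
  (dn : nat -> measure_display) (Tn : forall n, measurableType (dn n))
  (Pn : forall n, probability (Tn n) R)
  (Yn : forall n, {RV (Pn n) >-> q.-tuple R})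
  (Xn : forall n, {RV (Pn n) >-> p.-tuple R})
  (en : nat -> measure_display) (Un : forall n, measurableType (en n))
  (Qn : forall n, probability (Un n) R)
  (radn : forall n, {RV (Qn n) >-> R})
  (d : measure_display) (T : measurableType d) (P : probability T R)
  (Y : {RV P >-> q.-tuple R}) (X : {RV P >-> p.-tuple R})
  (e : measure_display) (U : measurableType e) (Q : probability U R)
  (rad : {RV Q >-> R})
  (symn : forall n, l1_symmetric_with (Pn n) (join_vector (Yn n) (Xn n)) (Qn n) (radn n))
  (sym : l1_symmetric_with P (join_vector Y X) Q rad)
  (cdfn_continuous : forall n, continuous (cdf (radn n)))
  (cdf_continuous : continuous (cdf rad))
  (cdfn0 : forall n, cdf (radn n) 0 = 0%E)
  (cdf0 : cdf rad 0 = 0%E)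
  (rad_cvg : cvg_in_distribution Qn radn Q rad) :
  [/\ [/\ markov_products_cvg Pn P
            (fun n => component (Yn n) (Ordinal q_gt0)) Xn
            (component Y (Ordinal q_gt0)) X,
          forall i : 'I_q, (0 < i)%N ->
            markov_products_cvg Pn P
              (fun n => component (Yn n) i)
              (fun n => join_vector (preceding (Yn n) i) (Xn n))
              (component Y i) (join_vector (preceding Y i) X) &
          forall i : 'I_q, (0 < i)%N ->
            markov_products_cvg Pn P
              (fun n => component (Yn n) i) (fun n => preceding (Yn n) i)
              (component Y i) (preceding Y i)],
      forall i : 'I_q,
        {ae @lebesgue_measure R, forall t : R, 0 < t < 1 ->
          cdf (component (Yn n) i) (quantile (component (Yn n) i) t)
            @[n --> \oo]
          --> cdf (component Y i) (quantile (component Y i) t)} &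
      dependence_T (Pn n) (Yn n) (Xn n) @[n --> \oo] --> dependence_T P Y X].
Proof.
have k0 : (0 < q + p)%N by rewrite addn_gt0 q_gt0.
have rrn n : radial (radn n) by have [r0 _] := symn n.
have rr : radial rad by have [r0 _] := sym.
have radc v : csurv (radn n) v @[n --> \oo] --> csurv rad v by exact: csurv_cvg.
have Ln n := l1_symmetric_law k0 (cdfn0 n) (symn n).
have L := l1_symmetric_law k0 cdf0 sym.
have V1n n i := l1_law_component (rrn n) (Ln n) i.
have V1 i := l1_law_component rr L i.
(* With [D = q + p - 1], this is [m <= D] for all conditioning vectors: [j] is [p] or 0 according to
   whether [X] is included. *)
have ltD i j : (i < q)%N -> (j <= p)%N -> (i + j <= (q + p).-1)%N.
  by move=> iq jp; rewrite -ltnS prednK// -addSn leq_add.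
have xi_rev_cvg (i : 'I_q) : (0 < i)%N ->
    xi (Pn n) (component (Yn n) i) (preceding_rev (Yn n) i) @[n --> \oo] -->
    xi P (component Y i) (preceding_rev Y i).
  move=> i0; have iD := ltD i 0%N (ltn_ord i) isT; rewrite addn0 in iD.
  apply: (xi_cvg rrn rr radc i0 iD) => // [n|].
  + exact: l1_pair_preceding_rev (rrn n) (Ln n) i.
  + exact: l1_pair_preceding_rev rr L i.
split; first split.
- apply: (l1_pair_markov_cvg rrn rr radc p_gt0 (ltD 0%N p q_gt0 (leqnn p))) => [n|].
    exact: l1_pair_others (rrn n) (Ln n) _.
  exact: l1_pair_others rr L _.
- move=> i i0; apply: (l1_pair_markov_cvg rrn rr radc _ (ltD i p (ltn_ord i) (leqnn p))) => [|n|].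
  + by rewrite addn_gt0 i0.
  + exact: l1_pair_preceding_join (rrn n) (Ln n) i.
  + exact: l1_pair_preceding_join rr L i.
- move=> i i0; have iD := ltD i 0%N (ltn_ord i) isT; rewrite addn0 in iD.
  apply: (l1_pair_markov_cvg rrn rr radc i0 iD) => [n|].
  + exact: l1_pair_preceding (rrn n) (Ln n) i.
  + exact: l1_pair_preceding rr L i.
(* For every [t] in []0, 1[] both sides equal [t]. *)
- move=> i; apply: aeW => t t01.
  rewrite (cdf_quantile rr (singleton_tail rr (V1 i)) t01).
  rewrite (_ : (fun n => _) = fun=> t%:E); first exact: cvg_cst.
  apply/funext => n.
  exact: (cdf_quantile (rrn n) (singleton_tail (rrn n) (V1n n i)) t01).
- rewrite /dependence_T; apply: cvgB; first exact: cvg_cst.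
  apply: cvgM.
    apply: cvgB; first exact: cvg_cst.
    apply: cvg_big => [|i _]; first exact: add_continuous.
    have iD := ltD i p (ltn_ord i) (leqnn p); rewrite addnC in iD.
    apply: (xi_cvg rrn rr radc _ iD) => // [|n|].
    - by rewrite addn_gt0 p_gt0.
    - exact: l1_pair_join_preceding_rev (rrn n) (Ln n) i.
    - exact: l1_pair_join_preceding_rev rr L i.
  apply: cvgV.
    (* The denominator is the sum of the terms [1 - xi]: the one of index 0 equals 1 and the others
       are nonnegative, so the limit is positive. *)
    rewrite gt_eqF// -[X in X%:R - _](card_ord q) -sumr_const -sumrB.
    rewrite (bigD1 (Ordinal q_gt0))//= subr0 ltr_pwDl// sumr_ge0// => i _.
    case: ifPn => [_|i0]; first by rewrite subr0.
    have iD := ltD i 0%N (ltn_ord i) isT; rewrite addn0 in iD.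
    rewrite subr_ge0; apply: (xi_le1 rr _ iD) => //; first by rewrite lt0n.
    exact: l1_pair_preceding_rev rr L i.
  apply: cvgB; first exact: cvg_cst.
  apply: cvg_big => [|i _]; first exact: add_continuous.
  case: ifPn => [_|i0]; first exact: cvg_cst.
  by apply: xi_rev_cvg; rewrite lt0n.
Qed.
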